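(* Let $Z=Z_1\cup Z_2\subset\mathbb P^3_{\mathbb C}$ be the union of two multiplicity structures on smooth curves $C_1,C_2$ meeting at $p$, with respective multiplicities $m\le n$. Assume that $Z_i$ is contained in a local smooth surface $S_i$ ($i=1,2$), that $C_1$ is not tangent to $S_2$ at $p$, and that $C_2$ is not tangent to $S_1$ at $p$. Then the general surface $S$ containing $Z$ has an $\mathbf A_{n-1}$ singularity at $p$, and $C_1$ (resp. $C_2$) maps to $1$ (resp. $-1$) under the isomorphism $\operatorname{Cl}\widehat{\mathcal O}_{S,p}\cong\mathbb Z/n\mathbb Z$; that is, there is such an isomorphism for which these are the images.
   Context: A local smooth surface is a smooth surface defined in a neighbourhood of $p$ in $\mathbb P^3$. A multiplicity structure $Z_i$ of multiplicity $k$ on $C_i$ is a locally Cohen-Macaulay (no embedded points) scheme supported on $C_i$ of multiplicity $k$; so near $p$, being contained in $S_i$, it is the effective Cartier divisor $kC_i$ on $S_i$. ''General surface containing $Z$'' means a general member of $|H^0(\mathbb P^3,\mathcal I_Z(d))|$ for $d\gg0$. $S$ has an $\mathbf A_k$ singularity at $p$ if $\widehat{\mathcal O}_{S,p}\cong\mathbb C[[x,y,z]]/(xy-z^{k+1})$ ($\mathbf A_0$ meaning smooth). The image of $C_i$ is taken under the natural map $\operatorname{Cl} S\to\operatorname{Cl}\mathcal O_{S,p}\hookrightarrow\operatorname{Cl}\widehat{\mathcal O}_{S,p}$, i.e. the class of the ideal of $C_i$ in $\widehat{\mathcal O}_{S,p}$. *)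

(* Defs.v *)
From HB Require Import structures.
From mathcomp Require Import all_boot all_order all_algebra.
From mathcomp Require Import fraction generic_quotient ring_quotient.
From mathcomp Require Import boolp classical_sets reals.
From mathcomp Require Import complex mpoly freeg.

Set Implicit Arguments.
Unset Strict Implicit.
Unset Printing Implicit Defensive.

Import Order.TTheory GRing.Theory Num.Theory.
Local Open Scope classical_set_scope.
Local Open Scope quotient_scope.
Local Open Scope ring_scope.

Definition subgroup_span (V : zmodType) (X : set V) : {pred V} :=
  fun x => `[< forall H : set V, H 0 -> (forall y z, H y -> H z -> H (y - z)) ->
               X `<=` H -> H x >].

Lemma subgroup_span_zmod_closed (V : zmodType) (X : set V) :
  zmod_closed (subgroup_span X).
Proof.
split; first by apply/asboolP.
move=> x y /asboolP Hx /asboolP Hy; apply/asboolP => H H0 HB XH.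
by apply: (HB) => //; [exact: Hx | exact: Hy].
Qed.

HB.instance Definition _ (V : zmodType) (X : set V) :=
  GRing.isZmodClosed.Build V (subgroup_span X) (subgroup_span_zmod_closed X).

(* V / <X>, with X any subset of V *)
Definition zquot (V : zmodType) (X : set V) : zmodType :=
  Quotient.quot (subgroup_span X).

Definition zproj (V : zmodType) (X : set V) : V -> zquot X :=
  \pi_(Quotient.quot (subgroup_span X)).

Section Ideals.
Variable A : comPzRingType.
Implicit Types I J P Q : set A.

Definition is_ideal I :=
  [/\ I 0, forall x y, I x -> I y -> I (x + y) & forall a x, I x -> I (a * x)].

Definition ideal_span J : set A :=
  [set x | forall I, is_ideal I -> J `<=` I -> I x].

Definition is_prime P :=
  [/\ is_ideal P, ~ P 1 & forall x y, P (x * y) -> P x \/ P y].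

Fixpoint ideal_pow I k : set A :=
  if k is k'.+1 then
    ideal_span [set z | exists x y, [/\ I x, ideal_pow I k' y & z = x * y]]
  else setT.

Lemma is_ideal_span J : is_ideal (ideal_span J).
Proof.
split=> [I [] //|x y Hx Hy I II JI|a x Hx I II JI].
  by case: (II) => _ ID _; apply: ID; [exact: Hx | exact: Hy].
by case: (II) => _ _ IM; apply: IM; exact: Hx.
Qed.

Lemma is_idealN I x : is_ideal I -> I x -> I (- x).
Proof. by case=> _ _ IM /(IM (-1)); rewrite mulN1r. Qed.

Definition ideal_mem J : {pred A} := fun x => `[< ideal_span J x >].

Lemma ideal_mem_zmod_closed J : zmod_closed (ideal_mem J).
Proof.
have IJ := is_ideal_span J; have [I0 ID IM] := IJ.
split; first exact/asboolP.
by move=> x y /asboolP Hx /asboolP Hy; apply/asboolP; exact: ID Hx (is_idealN IJ Hy).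
Qed.

HB.instance Definition _ J :=
  GRing.isZmodClosed.Build A (ideal_mem J) (ideal_mem_zmod_closed J).

(* A / (J), with J any subset of A *)
Definition rquot J := Quotient.quot (ideal_mem J).

End Ideals.

Section QuotientRing.
Variables (A : comPzRingType) (J : set A).

HB.instance Definition _ := GRing.Zmodule.on (rquot J).

Definition rproj : A -> rquot J := \pi_(Quotient.quot (ideal_mem J)).
Definition rquot_mul (u v : rquot J) : rquot J := rproj (repr u * repr v).

Lemma rproj_surj (u : rquot J) : rproj (repr u) = u.
Proof. exact: reprK. Qed.

Lemma rprojP x y : rproj x = rproj y <-> ideal_span J (x - y).
Proof.
rewrite /rproj; split.
  by move/eqP; rewrite -Quotient.idealrBE => /asboolP.
by move=> h; apply/eqP; rewrite -Quotient.idealrBE; apply/asboolP.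
Qed.

Lemma rproj_is_zmod_morphism : zmod_morphism rproj.
Proof. exact: pi_is_zmod_morphism. Qed.

HB.instance Definition _ :=
  GRing.isZmodMorphism.Build A (rquot J) rproj rproj_is_zmod_morphism.

Lemma rprojM x y : rproj (x * y) = rquot_mul (rproj x) (rproj y).
Proof.
have [I0 ID IM] := is_ideal_span J; apply/rprojP.
set x' := repr _; set y' := repr _.
have -> : x * y - x' * y' = y * (x - x') + x' * (y - y').
  by rewrite !mulrBr (mulrC y x) (mulrC y x') addrA subrK.
by apply: ID; apply: IM; apply/rprojP; rewrite rproj_surj.
Qed.

Lemma rquot_mulA : associative rquot_mul.
Proof.
move=> u v w; rewrite -(rproj_surj u) -(rproj_surj v) -(rproj_surj w).
by rewrite -!rprojM mulrA.
Qed.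

Lemma rquot_mulC : commutative rquot_mul.
Proof.
by move=> u v; rewrite -(rproj_surj u) -(rproj_surj v) -!rprojM mulrC.
Qed.

Lemma rquot_mul1 : left_id (rproj 1) rquot_mul.
Proof. by move=> u; rewrite -(rproj_surj u) -rprojM mul1r. Qed.

Lemma rquot_mulDl : left_distributive rquot_mul +%R.
Proof.
move=> u v w; rewrite -(rproj_surj u) -(rproj_surj v) -(rproj_surj w).
by rewrite -raddfD -!rprojM mulrDl raddfD.
Qed.

HB.instance Definition _ := GRing.Zmodule_isComPzRing.Build (rquot J)
  rquot_mulA rquot_mulC rquot_mul1 rquot_mulDl.

Lemma rproj_is_monoid_morphism : monoid_morphism rproj.
Proof. by split=> // x y; exact: rprojM. Qed.

HB.instance Definition _ :=
  GRing.isMonoidMorphism.Build A (rquot J) rproj rproj_is_monoid_morphism.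

End QuotientRing.

Section Completion.
Variables (A : comPzRingType) (I : set A).

(* The completion is the inverse limit of the rings A / I^k. *)
Definition coherent (s : forall k, rquot (ideal_pow I k)) : Prop :=
  forall k, exists a : A, s k = rproj _ a /\ s k.+1 = rproj _ a.

Definition completion := {s : forall k, rquot (ideal_pow I k) | coherent s}.

HB.instance Definition _ := gen_eqMixin completion.
HB.instance Definition _ := gen_choiceMixin completion.

Lemma completion_eq (s t : completion) :
  (forall k, projT1 s k = projT1 t k) -> s = t.
Proof.
case: s t => [s Hs] [t Ht] /= st; apply: eq_exist.
exact: functional_extensionality_dep.
Qed.

Definition to_completion (a : A) : completion :=
  exist coherent (fun k => rproj _ a)
    (fun k => ex_intro _ a (conj erefl erefl)).

Lemma coherentD s t : coherent s -> coherent t -> coherent (fun k => s k + t k).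
Proof.
move=> Hs Ht k; have [a [-> ->]] := Hs k; have [b [-> ->]] := Ht k.
by exists (a + b); rewrite !raddfD.
Qed.

Lemma coherentN s : coherent s -> coherent (fun k => - s k).
Proof.
by move=> Hs k; have [a [-> ->]] := Hs k; exists (- a); rewrite !raddfN.
Qed.

Lemma coherentM s t : coherent s -> coherent t -> coherent (fun k => s k * t k).
Proof.
move=> Hs Ht k; have [a [-> ->]] := Hs k; have [b [-> ->]] := Ht k.
by exists (a * b); rewrite !rmorphM.
Qed.

Definition completion_add (s t : completion) : completion :=
  exist coherent _ (coherentD (projT2 s) (projT2 t)).
Definition completion_opp (s : completion) : completion :=
  exist coherent _ (coherentN (projT2 s)).
Definition completion_mul (s t : completion) : completion :=
  exist coherent _ (coherentM (projT2 s) (projT2 t)).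

Lemma completion_addA : associative completion_add.
Proof. by move=> s t u; apply: completion_eq => k /=; rewrite addrA. Qed.
Lemma completion_addC : commutative completion_add.
Proof. by move=> s t; apply: completion_eq => k /=; rewrite addrC. Qed.
Lemma completion_add0 : left_id (to_completion 0) completion_add.
Proof. by move=> s; apply: completion_eq => k /=; rewrite raddf0 add0r. Qed.
Lemma completion_addN :
  left_inverse (to_completion 0) completion_opp completion_add.
Proof. by move=> s; apply: completion_eq => k /=; rewrite raddf0 addNr. Qed.

HB.instance Definition _ := GRing.isZmodule.Build completion
  completion_addA completion_addC completion_add0 completion_addN.

Lemma completion_mulA : associative completion_mul.
Proof. by move=> s t u; apply: completion_eq => k /=; rewrite mulrA. Qed.
Lemma completion_mulC : commutative completion_mul.
Proof. by move=> s t; apply: completion_eq => k /=; rewrite mulrC. Qed.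
Lemma completion_mul1 : left_id (to_completion 1) completion_mul.
Proof. by move=> s; apply: completion_eq => k /=; rewrite rmorph1 mul1r. Qed.
Lemma completion_mulDl : left_distributive completion_mul +%R.
Proof. by move=> s t u; apply: completion_eq => k /=; rewrite mulrDl. Qed.

HB.instance Definition _ := GRing.Zmodule_isComPzRing.Build completion
  completion_mulA completion_mulC completion_mul1 completion_mulDl.

Lemma to_completion_is_zmod_morphism : zmod_morphism to_completion.
Proof. by move=> a b; apply: completion_eq => k /=; rewrite raddfB. Qed.
Lemma to_completion_is_monoid_morphism : monoid_morphism to_completion.
Proof. by split=> // a b; apply: completion_eq => k /=; rewrite rmorphM. Qed.

HB.instance Definition _ := GRing.isZmodMorphism.Build A completion
  to_completion to_completion_is_zmod_morphism.
HB.instance Definition _ := GRing.isMonoidMorphism.Build A completion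
  to_completion to_completion_is_monoid_morphism.

End Completion.

Section PowerSeries.
Variables (K : comNzRingType) (n : nat).

Definition fps := 'X_{1..n} -> K.
Implicit Types f g h : fps.

HB.instance Definition _ := gen_eqMixin fps.
HB.instance Definition _ := gen_choiceMixin fps.

Definition fps_const (c : K) : fps := fun m => if m == 0%MM then c else 0.
Definition fps_var (i : 'I_n) : fps := fun m => (m == U_(i)%MM)%:R.
Definition fps_add f g : fps := fun m => f m + g m.
Definition fps_opp f : fps := fun m => - f m.
Definition fps_mul f g : fps := fun m =>
  \sum_(k : 'X_{1..n < (mdeg m).+1, (mdeg m).+1} | m == (k.1 + k.2)%MM)
    f k.1 * g k.2.

Lemma fps_eq f g : (forall m, f m = g m) -> f = g.
Proof. exact: functional_extensionality_dep. Qed.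

Lemma fps_addA : associative fps_add.
Proof. by move=> f g h; apply: fps_eq => m; rewrite /fps_add addrA. Qed.
Lemma fps_addC : commutative fps_add.
Proof. by move=> f g; apply: fps_eq => m; rewrite /fps_add addrC. Qed.
Lemma fps_add0 : left_id (fps_const 0) fps_add.
Proof.
by move=> f; apply: fps_eq => m; rewrite /fps_add /fps_const if_same add0r.
Qed.
Lemma fps_addN : left_inverse (fps_const 0) fps_opp fps_add.
Proof.
move=> f; apply: fps_eq => m.
by rewrite /fps_add /fps_opp /fps_const if_same addNr.
Qed.

HB.instance Definition _ := GRing.isZmodule.Build fps
  fps_addA fps_addC fps_add0 fps_addN.

Definition fps_trunc d f : {mpoly K[n]} :=
  \sum_(m : 'X_{1..n < d}) f m *: 'X_[m].

Lemma fps_truncE d f (m : 'X_{1..n}) : (mdeg m < d)%N -> (fps_trunc d f)@_m = f m.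
Proof. by move=> md; rewrite /fps_trunc (mcoeff_mpoly f md). Qed.

Lemma fps_mulE d f g (m : 'X_{1..n}) : (mdeg m < d)%N ->
  fps_mul f g m = (fps_trunc d f * fps_trunc d g)@_m.
Proof.
move=> md; rewrite mcoeffM; apply: eq_bigr => -[k1 k2] _ /=.
by rewrite !fps_truncE //; apply: leq_trans (bmdeg _) _.
Qed.

Lemma fps_mulC : commutative fps_mul.
Proof.
move=> f g; apply: fps_eq => m.
by rewrite !(fps_mulE _ _ (ltnSn _)) mulrC.
Qed.

Lemma fps_mulA : associative fps_mul.
Proof.
move=> f g h; apply: fps_eq => m.
pose T := fps_trunc (mdeg m).+1.
transitivity ((T f * (T g * T h))@_m).
  rewrite mcoeffM; apply: eq_bigr => -[k1 k2] _ /=.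
  by rewrite fps_truncE ?bmdeg // (fps_mulE _ _ (bmdeg k2)).
rewrite mulrA mcoeffM; apply: eq_bigr => -[k1 k2] _ /=.
by rewrite fps_truncE ?bmdeg // (fps_mulE _ _ (bmdeg k1)).
Qed.

Lemma fps_mul1 : left_id (fps_const 1) fps_mul.
Proof.
move=> f; apply: fps_eq => m; rewrite (fps_mulE _ _ (ltnSn _)).
suff -> : fps_trunc (mdeg m).+1 (fps_const 1) = 1 by rewrite mul1r fps_truncE.
apply/mpolyP => k; rewrite mcoeff1.
case: (ltnP (mdeg k) (mdeg m).+1) => hk.
  by rewrite fps_truncE // /fps_const; case: eqP.
have /negPf -> : k != 0%MM by apply: contraTneq hk => ->; rewrite mdeg0.
rewrite /fps_trunc raddf_sum big1 // => i _; rewrite /= mcoeffZ mcoeffX.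
case: eqP => [ik|]; last by rewrite mulr0.
by move: hk; rewrite -ik leqNgt bmdeg.
Qed.

Lemma fps_mulDl : left_distributive fps_mul +%R.
Proof.
move=> f g h; apply: fps_eq => m.
transitivity (fps_mul f h m + fps_mul g h m) => //.
by rewrite /fps_mul -big_split /=; apply: eq_bigr => k _; rewrite -mulrDl.
Qed.

HB.instance Definition _ := GRing.Zmodule_isComPzRing.Build fps
  fps_mulA fps_mulC fps_mul1 fps_mulDl.

End PowerSeries.

Section LocalAlgebra.
Variable A : comPzRingType.
Implicit Types I P Q : set A.

Definition noetherian : Prop :=
  forall I, is_ideal I -> exists s : seq A, I = ideal_span [set` s].

Definition nonunits : set A := [set x | ~ exists y, x * y = 1].

(* The nonunits of a local ring are its maximal ideal; the zero ring is excluded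
   because there 0 is a unit. *)
Definition is_local : Prop := is_ideal nonunits.

Definition prime_chain d (c : nat -> set A) : Prop :=
  (forall i, (i <= d)%N -> is_prime (c i)) /\
  (forall i, (i < d)%N -> c i `<` c i.+1).

Definition krull_dim d : Prop :=
  (exists c, prime_chain d c) /\ ~ (exists c, prime_chain d.+1 c).

Definition is_height Q d : Prop :=
  (exists2 c, prime_chain d c & c d = Q) /\
  ~ (exists2 c, prime_chain d.+1 c & c d.+1 = Q).

Definition regular_local d : Prop :=
  [/\ noetherian, is_local, krull_dim d
    & exists x : 'I_d -> A, nonunits = ideal_span (range x)].

Definition regular_sequence d (x : 'I_d -> A) : Prop :=
  forall i : 'I_d, nonunits (x i) /\
    let I := ideal_span [set x j | j in [set j : 'I_d | (j < i)%N]] in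
    forall a, I (x i * a) -> I a.

(* depth = dimension *)
Definition cohen_macaulay_local : Prop :=
  [/\ noetherian, is_local
    & exists d, krull_dim d /\ exists x : 'I_d -> A, regular_sequence x].

Definition ideal_chain k (c : nat -> set A) : Prop :=
  (forall i, (i <= k)%N -> is_ideal (c i)) /\
  (forall i, (i < k)%N -> c i `<` c i.+1).

(* the length of A as an A-module *)
Definition ring_length k : Prop :=
  (exists c, ideal_chain k c) /\ ~ (exists c, ideal_chain k.+1 c).

End LocalAlgebra.

(* Meaningful for a Noetherian normal domain A. *)
Section ClassGroup.
Variable A : comPzRingType.

Definition prime_divisor :=
  {Q : set A | `[< is_prime Q /\ is_height Q 1 >]}.

Definition weil_divisor := {freeg prime_divisor / int}.

(* the contraction to A of (Q A_Q)^k, i.e. the elements of valuation >= k for the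
   discrete valuation ring A_Q *)
Definition symbolic_pow (Q : set A) k : set A :=
  [set f | exists2 s, ~ Q s & ideal_pow Q k (s * f)].

(* D = \sum_Q v_Q(I) Q, where v_Q(I) is the least valuation of an element of I *)
Definition is_divisor_of (I : set A) (D : weil_divisor) : Prop :=
  forall Q : prime_divisor, exists k : nat,
    [/\ coeff Q D = k%:Z, I `<=` symbolic_pow (sval Q) k
      & ~ I `<=` symbolic_pow (sval Q) k.+1].

(* The subgroup spanned by the divisors of nonzero elements of A contains those
   of all nonzero elements of Frac A. *)
Definition class_group : zmodType :=
  zquot [set D : weil_divisor |
          exists2 f : A, f != 0 & is_divisor_of (ideal_span [set f]) D].

Definition divisor_class : weil_divisor -> class_group :=
  @zproj weil_divisor _.

Definition is_class_of (I : set A) (c : class_group) : Prop :=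
  exists2 D, is_divisor_of I D & c = divisor_class D.

End ClassGroup.

(* Z/nZ, the trivial group when n = 1 *)
Definition Zmod (n : nat) : zmodType := zquot [set n%:Z].
Definition Zmod_proj (n : nat) : int -> Zmod n := @zproj int [set n%:Z].

(* A closed subscheme of P^3 is given by its saturated homogeneous ideal, and a
   scheme-theoretic point by a homogeneous prime not containing all variables. *)

Section Projective.
Variable K : fieldType.
Local Notation S := {mpoly K[4]}.
Implicit Types I J : set S.

Definition homogeneous_ideal I : Prop :=
  is_ideal I /\ forall f d, I f -> I (pihomog mdeg d f).

Definition saturated I : Prop :=
  forall f, (exists N, forall i : 'I_4, I ('X_i ^+ N * f)) -> I f.

Definition closed_subscheme I : Prop := homogeneous_ideal I /\ saturated I.

Record ppoint := PPoint {
  pt_ideal : set S;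
  pt_homogeneous : homogeneous_ideal pt_ideal;
  pt_prime : is_prime pt_ideal;
  pt_relevant : exists i : 'I_4, ~ pt_ideal 'X_i
}.

(* the ideal of the closed point [v] *)
Definition cpoint_ideal (v : 'rV[K]_4) : set S :=
  [set f | forall d, (pihomog mdeg d f).@[v 0] = 0].

(* f |-> f(vT); its kernel is the ideal of [v] *)
Definition line_eval (v : 'rV[K]_4) : S -> {poly K} :=
  mmap polyC (fun i => v 0 i *: 'X).

Lemma line_eval_homog v d g :
  g \is d.-homog -> line_eval v g = g.@[v 0] *: 'X^d.
Proof.
move=> /dhomogP hg; rewrite [in LHS](mpolyE g) [in RHS](mpolyE g) /line_eval.
rewrite !raddf_sum scaler_suml /= !big_seq; apply: eq_bigr => m mg.
rewrite mmapZ mevalZ mmapX mevalX mul_polyC -scalerA; congr (_ *: _).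
rewrite /mmap1 -(hg m mg) /= mdegE -prodrXr -scaler_prod.
by apply: eq_bigr => i _; rewrite exprZn.
Qed.

Lemma cpoint_idealP v f : cpoint_ideal v f <-> line_eval v f = 0.
Proof.
have fE : line_eval v f =
    \sum_(d < msize f) (pihomog mdeg d f).@[v 0] *: 'X^d.
  rewrite {1}(pihomog_partitionE (leqnn (msize f))) /line_eval raddf_sum /=.
  by apply: eq_bigr => d _; rewrite -/(line_eval v _) (line_eval_homog _ (pihomogP _ _ _)).
split=> [f0|f0 d]; first by rewrite fE big1 // => d _; rewrite f0 scale0r.
case: (ltnP d (msize f)) => [df|fd].
  have := congr1 (fun p : {poly K} => p`_d) f0.
  rewrite fE coef0 coef_sum (bigD1 (Ordinal df)) //= big1 ?addr0.
    by rewrite coefZ coefXn eqxx mulr1.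
  move=> i ni; rewrite coefZ coefXn.
  suff /negPf -> : d != i by rewrite mulr0.
  by apply: contra ni => /eqP di; apply/eqP/val_inj.
suff -> : pihomog mdeg d f = 0 by rewrite meval0.
rewrite pihomogE big_seq_cond big1 // => m /andP[mf /eqP md].
by have := msize_mdeg_lt mf; rewrite md ltnNge fd.
Qed.

Lemma cpoint_homogeneous v : homogeneous_ideal (cpoint_ideal v).
Proof.
split; last first.
  move=> f d f0 e; have [->|ne] := eqVneq e d.
    by rewrite pihomog_id; exact: f0.
  by rewrite (pihomog_ne0 _ (pihomogP _ _ _)) ?meval0 // eq_sym.
split.
- by apply/cpoint_idealP; rewrite /line_eval raddf0.
- move=> f g /cpoint_idealP f0 /cpoint_idealP g0; apply/cpoint_idealP.
  by move: f0 g0; rewrite /line_eval raddfD /= => -> ->; rewrite addr0.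
- move=> a f /cpoint_idealP f0; apply/cpoint_idealP.
  by move: f0; rewrite /line_eval rmorphM /= => ->; rewrite mulr0.
Qed.

Lemma cpoint_prime v : is_prime (cpoint_ideal v).
Proof.
split; first by have [] := cpoint_homogeneous v.
- by move/cpoint_idealP/eqP; rewrite /line_eval rmorph1 oner_eq0.
- move=> f g /cpoint_idealP/eqP; rewrite /line_eval rmorphM /= mulf_eq0.
  by case/orP => /eqP h; [left | right]; apply/cpoint_idealP.
Qed.

Lemma cpoint_relevant v : v != 0 -> exists i : 'I_4, ~ cpoint_ideal v 'X_i.
Proof.
case/rV0Pn => i vi; exists i => /(_ 1%N).
have hX : ('X_i : S) \is 1.-homog by rewrite dhomogX /= mdeg1.
by rewrite (pihomog_dE hX) mevalXU => vi0; rewrite vi0 eqxx in vi.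
Qed.

Definition cpoint (v : 'rV[K]_4) (hv : v != 0) : ppoint :=
  PPoint (cpoint_homogeneous v) (cpoint_prime v) (cpoint_relevant hv).

Definition local_frac (P : ppoint) : {pred {fraction S}} :=
  fun u => `[< exists d (f g : S),
    [/\ f \is d.-homog, g \is d.-homog, ~ pt_ideal P g & u = tofrac f / tofrac g] >].

Lemma local_frac_subring_closed P : subring_closed (local_frac P).
Proof.
have [[P0 _ _] P1 PM] := pt_prime P.
have nz g : ~ pt_ideal P g -> tofrac g != 0 :> {fraction S}.
  by move=> Pg; rewrite tofrac_eq0; apply: contra_notN Pg => /eqP ->.
split.
- apply/asboolP; exists 0%N, 1, 1.
  by rewrite dhomog1 divr1 rmorph1; split.
- move=> u v /asboolP[d [f [g [hf hg Pg ->]]]] /asboolP[e [f' [g' [hf' hg' Pg' ->]]]].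
  apply/asboolP; exists (d + e)%N, (f * g' - f' * g), (g * g'); split.
  + by apply: rpredB; [exact: dhomogM | rewrite addnC; exact: dhomogM].
  + exact: dhomogM.
  + by case/PM.
  + by rewrite -mulNr addf_div ?nz // rmorphB !rmorphM mulNr.
- move=> u v /asboolP[d [f [g [hf hg Pg ->]]]] /asboolP[e [f' [g' [hf' hg' Pg' ->]]]].
  apply/asboolP; exists (d + e)%N, (f * f'), (g * g'); split.
  + exact: dhomogM.
  + exact: dhomogM.
  + by case/PM.
  + by rewrite !rmorphM /= mulf_div.
Qed.

HB.instance Definition _ P :=
  GRing.isSubringClosed.Build {fraction S} (local_frac P)
    (local_frac_subring_closed P).

(* the local ring of P^3 at P *)
Definition stalk P := {u : {fraction S} | local_frac P u}.
HB.instance Definition _ P := SubChoice.on (stalk P).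
HB.instance Definition _ P := [SubChoice_isSubComNzRing of stalk P by <:].

Definition stalk_ideal I P : set (stalk P) :=
  [set u | exists d (f g : S), [/\ I f, f \is d.-homog, g \is d.-homog, ~ pt_ideal P g
                                 & val u = tofrac f / tofrac g]].

Lemma local_frac_const P (c : K) : local_frac P (tofrac c%:MP).
Proof.
have [_ P1 _] := pt_prime P.
apply/asboolP; exists 0%N, c%:MP, 1.
rewrite dhomog1 rmorph1 divr1; split=> //.
by rewrite -[_%:MP]mulr1 mul_mpolyC rpredZ // dhomog1.
Qed.

Definition stalk_const P (c : K) : stalk P := Sub (tofrac c%:MP) (local_frac_const P c).

(* O_{X,P}, for X the closed subscheme with ideal I *)
Definition local_ring I P : comPzRingType := rquot (@stalk_ideal I P).

Definition complete_local_ring I P : comPzRingType :=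
  completion (@nonunits (local_ring I P)).

Definition to_complete_local_ring I P : stalk P -> complete_local_ring I P :=
  fun u => @to_completion (local_ring I P) _ (rproj _ u).

Definition complete_local_const I P (c : K) : complete_local_ring I P :=
  to_complete_local_ring I (stalk_const P c).

Definition lies_on (P : ppoint) I : Prop := I `<=` pt_ideal P.

Definition generic_point (P : ppoint) I : Prop :=
  lies_on P I /\
  forall Q, lies_on Q I -> pt_ideal Q `<=` pt_ideal P -> pt_ideal Q = pt_ideal P.

(* Over an algebraically closed field a scheme is smooth of dimension r iff its
   local rings at closed points are regular of dimension r. *)
Definition smooth_curve I : Prop :=
  closed_subscheme I /\
  forall (v : 'rV[K]_4) (hv : v != 0),
    lies_on (cpoint hv) I -> regular_local (local_ring I (cpoint hv)) 1.

(* J is a locally Cohen-Macaulay subscheme supported on I, of multiplicity k *)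
Definition multiplicity_structure I J (k : nat) : Prop :=
  [/\ closed_subscheme J,
      forall P, lies_on P J <-> lies_on P I,
      forall P, lies_on P J -> cohen_macaulay_local (local_ring J P)
    & forall P, generic_point P I -> ring_length (local_ring J P) k].

(* The open neighbourhood of v is D(h), the complement of h = 0. The surface is
   the trace on D(h) of the closed subscheme cut out by the homogeneous ideal T. *)
Definition local_smooth_surface (v : 'rV[K]_4) (h : S) (T : set S) : Prop :=
  [/\ exists e, h \is e.-homog, h.@[v 0] != 0, homogeneous_ideal T
    & forall (w : 'rV[K]_4) (hw : w != 0), h.@[w 0] != 0 ->
        lies_on (cpoint hw) T -> regular_local (local_ring T (cpoint hw)) 2].

(* over D(h), V(J) is a subscheme of V(T) *)
Definition contained_over (h : S) J T : Prop :=
  forall (w : 'rV[K]_4) (hw : w != 0), h.@[w 0] != 0 ->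
    @stalk_ideal T (cpoint hw) `<=` @stalk_ideal J (cpoint hw).

(* the cone in K^4 over the projective tangent space at [v] *)
Definition tangent_space I (v : 'rV[K]_4) : set 'rV[K]_4 :=
  [set w : 'rV[K]_4 | forall f, I f -> \sum_(i < 4) w 0 i * (f^`M(i)).@[v 0] = 0].

Definition form_coeffs d (F : S) : 'I_#|{: 'X_{1..4 < d.+1}}| -> K :=
  fun i => F@_(enum_val i).

(* P holds for the general member of |H^0(P^3, I(d))|, d >> 0: since I is
   saturated, H^0(P^3, I(d)) is the space of forms of degree d in I; P is to hold
   on a nonempty basic open subset G != 0 of its projectivisation. *)
Definition general_surface I (P : S -> Prop) : Prop :=
  exists d0, forall d, (d0 <= d)%N ->
    exists e (G : {mpoly K[#|{: 'X_{1..4 < d.+1}}|]}),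
      let U := [set F : S | [/\ I F, F \is d.-homog, F != 0
                              & G.@[@form_coeffs d F] != 0]] in
      [/\ G \is e.-homog, U !=set0 & U `<=` P].

(* K[[x,y,z]] / (xy - z^(k+1)) *)
Definition Ak_ring (k : nat) : comPzRingType :=
  rquot [set (fps_var K ord0 * fps_var K (inord 1)
               - fps_var K (inord 2) ^+ k.+1 : fps K 3)].

Definition Ak_const k (c : K) : Ak_ring k := rproj _ (@fps_const K 3 c).

(* The isomorphism of complete local rings is one of K-algebras. *)
Definition Ak_singularity (F : S) (P : ppoint) (k : nat) : Prop :=
  exists phi : {rmorphism complete_local_ring (ideal_span [set F]) P -> Ak_ring k},
    bijective phi /\ forall c, phi (complete_local_const _ P c) = Ak_const k c.

(* the ideal of the subscheme I in the completed local ring of F = 0 at P *)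
Definition completed_ideal (F : S) (P : ppoint) I :
    set (complete_local_ring (ideal_span [set F]) P) :=
  ideal_span [set to_complete_local_ring _ u | u in @stalk_ideal I P].

End Projective.

(* Main.v *)
Require Import Defs.
From HB Require Import structures.
From mathcomp Require Import all_boot all_order all_algebra.
From mathcomp Require Import boolp classical_sets reals.
From mathcomp Require Import complex mpoly freeg.
From mathcomp Require Import ring zify.

Set Implicit Arguments.
Unset Strict Implicit.
Unset Printing Implicit Defensive.

Import Order.TTheory GRing.Theory Num.Theory.
Local Open Scope classical_set_scope.
Local Open Scope ring_scope.

(** Let [O] be the local ring of P^3 at [p]; Taylor expansion maps it into the
    ring of power series in three variables, which is its completion.

    Local equations. Let [a] and [b] be equations of the two smooth surfaces at
    [p]. In [O / a] the curve C_1 is defined by one element [u], and the ideal of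
    Z_1, which has no embedded component, is primary over it, hence generated by
    a power of [u]; the length of Z_1 at the generic point of C_1 shows that this
    power is [u ^ m] ([branch_ex]). So Z_1 has the ideal [(a, u ^ m)] and Z_2 an
    ideal [(b, v ^ n)]. That [O] has dimension three ([chain_bound]) identifies
    the primes that occur, and Krull's intersection theorem
    ([krull_intersection]) brings statements about power series back to [O]. As
    the curves are transverse to the surfaces, [a, u, b] and [b, v, a] are
    regular systems of parameters ([transverse]), and there is one element [z]
    that can serve both as [u] and as [v] ([common_param]).

    The general surface. In the coordinates [x = b], [y = a] and [z], and for
    [m <= n], the intersection of the ideals [(y, z ^ m)] and [(x, z ^ n)] is
    generated by [x y], [x z ^ m] and [z ^ n]. A surface containing Z therefore
    has a local equation [c1 x y + c2 x z ^ m + c3 z ^ n]. When [c1] and [c3] are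
    units this is, up to a unit, [x y' - z ^ n], where
    [y' = - (c1 y + c2 z ^ m) / c3]; moreover C_1 is [(y', z)] and C_2 is [(x, z)]
    ([normal_form]). That [c1] and [c3] do not vanish at [p] amounts to two
    linear forms in the coefficients of the surface being nonzero, and neither of
    these linear forms vanishes identically, because [a b] and [z ^ n] are germs
    of forms that vanish on Z ([general_opposite_classes]).

    The singularity. The completed local ring of such a surface is the quotient
    of the ring of power series by [x y - z ^ n] ([completed_Ak]). By
    [x = s ^ n], [y = t ^ n] and [z = s t] it becomes the part of degree zero of
    K[[s,t]], graded by Z/n with [t] in degree 1 and [s] in degree -1 ([Phi_ker],
    [Phi_image]). Homogeneous power series factor uniquely: greatest common
    divisors exist because the syzygies of two homogeneous elements are free of
    rank one ([syz_gen], [hom_gcd]). The primes of height one are the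
    contractions of the homogeneous primes of K[[s,t]], and the sum of the degrees
    of the latter identifies the class group with Z/n ([class_wt_bij]). The ideals
    [(y, z)] and [(x, z)] have the divisors of [t] and of [s], hence the classes 1
    and -1 ([ideal_class]). *)

(** * Formal power series *)

Section FpsOrder.
Variables (K : comNzRingType) (n : nat).
Implicit Types (f g : fps K n) (m : 'X_{1..n}).

Lemma fpsD f g m : (f + g) m = f m + g m. Proof. by []. Qed.
Lemma fpsN f m : (- f) m = - f m. Proof. by []. Qed.
Lemma fpsB f g m : (f - g) m = f m - g m. Proof. by []. Qed.
Lemma fps0 m : (0 : fps K n) m = 0. Proof. exact: if_same. Qed.
Lemma fps1 m : (1 : fps K n) m = (m == 0%MM)%:R.
Proof. by rewrite /GRing.one /= /fps_const; case: eqP. Qed.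
Lemma fpsM f g m : (f * g) m =
  \sum_(k : 'X_{1..n < (mdeg m).+1, (mdeg m).+1} | m == (k.1 + k.2)%MM)
    f k.1 * g k.2.
Proof. by []. Qed.

Lemma fpsM_trunc d f g m : (mdeg m < d)%N ->
  (f * g) m = (fps_trunc d f * fps_trunc d g)@_m.
Proof. exact: fps_mulE. Qed.

Lemma fps_sum (I : Type) (r : seq I) (P : pred I) (F : I -> fps K n) m :
  (\sum_(i <- r | P i) F i) m = \sum_(i <- r | P i) F i m.
Proof. by elim/big_rec2: _ => [|i x y _ <-]; rewrite ?fps0. Qed.

Lemma fps_oner_neq0 : (1 : fps K n) != 0.
Proof.
by apply/eqP => /(congr1 (@^~ 0%MM)); rewrite fps1 fps0 eqxx; apply/eqP/oner_neq0.
Qed.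
HB.instance Definition _ :=
  GRing.PzSemiRing_isNonZero.Build (fps K n) fps_oner_neq0.

(** The [k]-th power of the maximal ideal, over a field. *)
Definition ford k f := forall m, (mdeg m < k)%N -> f m = 0.

Lemma ford0n f : ford 0 f. Proof. by []. Qed.
Lemma ford_zero k : ford k 0. Proof. by move=> m _; rewrite fps0. Qed.
Lemma fordD k f g : ford k f -> ford k g -> ford k (f + g).
Proof. by move=> Hf Hg m mk; rewrite fpsD Hf // Hg // addr0. Qed.
Lemma fordN k f : ford k f -> ford k (- f).
Proof. by move=> Hf m mk; rewrite fpsN Hf // oppr0. Qed.
Lemma fordB k f g : ford k f -> ford k g -> ford k (f - g).
Proof. by move=> Hf Hg; apply: fordD => //; apply: fordN. Qed.
Lemma fordW j k f : (j <= k)%N -> ford k f -> ford j f.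
Proof. by move=> jk H m mj; apply: H; apply: leq_trans jk. Qed.
Lemma fordM j k f g : ford j f -> ford k g -> ford (j + k) (f * g).
Proof.
move=> Hf Hg m mjk; rewrite fpsM big1 // => -[[k1 h1] [k2 h2]] /= /eqP Em.
move: mjk; rewrite Em mdegD => mjk.
have [h|h] := ltnP (mdeg k1) j; first by rewrite Hf // mul0r.
by rewrite Hg ?mulr0 //; lia.
Qed.
Lemma fordMl k f g : ford k f -> ford k (g * f).
Proof. by rewrite -[k in _ -> ford k _]add0n => h; apply: fordM. Qed.
Lemma fordMr k f g : ford k f -> ford k (f * g).
Proof. by rewrite mulrC; apply: fordMl. Qed.
Lemma fordX j f i : ford j f -> ford (i * j) (f ^+ i).
Proof. by move=> Hf; elim: i => // i IH; rewrite mulSn exprS; apply: fordM. Qed.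
Lemma ford_sum k (I : Type) (r : seq I) (P : pred I) (F : I -> fps K n) :
  (forall i, P i -> ford k (F i)) -> ford k (\sum_(i <- r | P i) F i).
Proof. by move=> H; elim/big_rec: _ => [|i x Pi Hx]; [exact: ford_zero|apply: fordD; auto]. Qed.
Lemma ford_eq0 f : (forall k, ford k f) -> f = 0.
Proof. by move=> H; apply: fps_eq => m; rewrite fps0 (H (mdeg m).+1). Qed.
Lemma ford_eq f g : (forall k, ford k (f - g)) -> f = g.
Proof. by move=> /ford_eq0 /eqP; rewrite subr_eq0 => /eqP. Qed.
Lemma fordBC k f g : ford k (f - g) -> ford k (g - f).
Proof. by rewrite -[g - f]opprB; apply: fordN. Qed.
Lemma ford_trans k f g h : ford k (f - g) -> ford k (g - h) -> ford k (f - h).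
Proof. by move=> /fordD H /H; rewrite addrA subrK. Qed.

(** The space of series is complete for the order filtration. *)
Lemma fps_limit (u : nat -> fps K n) :
  (forall k, ford k (u k.+1 - u k)) -> exists L, forall k, ford k (L - u k).
Proof.
move=> H; exists (fun m => u (mdeg m).+1 m) => k m.
move=> mk; rewrite fpsB; apply/eqP; rewrite subr_eq0; apply/eqP.
elim: k mk => // k IH; rewrite ltnS leq_eqVlt => /orP[/eqP -> //|mk].
by rewrite IH //; apply/eqP; rewrite eq_sym -subr_eq0 -fpsB (H k).
Qed.

Lemma ford_unit1 f : ford 1 f -> exists g, (1 - f) * g = 1.
Proof.
move=> Hf; pose u d := \sum_(i < d) f ^+ i.
have [k|L HL] := @fps_limit u.
  by rewrite /u big_ord_recr /= addrAC subrr add0r -[k in ford k]muln1; apply: fordX.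
exists L; apply: ford_eq => k.
have -> : (1 - f) * L - 1 = (1 - f) * (L - u k) - f ^+ k.
  have E : (1 - f) * u k = 1 - f ^+ k.
    by rewrite -[1 - f ^+ k]opprB subrX1 -/(u k) -mulNr opprB.
  by rewrite mulrBr E; ring.
by apply: fordB; [exact: fordMl | rewrite -[k in ford k]muln1; apply: fordX].
Qed.

Lemma fps_const_is_zmod : zmod_morphism (@fps_const K n).
Proof.
move=> c d; apply: fps_eq => m; rewrite fpsB /fps_const.
by case: eqP => // _; rewrite subr0.
Qed.
HB.instance Definition _ :=
  GRing.isZmodMorphism.Build K (fps K n) (@fps_const K n) fps_const_is_zmod.

Definition fps_of (p : {mpoly K[n]}) : fps K n := fun m => p@_m.

Lemma fps_of_is_zmod : zmod_morphism fps_of.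
Proof. by move=> p q; apply: fps_eq => m; rewrite fpsB /fps_of mcoeffB. Qed.
Lemma fps_of_is_monoid : monoid_morphism fps_of.
Proof.
split; first by apply: fps_eq => m; rewrite /fps_of mcoeff1 fps1.
by move=> p q; apply: fps_eq => m; rewrite fpsM /fps_of mcoeffM.
Qed.
HB.instance Definition _ :=
  GRing.isZmodMorphism.Build {mpoly K[n]} (fps K n) fps_of fps_of_is_zmod.
HB.instance Definition _ :=
  GRing.isMonoidMorphism.Build {mpoly K[n]} (fps K n) fps_of fps_of_is_monoid.

Lemma fps_ofC c : fps_of c%:MP = fps_const c.
Proof.
apply: fps_eq => m; rewrite /fps_of mcoeffC /fps_const.
by case: eqP; rewrite (mulr1, mulr0).
Qed.
Lemma fps_const_is_monoid : monoid_morphism (@fps_const K n).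
Proof. by split=> // c d; rewrite -!fps_ofC mpolyCM rmorphM. Qed.
HB.instance Definition _ :=
  GRing.isMonoidMorphism.Build K (fps K n) (@fps_const K n) fps_const_is_monoid.

Lemma fps_of_trunc d f : ford d (f - fps_of (fps_trunc d f)).
Proof. by move=> m md; rewrite fpsB /fps_of fps_truncE // subrr. Qed.

Lemma fps_truncE_big d f m : (d <= mdeg m)%N -> (fps_trunc d f)@_m = 0.
Proof.
move=> md; rewrite /fps_trunc raddf_sum big1 //= => i _; rewrite mcoeffZ mcoeffX.
case: eqP => [ik|]; last by rewrite mulr0.
by move: md; rewrite -ik leqNgt bmdeg.
Qed.

Notation mono m := (fps_of 'X_[m]).

Lemma fps_varE i : fps_var K i = (mono U_(i)%MM).
Proof. by apply: fps_eq => m; rewrite /fps_of mcoeffX eq_sym. Qed.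

Lemma fps_mono a m : (mono a) m = (a == m)%:R.
Proof. by rewrite /fps_of mcoeffX. Qed.

Lemma fps_monoD a b : (mono (a + b)%MM) = (mono a) * (mono b).
Proof. by rewrite mpolyXD rmorphM. Qed.

Lemma fps_monoM a f m : ((mono a) * f) m = if (a <= m)%MM then f (m - a)%MM else 0.
Proof.
rewrite (fpsM_trunc _ _ (ltnSn _)).
have -> : fps_trunc (mdeg m).+1 (mono a) * fps_trunc (mdeg m).+1 f
  = fps_trunc (mdeg m).+1 f * fps_trunc (mdeg m).+1 (mono a) by rewrite mulrC.
have [am|/negP am] := boolP (a <= m)%MM.
  have -> : fps_trunc (mdeg m).+1 (mono a) = 'X_[a].
    apply/mpolyP => k; have [km|mk] := ltnP (mdeg k) (mdeg m).+1.
      by rewrite fps_truncE.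
    rewrite fps_truncE_big // mcoeffX; case: eqP => // E; move: mk.
    by rewrite -E -(submK am) mdegD; lia.
  have := mcoeffMX (fps_trunc (mdeg m).+1 f) a (m - a)%MM.
  by rewrite addmC submK // => ->; rewrite fps_truncE // ltnS mdegB.
rewrite mcoeffM big1 // => -[[k1 h1] [k2 h2]] /= /eqP Em.
have [E|ne] := eqVneq a k2.
  by case: am; rewrite Em E lem_addl.
rewrite (_ : _@_k2 = 0) ?mulr0 // fps_truncE //.
by rewrite /fps_of mcoeffX (negPf ne).
Qed.

Lemma ford_mono a : ford (mdeg a) (mono a).
Proof. by move=> m; rewrite fps_mono; case: eqP => // ->; rewrite ltnn. Qed.

Lemma fps_mono_dvd a f : (forall m, ~~ (a <= m)%MM -> f m = 0) ->
  exists g, f = (mono a) * g.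
Proof.
move=> H; exists (fun m => f (m + a)%MM); apply: fps_eq => m.
by rewrite fps_monoM; case: ifPn => [am|/H //]; rewrite submK.
Qed.

Lemma fps_constM (c : K) f m : (fps_const c * f) m = c * f m.
Proof.
rewrite -fps_ofC (_ : c%:MP = c *: 'X_[0]); last by rewrite mpolyX0 -mul_mpolyC mulr1.
rewrite (fpsM_trunc _ _ (ltnSn _)).
have -> : fps_trunc (mdeg m).+1 (fps_of (c *: 'X_[0])) = c%:MP.
  apply/mpolyP => k; have [km|mk] := ltnP (mdeg k) (mdeg m).+1.
    by rewrite fps_truncE // /fps_of mpolyX0 -mul_mpolyC mulr1.
  rewrite fps_truncE_big // mcoeffC; case: eqP mk; rewrite ?mulr0 // => ->.
  by rewrite mdeg0.
by rewrite mcoeffCM fps_truncE.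
Qed.

Lemma fps_constE (c : K) m : fps_const c m = c * (m == 0%MM)%:R.
Proof. by rewrite /fps_const; case: eqP; rewrite (mulr1, mulr0). Qed.

(** A set of series cut out by a face of the monoid of monomials (here the
    monomials satisfying [P]) is a prime ideal: the product of the smallest
    monomials on that face cannot cancel. *)
Lemma face_prime (P : pred 'X_{1..n}) :
  (forall a b, P (a + b)%MM = P a && P b) ->
  forall f g, (forall m, P m -> (f * g) m = 0) ->
  GRing.integral_domain_axiom K ->
  (forall m, P m -> f m = 0) \/ (forall m, P m -> g m = 0).
Proof.
move=> PD f g fg0 dom; apply: contrapT => /not_orP[nf ng].
have minex (h : fps K n) : ~ (forall m, P m -> h m = 0) ->
    exists m, [/\ P m, h m <> 0 & forall k, (k < m)%O -> P k -> h k = 0].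
  move=> nh; apply: contrapT => H; apply: nh => m.
  elim/(well_founded_ind (@ltom_wf n)): m => m IH Pm; apply: contrapT => hm.
  by apply: H; exists m; split=> // k km Pk; apply: IH.
have [a [Pa fa mina]] := minex _ nf; have [b [Pb gb minb]] := minex _ ng.
have := fg0 (a + b)%MM; rewrite PD Pa Pb => /(_ isT); rewrite fpsM.
have ha : (mdeg a < (mdeg (a + b)).+1)%N by rewrite mdegD; lia.
have hb : (mdeg b < (mdeg (a + b)).+1)%N by rewrite mdegD; lia.
rewrite (bigD1 (BMultinom ha, BMultinom hb)) //= big1 ?addr0.
  by move/dom => /orP[] /eqP.
move=> [[k1 h1] [k2 h2]] /= /andP[/eqP E ne].
have : P (k1 + k2)%MM by rewrite -E PD Pa Pb.
rewrite PD => /andP[P1 P2].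
case: (ltgtP k1 a) => [k1a|ak1|Ea]; first by rewrite mina // mul0r.
  rewrite minb ?mulr0 //; have := ltmc_le_add ak1 (lexx b).
  rewrite E; case: (ltP k2 b) => // bk2.
  by rewrite ltNge (lem_add (lexx _) bk2).
case/negP: ne; rewrite -pair_eqE /pair_eq /= !bmeqP /= Ea eqxx /=.
by move: E; rewrite Ea => /addmI ->.
Qed.

End FpsOrder.

Notation mono m := (fps_of 'X_[m]).

Section FpsField.
Variables (K : fieldType) (n : nat).
Implicit Types (f g : fps K n) (m : 'X_{1..n}).

Lemma fps_dom : GRing.integral_domain_axiom (fps K n).
Proof.
move=> f g fg.
have dK : GRing.integral_domain_axiom K by move=> x y /eqP; rewrite mulf_eq0.
case: (@face_prime K n xpredT (fun _ _ => erefl) f g _ dK).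
- by move=> m _; rewrite fg fps0.
- by move=> H; apply/orP; left; apply/eqP/fps_eq => m; rewrite H // fps0.
- by move=> H; apply/orP; right; apply/eqP/fps_eq => m; rewrite H // fps0.
Qed.

Lemma ford1E f : ford 1 f <-> f 0%MM = 0.
Proof.
split=> [|f0 m]; first by apply; rewrite mdeg0.
by rewrite ltnS leqn0 mdeg_eq0 => /eqP ->.
Qed.

Lemma ford1_const f : ford 1 (f - fps_const (f 0%MM)).
Proof. by apply/ford1E; rewrite fpsB fps_constE eqxx mulr1 subrr. Qed.

Lemma fpsM0 f g : (f * g) 0%MM = f 0%MM * g 0%MM.
Proof.
have H : ford 1 (f * g - fps_const (f 0%MM * g 0%MM)).
  rewrite rmorphM /=; apply: (@ford_trans _ _ _ _ (fps_const (f 0%MM) * g)).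
    by rewrite -mulrBl; apply: fordMr; apply: ford1_const.
  by rewrite -mulrBr; apply: fordMl; apply: ford1_const.
move/ford1E/eqP: H; rewrite fpsB subr_eq0 => /eqP ->.
by rewrite fps_constE eqxx mulr1.
Qed.

Lemma fps_inv_ex f : f 0%MM != 0 -> exists g, g * f = 1.
Proof.
move=> f0; pose h := 1 - fps_const (f 0%MM)^-1 * f.
have [|g Hg] := @ford_unit1 _ _ h.
  apply/ford1E; rewrite /h fpsB fps1 eqxx fpsM0 fps_constE eqxx mulr1 mulVf //.
  exact: subrr.
exists (fps_const (f 0%MM)^-1 * g); rewrite -Hg /h; ring.
Qed.

Definition fps_unit : {pred fps K n} := fun f => f 0%MM != 0.
Definition fps_inv f : fps K n :=
  if pselect (exists g, g * f = 1) is left H then projT1 (cid H) else f.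

Lemma fps_mulVx : {in fps_unit, left_inverse 1 fps_inv *%R}.
Proof.
move=> f /fps_inv_ex H; rewrite /fps_inv; case: pselect => // {}H.
exact: (projT2 (cid H)).
Qed.
Lemma fps_unitPl f g : g * f = 1 -> fps_unit f.
Proof.
move=> /(congr1 (@^~ 0%MM)); rewrite fpsM0 fps1 eqxx => /eqP.
by apply: contraTneq => ->; rewrite mulr0 eq_sym oner_eq0.
Qed.
Lemma fps_invr_out : {in [predC fps_unit], fps_inv =1 id}.
Proof.
move=> f nf; rewrite /fps_inv; case: pselect => // H.
have [g /fps_unitPl uf] := H; by move: nf; rewrite inE /in_mem /= uf.
Qed.

HB.instance Definition _ := GRing.ComNzRing_hasMulInverse.Build (fps K n)
  fps_mulVx fps_unitPl fps_invr_out.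
HB.instance Definition _ := GRing.ComUnitRing_isIntegral.Build (fps K n) fps_dom.

Lemma fps_unitE f : (f \is a GRing.unit) = (f 0%MM != 0). Proof. by []. Qed.

Lemma fps_mono_neq0 a : (mono a) != 0 :> fps K n.
Proof.
apply/eqP => /(congr1 (@^~ a)); rewrite fps_mono eqxx fps0.
by apply/eqP/oner_neq0.
Qed.

Lemma fps_neq0P f : f != 0 -> exists m, f m != 0.
Proof.
move=> /eqP f0; apply: contrapT => H; apply: f0; apply: fps_eq => m.
by rewrite fps0; apply/eqP/negPn/negP => ?; apply: H; exists m.
Qed.

Lemma fps_neq0_ford f : f != 0 -> exists k, ~ ford k f.
Proof. by move=> /fps_neq0P[m fm]; exists (mdeg m).+1 => /(_ m (ltnSn _)) /eqP; apply/negP. Qed.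

End FpsField.

(** * Substitution into power series *)

Section Substitution.
Variables (K : fieldType) (n k : nat) (w : 'I_n -> fps K k).
Implicit Types (f g : fps K n) (p q : {mpoly K[n]}).

(** Only series without constant term can be substituted: the constant terms are
    dropped, so that substitution is a total operation. *)
Let v i := w i - fps_const (w i 0%MM).
Let hv i : ford 1 (v i). Proof. exact: ford1_const. Qed.

Definition pev p : fps K k := mmap (@fps_const K k) v p.

Lemma pev_is_zmod : zmod_morphism pev.
Proof. by move=> p q; rewrite /pev raddfB. Qed.
Lemma pev_is_monoid : monoid_morphism pev.
Proof. by split=> [|p q]; rewrite /pev ?rmorph1 ?rmorphM. Qed.
HB.instance Definition _ :=
  GRing.isZmodMorphism.Build {mpoly K[n]} (fps K k) pev pev_is_zmod.
HB.instance Definition _ :=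
  GRing.isMonoidMorphism.Build {mpoly K[n]} (fps K k) pev pev_is_monoid.

Lemma ford_mmap1 m : ford (mdeg m) (mmap1 v m).
Proof.
rewrite /mmap1 mdegE; elim/big_rec2: _ => [|i y d _ IH]; first exact: ford0n.
by apply: fordM => //; rewrite -[X in ford X]muln1; apply: fordX.
Qed.

Lemma pev_ford p d : (forall m, (mdeg m < d)%N -> p@_m = 0) -> ford d (pev p).
Proof.
move=> H; rewrite /pev /mmap; apply: ford_sum => m _.
have [md|dm] := ltnP (mdeg m) d; last first.
  by apply: fordMl; apply: fordW dm _; apply: ford_mmap1.
by rewrite H // rmorph0 mul0r; apply: ford_zero.
Qed.

Definition ev f : fps K k := fun m => pev (fps_trunc (mdeg m).+1 f) m.

Lemma evE d f : ford d (ev f - pev (fps_trunc d f)).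
Proof.
move=> m md; rewrite fpsB /ev -fpsB -raddfB; apply: (@pev_ford _ (mdeg m).+1) => // a am.
by rewrite mcoeffB !fps_truncE ?subrr //; apply: leq_trans md.
Qed.

Lemma ev_pev d f p : (forall m, (mdeg m < d)%N -> p@_m = f m) ->
  ford d (ev f - pev p).
Proof.
move=> H; apply: ford_trans (@evE d f) _; rewrite -raddfB; apply: pev_ford => m md.
by rewrite mcoeffB fps_truncE // H // subrr.
Qed.

Lemma ev_of p : ev (fps_of p) = pev p.
Proof. by apply: ford_eq => d; apply: ev_pev. Qed.

Lemma ev_is_zmod : zmod_morphism ev.
Proof.
move=> f g; apply: ford_eq => d.
apply: (@ford_trans _ _ _ _ (pev (fps_trunc d f - fps_trunc d g))).
  by apply: ev_pev => m md; rewrite mcoeffB !fps_truncE.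
rewrite raddfB (_ : _ - _ = (pev (fps_trunc d f) - ev f) -
  (pev (fps_trunc d g) - ev g)) /=; last by ring.
by apply: fordB; apply: fordBC; apply: evE.
Qed.

Lemma ev_is_monoid : monoid_morphism ev.
Proof.
split; first by rewrite -(rmorph1 (@fps_of K n)) ev_of rmorph1.
move=> f g; apply: ford_eq => d.
apply: (@ford_trans _ _ _ _ (pev (fps_trunc d f * fps_trunc d g))).
  by apply: ev_pev => m md; rewrite -fpsM_trunc.
rewrite rmorphM; apply: (@ford_trans _ _ _ _ (ev f * pev (fps_trunc d g))).
  by rewrite -mulrBl; apply: fordMr; apply: fordBC; apply: evE.
by rewrite -mulrBr; apply: fordMl; apply: fordBC; apply: evE.
Qed.
HB.instance Definition _ :=
  GRing.isZmodMorphism.Build (fps K n) (fps K k) ev ev_is_zmod.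
HB.instance Definition _ :=
  GRing.isMonoidMorphism.Build (fps K n) (fps K k) ev ev_is_monoid.

Lemma ev_ford d f : ford d f -> ford d (ev f).
Proof.
move=> H; rewrite -[ev f]subr0 -[0](rmorph0 pev); apply: ev_pev => m md.
by rewrite mcoeff0 H.
Qed.

Lemma ev_const c : ev (fps_const c) = fps_const c.
Proof. by rewrite -fps_ofC ev_of /pev mmapC. Qed.

Hypothesis hw : forall i, ford 1 (w i).

Lemma pevE p : pev p = mmap (@fps_const K k) w p.
Proof.
congr mmap; apply: funext => i.
by rewrite /v ((ford1E _).1 (hw i)) rmorph0 subr0.
Qed.

Lemma ev_mono m : ev (mono m) = mmap1 w m.
Proof. by rewrite ev_of pevE mmapX. Qed.

Lemma ev_var i : ev (fps_var K i) = w i.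
Proof. by rewrite fps_varE ev_mono mmap1U. Qed.

Lemma ev_unique (phi : {rmorphism fps K n -> fps K k}) :
  (forall c, phi (fps_const c) = fps_const c) ->
  (forall d f, ford d f -> ford d (phi f)) ->
  (forall i, phi (fps_var K i) = w i) -> phi =1 ev.
Proof.
move=> phiC phiF phiX f; apply: ford_eq => d.
apply: (@ford_trans _ _ _ _ (phi (fps_of (fps_trunc d f)))).
  by rewrite -rmorphB; apply: phiF; apply: fps_of_trunc.
suff -> : phi (fps_of (fps_trunc d f)) = ev (fps_of (fps_trunc d f)).
  by rewrite -rmorphB; apply: ev_ford; apply: fordBC; apply: fps_of_trunc.
rewrite (mpolyE (fps_trunc d f)) !rmorph_sum; apply: eq_bigr => m _.
rewrite -mul_mpolyC !rmorphM /= !fps_ofC phiC ev_const; congr (_ * _).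
rewrite mpolyXE_id !rmorph_prod; apply: eq_bigr => i _.
by rewrite !rmorphXn /= -fps_varE phiX ev_var.
Qed.

End Substitution.

Lemma ford_var (K : fieldType) n (i : 'I_n) : ford 1 (fps_var K i).
Proof. by rewrite fps_varE -[X in ford X](mdeg1 i); apply: ford_mono. Qed.

Lemma ev_id (K : fieldType) n (f : fps K n) : ev (@fps_var K n) f = f.
Proof.
have H := @ev_unique K n n (@fps_var K n) (fun i => @ford_var K n i)
  (GRing.RMorphism.clone _ _ idfun _).
by rewrite -[RHS]/(idfun f) H.
Qed.

Lemma ev_comp (K : fieldType) n k l (v : 'I_n -> fps K k) (w : 'I_k -> fps K l) f :
  (forall i, ford 1 (v i)) -> (forall i, ford 1 (w i)) ->
  ev w (ev v f) = ev (fun i => ev w (v i)) f.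
Proof.
move=> hv hw.
have hvw i : ford 1 (ev w (v i)) by exact: ev_ford.
apply: (@ev_unique K n l _ hvw (GRing.RMorphism.clone _ _ (ev w \o ev v) _)).
- by move=> c /=; rewrite !ev_const.
- by move=> d g /=; move=> Hg; do 2 apply: ev_ford => //.
- by move=> i /=; rewrite ev_var.
Qed.

Lemma eq_ev (K : fieldType) n k (v w : 'I_n -> fps K k) : v =1 w -> ev v =1 ev w.
Proof. by move=> /funext ->. Qed.

(** * The formal inverse function theorem *)

Section Coordinates.
Variables (K : fieldType) (n : nat).
Implicit Types (f g : fps K n) (v w : 'I_n -> fps K n).

(** Over a field every automorphism preserves the order; it is recorded here
    because it is what makes [kappa] continuous. *)
Definition fps_auto (kappa : fps K n -> fps K n) : Prop :=
  [/\ forall c, kappa (fps_const c) = fps_const c,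
      forall d f, ford d (kappa f) <-> ford d f
    & forall g, exists f, kappa f = g].

Lemma ford1_lin f : ford 1 f ->
  ford 2 (f - \sum_j fps_const (f U_(j)%MM) * fps_var K j).
Proof.
move=> f1 m; rewrite ltnS leq_eqVlt ltnS leqn0 mdeg_eq0 => /orP[|/eqP ->].
  case/mdeg1P => i /eqP ->; rewrite fpsB fps_sum (bigD1 i) //= big1 => [|j ji].
    by rewrite fps_constM addr0 fps_varE fps_mono eqxx mulr1 subrr.
  by rewrite fps_constM fps_varE fps_mono eq_mnm1 (negPf ji) mulr0.
rewrite fpsB (f1 0%MM) ?mdeg0 // fps_sum big1 ?subr0 // => j _.
by rewrite fps_constM fps_varE fps_mono mnm1_eq0 mulr0.
Qed.

Section Unipotent.
Variable v : 'I_n -> fps K n.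
Hypothesis hv : forall i, ford 2 (v i - fps_var K i).

Let hv1 i : ford 1 (v i).
Proof.
rewrite -[v i](subrK (fps_var K i)); apply: fordD; last exact: ford_var.
exact: fordW (hv i).
Qed.

Lemma unip_mono m : ford (mdeg m).+1 (mmap1 v m - mono m).
Proof.
have pw i : forall d, ford d.+1 (v i ^+ d - fps_var K i ^+ d).
  elim=> [|d IH]; first by rewrite !expr0 subrr; apply: ford_zero.
  have -> : v i ^+ d.+1 - fps_var K i ^+ d.+1 =
    (v i - fps_var K i) * v i ^+ d + fps_var K i * (v i ^+ d - fps_var K i ^+ d).
    by rewrite !exprS; ring.
  apply: fordD; last by rewrite -addn1 addnC; apply: fordM => //; apply: ford_var.
  by have := fordM (hv i) (fordX (i:=d) (hv1 i)); rewrite muln1.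
rewrite mpolyXE_id rmorph_prod /mmap1 mdegE.
suff [//] : ford (\sum_(i < n) m i).+1 (\prod_(i < n) v i ^+ m i -
          \prod_(i < n) fps_of ('X_i ^+ m i)) /\
      ford (\sum_(i < n) m i) (\prod_(i < n) v i ^+ m i).
elim/big_rec3: _ => [|i x y d _ [IH1 IH2]].
  by rewrite subrr; split; [exact: ford_zero | exact: ford0n].
have X : ford (m i) (v i ^+ m i) by rewrite -[X in ford X]muln1; apply: fordX.
split; last exact: fordM.
rewrite rmorphXn /= -fps_varE.
rewrite (_ : _ - _ = (v i ^+ m i - fps_var K i ^+ m i) * y +
    fps_var K i ^+ m i * (y - x)); last by ring.
apply: fordD; first by rewrite -addSn; apply: fordM.
rewrite -addnS; apply: fordM => //.
by rewrite -[X in ford X]muln1; apply: fordX; apply: ford_var.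
Qed.

Lemma unip_step d f : ford d f -> ford d.+1 (ev v f - f).
Proof.
move=> Hf; apply: (@ford_trans _ _ _ _ (ev v (fps_of (fps_trunc d.+1 f)))).
  by rewrite -rmorphB; apply: ev_ford; apply: fps_of_trunc.
apply: (@ford_trans _ _ _ _ (fps_of (fps_trunc d.+1 f))); last first.
  by apply: fordBC; apply: fps_of_trunc.
rewrite /fps_trunc !rmorph_sum -sumrB; apply: ford_sum => m _.
rewrite -mul_mpolyC !rmorphM /= !fps_ofC ev_const -mulrBr.
have [md|dm] := ltnP (mdeg m) d.
  by rewrite Hf // rmorph0 mul0r; apply: ford_zero.
apply: fordMl; rewrite ev_mono //; apply: (@fordW _ _ _ (mdeg m).+1) => //.
exact: unip_mono.
Qed.

Lemma unip_auto : fps_auto (ev v).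
Proof.
split; [exact: ev_const | move=> d f; split; last exact: ev_ford |].
  elim: d => // d IH H; have Hd := IH (fordW (leqnSn d) H).
  rewrite -[f](subKr (ev v f)); apply: fordB => //; exact: unip_step.
move=> g; pose u := fix u k := if k is k'.+1 then u k' + (g - ev v (u k')) else 0.
have gu k : ford k (g - ev v (u k)).
  elim: k => // k IH; have Hs := unip_step IH.
  rewrite (_ : u k.+1 = u k + (g - ev v (u k))) // rmorphD /= opprD addrA.
  exact: fordBC.
have [k|L HL] := @fps_limit _ _ u; first by rewrite /= addrC addKr.
exists L; apply: ford_eq => k.
apply: (@ford_trans _ _ _ _ (ev v (u k))); last exact: fordBC.
by rewrite -rmorphB; apply: ev_ford.
Qed.
End Unipotent.

(** After a linear substitution the linear parts are the variables themselves. The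
    substitution of such series differs from the identity by terms of higher
    order, so it is inverted by successive approximation. *)
Theorem formal_inverse v : (forall i, ford 1 (v i)) ->
  (\matrix_(i, j) v i U_(j)%MM) \in unitmx ->
  exists kappa : {rmorphism fps K n -> fps K n},
    fps_auto kappa /\ forall i, kappa (v i) = fps_var K i.
Proof.
move=> hv; set M := \matrix_(i, j) _ => uM.
pose lin (A : 'M[K]_n) i : fps K n := \sum_j fps_const (A i j) * fps_var K j.
have lin1 A i : ford 1 (lin A i).
  by apply: ford_sum => j _; apply: fordMl; apply: ford_var.
have linK A B f : A *m B = 1%:M -> ev (lin B) (ev (lin A) f) = f.
  move=> AB; rewrite ev_comp // -[RHS]ev_id; apply: eq_ev => i.
  rewrite [X in ev _ X]/lin rmorph_sum /=.
  under eq_bigr => j _ do rewrite rmorphM /= ev_const ev_var // /lin mulr_sumr.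
  rewrite exchange_big (bigD1 i) //= [X in _ + X]big1 ?addr0 => [|j ji].
    under eq_bigr => j _ do rewrite mulrA -rmorphM.
    rewrite -mulr_suml -rmorph_sum; have := congr1 (fun A : 'M_n => A i i) AB.
    by rewrite !mxE eqxx => ->; rewrite rmorph1 mul1r.
  under eq_bigr => l _ do rewrite mulrA -rmorphM.
  rewrite -mulr_suml -rmorph_sum; have := congr1 (fun A : 'M_n => A i j) AB.
  by rewrite !mxE eq_sym (negPf ji) => ->; rewrite rmorph0 mul0r.
pose lam := ev (lin (invmx M)).
have lamF d f : ford d (lam f) <-> ford d f.
  split=> [H|]; last exact: ev_ford.
  by rewrite -(linK _ _ f (mulVmx uM)); apply: ev_ford.
have hw i : ford 2 (lam (v i) - fps_var K i).
  apply: (@ford_trans _ _ _ _ (lam (lin M i))).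
    rewrite -rmorphB; apply/lamF.
    rewrite (_ : lin M i = \sum_j fps_const (v i U_(j)%MM) * fps_var K j).
      exact: ford1_lin (hv i).
    by apply: eq_bigr => j _; rewrite mxE.
  rewrite -[lin M i](@ev_var K n n) // /lam linK ?mulmxV // subrr.
  exact: ford_zero.
have [thC thF thS] := unip_auto hw.
have thI f g : ev (lam \o v) f = ev (lam \o v) g -> f = g.
  move=> E; apply: ford_eq => d; apply/thF; rewrite rmorphB /= E subrr.
  exact: ford_zero.
have [inv invK] := choice thS.
pose kap f := inv (lam f).
have kapE f : ev (lam \o v) (kap f) = lam f by rewrite /kap invK.
have kzm : zmod_morphism kap.
  by move=> f g; apply: thI; rewrite rmorphB /= !kapE /lam rmorphB.
have kmm : monoid_morphism kap.
  split; first by apply: thI; rewrite kapE /lam !rmorph1.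
  by move=> f g; apply: thI; rewrite rmorphM /= !kapE /lam rmorphM.
pose kz := GRing.isZmodMorphism.Build _ _ kap kzm.
pose km := GRing.isMonoidMorphism.Build _ _ kap kmm.
pose kappa : {rmorphism fps K n -> fps K n} := HB.pack kap kz km.
exists kappa; split; last first.
  move=> i; apply: thI; rewrite [kappa _]/(kap _) kapE ev_var //.
  by move=> j; apply/lamF.
split.
- by move=> c; apply: thI; rewrite [kappa _]/(kap _) kapE /lam !ev_const.
- move=> d f; rewrite [kappa _]/(kap _); split.
    by move=> /thF; rewrite kapE => /lamF.
  by move=> H; apply/thF; rewrite kapE; apply/lamF.
- move=> g; exists (ev (lin M) (ev (lam \o v) g)); apply: thI.
  by rewrite [kappa _]/(kap _) kapE /lam linK // mulmxV.
Qed.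

End Coordinates.

(** * Graded factoriality of K[[s,t]] *)

Lemma ex_least (P : nat -> Prop) : (exists k, P k) ->
  exists2 k, P k & forall j, (j < k)%N -> ~ P j.
Proof.
move=> [k Pk]; apply: contrapT => H.
suff : ~ P k by [].
elim/ltn_ind: k {Pk} => k IH Pk; apply: H; exists k => //.
Qed.

Section Divisibility.
Variable B : idomainType.
Implicit Types e f g h : B.

Definition dv f g := exists h, g = f * h.

Lemma dv_refl f : dv f f. Proof. by exists 1; rewrite mulr1. Qed.
Lemma dv_trans f g h : dv f g -> dv g h -> dv f h.
Proof. by move=> [x ->] [y ->]; exists (x * y); rewrite mulrA. Qed.
Lemma dv_mull f g h : dv f g -> dv f (h * g).
Proof. by move=> [x ->]; exists (h * x); rewrite mulrCA. Qed.
Lemma dv_mulr f g h : dv f g -> dv f (g * h).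
Proof. by rewrite mulrC; apply: dv_mull. Qed.
Lemma dvD f g h : dv f g -> dv f h -> dv f (g + h).
Proof. by move=> [x ->] [y ->]; exists (x + y); rewrite mulrDr. Qed.
Lemma dv0 f : dv f 0. Proof. by exists 0; rewrite mulr0. Qed.
Lemma dv_mul2l h f g : h != 0 -> dv (h * f) (h * g) -> dv f g.
Proof. by move=> h0 [x]; rewrite -mulrA => /(mulfI h0) ->; exists x. Qed.
Lemma dvM f f' g g' : dv f f' -> dv g g' -> dv (f * g) (f' * g').
Proof. by move=> [x ->] [y ->]; exists (x * y); rewrite mulrACA. Qed.
Lemma dv_unit f g : g \is a GRing.unit -> dv f g -> f \is a GRing.unit.
Proof. by move=> ug [x E]; move: ug; rewrite E unitrM => /andP[]. Qed.
Lemma unit_dv f g : f \is a GRing.unit -> dv f g.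
Proof. by move=> uf; exists (f^-1 * g); rewrite mulrA mulrV // mul1r. Qed.
End Divisibility.

Section Variables_prime.
Variables (K : fieldType) (n : nat) (i : 'I_n).
Implicit Types (f g h : fps K n) (m : 'X_{1..n}).
Local Notation X := (fps_var K i).

Lemma dv_var f : (forall m, m i = 0%N -> f m = 0) -> dv X f.
Proof.
move=> H; have [m|h Hh] := @fps_mono_dvd _ _ U_(i)%MM f.
  by rewrite lep1mP negbK => /eqP; apply: H.
by exists h; rewrite fps_varE.
Qed.

Lemma var_mul0 h m : m i = 0%N -> (X * h) m = 0.
Proof. by move=> m0; rewrite fps_varE fps_monoM lep1mP m0. Qed.

Lemma prime_var f g : dv X (f * g) -> dv X f \/ dv X g.
Proof.
move=> [h E].
have dK : GRing.integral_domain_axiom K by move=> x y /eqP; rewrite mulf_eq0.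
have P a b : ((a + b)%MM i == 0%N) = (a i == 0%N) && (b i == 0%N).
  by rewrite mnmDE addn_eq0.
case: (@face_prime K n (fun m => m i == 0%N) P f g _ dK).
- by move=> m /eqP m0; rewrite E var_mul0.
- by move=> H; left; apply: dv_var => m /eqP; apply: H.
- by move=> H; right; apply: dv_var => m /eqP; apply: H.
Qed.

Lemma var_neq0 : X != 0. Proof. by rewrite fps_varE fps_mono_neq0. Qed.

Lemma var_ndv j : i != j -> ~ dv X (fps_var K j).
Proof.
move=> ij [h E]; have := congr1 (fun f : fps K n => f U_(j)%MM) E.
rewrite var_mul0; last by rewrite mnm1E eq_sym (negPf ij).
by rewrite fps_varE fps_mono eqxx => /eqP; rewrite oner_eq0.
Qed.
End Variables_prime.

Section Graded.
Variables (K : fieldType) (G : zmodType) (gam : G).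
Local Notation B := (fps K 2).
Local Notation i0 := (ord0 : 'I_2).
Local Notation i1 := (ord_max : 'I_2).
Local Notation s := (fps_var K i0).
Local Notation t := (fps_var K i1).
Implicit Types (e f g h : B) (m : 'X_{1..2}) (c d : G).

(** The grading in which [t] has degree [gam] and [s] has degree [- gam]. *)
Definition wt m : G := gam *+ m i1 - gam *+ m i0.

Lemma wtD m m' : wt (m + m')%MM = wt m + wt m'.
Proof. by rewrite /wt !mnmDE !mulrnDr opprD addrACA. Qed.
Lemma wt0 : wt 0%MM = 0.
Proof. by rewrite /wt !mnm0E !mulr0n subr0. Qed.

Definition hom c f := forall m, f m != 0 -> wt m = c.
Definition comp c f : B := fun m => if wt m == c then f m else 0.

Lemma hom_comp c f : hom c (comp c f).
Proof. by move=> m; rewrite /comp; case: (wt m =P c) => // _ /eqP. Qed.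
Lemma comp_id c f : hom c f -> comp c f = f.
Proof.
move=> H; apply: fps_eq => m; rewrite /comp; case: eqP => // Hm.
by apply/esym/eqP/negPn/negP => /H.
Qed.
Lemma hom1 : hom 0 1.
Proof. by move=> m; rewrite fps1; case: (m =P _) => [-> _|_ /eqP//]; exact: wt0. Qed.
Lemma hom_mono m : hom (wt m) (mono m).
Proof. by move=> m'; rewrite fps_mono; case: (m =P m') => [->//|_ /eqP]. Qed.
Lemma hom_t : hom gam t.
Proof.
rewrite fps_varE (_ : gam = wt U_(i1)%MM); first exact: hom_mono.
by rewrite /wt !mnm1E /= subr0.
Qed.
Lemma hom_s : hom (- gam) s.
Proof.
rewrite fps_varE (_ : - gam = wt U_(i0)%MM); first exact: hom_mono.
by rewrite /wt !mnm1E /= sub0r.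
Qed.

Lemma homM c d f g : hom c f -> hom d g -> hom (c + d) (f * g).
Proof.
move=> Hf Hg m fgm; apply: contrapT => Hm; case/negP: fgm.
rewrite fpsM big1 // => -[[k1 h1] [k2 h2]] /= /eqP E.
have [->|f1] := eqVneq (f k1) 0; first by rewrite mul0r.
have [->|g2] := eqVneq (g k2) 0; first by rewrite mulr0.
by case: Hm; rewrite E wtD Hf // Hg.
Qed.
Lemma homX c f k : hom c f -> hom (c *+ k) (f ^+ k).
Proof.
move=> H; elim: k => [|k IH]; first by rewrite mulr0n expr0; apply: hom1.
by rewrite mulrS exprS; apply: homM.
Qed.

Lemma comp_mul c d e f : hom c e -> comp (c + d) (e * f) = e * comp d f.
Proof.
move=> He; apply: fps_eq => m; rewrite /comp; case: eqP => Em.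
  rewrite !fpsM; apply: eq_bigr => -[[k1 h1] [k2 h2]] /= /eqP E.
  have [->|e1] := eqVneq (e k1) 0; first by rewrite !mul0r.
  by move: Em; rewrite E wtD (He _ e1) => /addrI ->; rewrite eqxx.
apply/esym/eqP/negPn/negP => H; apply: Em.
exact: (homM He (@hom_comp d f)).
Qed.

Lemma hom_div c d e f : e != 0 -> hom c e -> hom d (e * f) -> hom (d - c) f.
Proof.
move=> e0 He Hef; have := comp_mul (d - c) f He.
by rewrite addrC subrK comp_id // => /(mulfI e0) ->; apply: hom_comp.
Qed.

Lemma hom_unit c f : hom c f -> f \is a GRing.unit -> c = 0.
Proof. by move=> H; rewrite fps_unitE => /H; rewrite wt0. Qed.

(* The points of the coordinate axis s = 0 of the monoid of monomials. *)
Local Notation ax k := (U_(i1) *+ k)%MM.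

Lemma axE m : m i0 = 0%N -> m = ax (m i1).
Proof.
move=> m0; apply/mnmP => j; rewrite mulmnE mnm1E.
case: j => -[|[|//]] /= hj.
  by rewrite (_ : Ordinal hj = i0) ?m0 //; apply: val_inj.
by rewrite (_ : Ordinal hj = i1) ?eqxx ?mul1n //; apply: val_inj.
Qed.

Lemma s_ax h k : (s * h) (ax k) = 0.
Proof. by apply: var_mul0; rewrite mulmnE mnm1E. Qed.

(** Modulo [s] the ring is a discrete valuation ring with uniformiser [t]. *)
Lemma ax_div k f g : f (ax k) != 0 ->
  (forall j, (j < k)%N -> f (ax j) = 0) -> (forall j, (j < k)%N -> g (ax j) = 0) ->
  exists q r, g = q * f + s * r.
Proof.
move=> fk fj gj.
pose u (h : B) : B := fun m => if m i0 == 0%N then h (m + ax k)%MM else 0.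
have uE (h : B) : (forall j, (j < k)%N -> h (ax j) = 0) ->
    exists r, h = mono (ax k) * u h + s * r.
  move=> hj; have [m m0|r Hr] := @dv_var _ _ i0 (h - mono (ax k) * u h).
    rewrite fpsB fps_monoM; case: ifPn => [le|/negP nle].
      by rewrite /u mnmBE m0 sub0n eqxx submK // subrr.
    rewrite (axE m0) hj ?subr0 // ltnNge; apply/negP => km; apply: nle.
    rewrite (axE m0); apply/mnm_lepP => j; rewrite !mulmnE.
    by rewrite leq_mul2l km orbT.
  by exists r; rewrite -Hr addrC subrK.
have [rf Ef] := uE _ fj; have [rg Eg] := uE _ gj.
have uf : u f \is a GRing.unit by rewrite fps_unitE /u mnm0E eqxx add0m.
move: (u f) (u g) uf Ef Eg => a b ua -> ->.
exists (b / a), (rg - b / a * rf).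
by rewrite -{1}(divrK ua b); ring.
Qed.

Section Syzygy.
Variables (f g : B).
Hypothesis g0 : g != 0.

Definition syz (p : B * B) := p.1 * f = p.2 * g.

Lemma syz_prop p q : syz p -> syz q -> p.1 * q.2 = q.1 * p.2.
Proof.
rewrite /syz => Hp Hq; apply: (mulIf g0).
by rewrite -[_ * _ * g]mulrA -Hq mulrCA [p.1 * _]Hp mulrA.
Qed.

(** The syzygies of [f] and [g] form a free module of rank one. A generator is a
    syzygy whose reduction modulo [s] has the least [t]-adic order: every syzygy
    is a multiple of it modulo [s], the quotient by [s] is again a syzygy, and
    the successive quotients sum up to a series. *)
Lemma syz_gen p k : syz p -> p.1 (ax k) != 0 ->
  (forall q j, syz q -> (j < k)%N -> q.1 (ax j) = 0) ->
  forall q, syz q -> exists b, q = (b * p.1, b * p.2).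
Proof.
move=> Sp pk mink.
have step (q : B * B) : exists b : B * (B * B), syz q ->
    syz b.2 /\ q = (b.1 * p.1 + s * b.2.1, b.1 * p.2 + s * b.2.2).
  have [Sq|nSq] := pselect (syz q); last by exists (0, (0, 0)).
  have [b [r Er]] := ax_div pk (mink p ^~ Sp) (mink q ^~ Sq).
  have [[x Ex]|[r' Er']] : dv s p.1 \/ dv s (q.2 - b * p.2).
  - apply: prime_var; exists (r * p.2).
    by rewrite mulrBr (syz_prop Sp Sq) {1}Er; ring.
  - by move: pk; rewrite Ex s_ax eqxx.
  have E2 : q.2 = b * p.2 + s * r' by rewrite -Er' addrC subrK.
  exists (b, (r, r')) => _; split; last by rewrite [q]surjective_pairing Er E2.
  apply: (mulfI (var_neq0 K i0)); move: Sq Sp; rewrite /syz Er E2 /= => Sq Sp.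
  have : s * (r * f) = (b * p.1 + s * r) * f - b * (p.1 * f) by ring.
  by rewrite Sq Sp => ->; ring.
have [F HF] := choice step.
move=> q Sq.
pose x := fix x i := if i is i'.+1 then (F (x i')).2 else q.
have Sx i : syz (x i) by elim: i => // i /HF[].
pose b i := \sum_(j < i) (F (x j)).1 * s ^+ j.
have fs i (y : B) : ford i (s ^+ i * y).
  by apply: fordMr; rewrite -[X in ford X]muln1; apply: fordX; apply: ford_var.
have bS i : b i.+1 = b i + (F (x i)).1 * s ^+ i by rewrite /b big_ord_recr.
have qE i : q = (b i * p.1 + s ^+ i * (x i).1, b i * p.2 + s ^+ i * (x i).2).
  elim: i => [|i IH].
    by rewrite /b big_ord0 !mul0r !add0r expr0 !mul1r -surjective_pairing.
  have [_ Ei] := HF _ (Sx i); rewrite {1}IH bS [x i.+1]/((F (x i)).2).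
  by rewrite {1 2}Ei exprS; congr pair; rewrite /=; ring.
have [i|L HL] := @fps_limit _ _ b.
  by rewrite bS addrAC subrr add0r mulrC; apply: fs.
exists L; rewrite [q]surjective_pairing; congr pair; apply: ford_eq => i.
  rewrite (qE i) /= (_ : _ - _ = s ^+ i * (x i).1 - (L - b i) * p.1); last by ring.
  by apply: fordB; [exact: fs | apply: fordMr].
rewrite (qE i) /= (_ : _ - _ = s ^+ i * (x i).2 - (L - b i) * p.2); last by ring.
by apply: fordB; [exact: fs | apply: fordMr].
Qed.

Lemma syz_ax : exists p k, syz p /\ (p.1 (ax k) != 0 \/ p.2 (ax k) != 0).
Proof.
pose P j := exists p m, [/\ syz p, p.1 m != 0 \/ p.2 m != 0 & mdeg m = j].
have [|_ [p [m [Sp nz <-]]] minp] := @ex_least P.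
  have [m gm] := fps_neq0P g0.
  by exists (mdeg m), (g, f), m; split; [rewrite /syz mulrC | left |].
apply: contrapT => H.
have ax0 k : p.1 (ax k) = 0 /\ p.2 (ax k) = 0.
  split; apply/eqP/negPn/negP => ?; apply: H; exists p, k; split=> //.
    by left. by right.
have [h1 E1] : dv s p.1 by apply: dv_var => m' /axE ->; case: (ax0 (m' i1)).
have [h2 E2] : dv s p.2 by apply: dv_var => m' /axE ->; case: (ax0 (m' i1)).
have Sh : syz (h1, h2).
  by apply: (mulfI (var_neq0 K i0)); rewrite /= !mulrA -E1 -E2.
have hm : (U_(i0) <= m)%MM.
  by case: nz; rewrite (E1, E2) fps_varE fps_monoM; case: ifP; rewrite ?eqxx.
apply: (minp (mdeg (m - U_(i0))%MM)).
  by rewrite -{2}(submK hm) mdegD mdeg1 addn1.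
exists (h1, h2), (m - U_(i0))%MM; split=> //.
by case: nz; rewrite (E1, E2) fps_varE fps_monoM hm; [left | right].
Qed.
End Syzygy.

(** The cofactor of a generating syzygy is a greatest common divisor; it is
    homogeneous because the module of syzygies is graded. *)
Lemma hom_gcd a b f g : f != 0 -> g != 0 -> hom a f -> hom b g ->
  exists c (d : B), [/\ hom c d, dv d f, dv d g & forall e, dv e f -> dv e g -> dv e d].
Proof.
wlog : a b f g / exists p k, [/\ syz f g p, p.1 (ax k) != 0 &
   forall q j, syz f g q -> (j < k)%N -> q.1 (ax j) = 0].
  move=> Hw f0 g0 Hf Hg.
  pose P k := exists p, syz f g p /\ (p.1 (ax k) != 0 \/ p.2 (ax k) != 0).
  have [|k [p [Sp pk]] mink] := @ex_least P.
    by have [p [k H]] := syz_ax f g0; exists k, p.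
  case: pk => pk.
    apply: (Hw a b) => //; exists p, k; split=> // q j Sq jk.
    by apply/eqP/negPn/negP => ?; apply: (mink j) => //; exists q; split=> //; left.
  suff [c [d [hd df dg H]]] : exists c (d : B),
      [/\ hom c d, dv d g, dv d f & forall e, dv e g -> dv e f -> dv e d].
    by exists c, d; split=> // e ef eg; apply: H.
  apply: (Hw b a) => //; exists (p.2, p.1), k; split=> //.
  move=> q j Sq jk; apply/eqP/negPn/negP => ?; apply: (mink j) => //.
  by exists (q.2, q.1); split; [exact/esym | right].
move=> [p [k [Sp pk mink]]] f0 g0 Hf Hg.
pose w := wt (ax k).
pose p' := (comp w p.1, comp (w + a - b) p.2).
have Sp' : syz f g p'.
  rewrite /syz /= [LHS]mulrC [RHS]mulrC -(comp_mul w p.1 Hf).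
  rewrite -(comp_mul (w + a - b) p.2 Hg) [f * _]mulrC Sp [_ * g]mulrC.
  by congr (comp _ _); rewrite [in RHS]addrC subrK addrC.
have p'k : p'.1 (ax k) != 0 by rewrite /= /comp eqxx.
have [|d Ed] := @syz_gen f g g0 p' k Sp' p'k mink (g, f).
  by rewrite /syz mulrC.
have [Eg Ef] : g = d * p'.1 /\ f = d * p'.2 by case: Ed.
have p1 : p'.1 != 0 by apply: contra_neq g0 => E; rewrite Eg E mulr0.
exists (b - w), d; split.
- apply: (hom_div p1); first exact: hom_comp.
  by rewrite mulrC -Eg.
- by rewrite Ef; apply: dv_mulr; apply: dv_refl.
- by rewrite Eg; apply: dv_mulr; apply: dv_refl.
move=> e [x Ex] [y Ey].
have e0 : e != 0 by apply: contra_neq f0; rewrite Ex => ->; rewrite mul0r.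
have [|z Ez] := @syz_gen f g g0 p' k Sp' p'k mink (y, x).
  by rewrite /syz /= Ex Ey; ring.
have Ey' : y = z * p'.1 by case: Ez.
by exists z; apply: (mulIf p1); rewrite -Eg Ey Ey' mulrA.
Qed.
End Graded.

Section GradedPrimes.
Variables (K : fieldType) (G : zmodType) (gam : G).
Local Notation B := (fps K 2).
Local Notation i0 := (ord0 : 'I_2).
Local Notation i1 := (ord_max : 'I_2).
Local Notation s := (fps_var K i0).
Local Notation t := (fps_var K i1).
Local Notation hom := (@hom K G gam).
Implicit Types (e f g h r : B) (c d : G).

Definition hprime r := [/\ r != 0, exists c, hom c r, r \isn't a GRing.unit
  & forall c d f g, hom c f -> hom d g -> dv r (f * g) -> dv r f \/ dv r g].

Lemma nunit_ford f : f \isn't a GRing.unit -> ford 1 f.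
Proof. by rewrite fps_unitE negbK => /eqP H; apply/ford1E. Qed.

Lemma not_fordM k f g : ~ ford k.+1 (f * g) -> f \isn't a GRing.unit -> ~ ford k g.
Proof. by move=> H /nunit_ford Hf Hg; apply: H; exact: (fordM Hf Hg). Qed.

(** In the monoid of homogeneous elements, where greatest common divisors exist,
    irreducible elements are prime. *)
Lemma hirr_prime c r : r != 0 -> hom c r -> r \isn't a GRing.unit ->
  (forall d g h, hom d g -> r = g * h -> g \is a GRing.unit \/ h \is a GRing.unit) -> hprime r.
Proof.
move=> r0 Hr nr irr; split=> //; first by exists c.
move=> a b f g Hf Hg rfg.
have [->|f0] := eqVneq f 0; first by left; apply: dv0.
have [->|g0] := eqVneq g 0; first by right; apply: dv0.
have [d [u [Hd [y Ey] uf Hu]]] := hom_gcd r0 f0 Hr Hf.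
have [uu|uy] := irr _ _ _ Hd Ey; last first.
  left; apply: dv_trans uf; exists y^-1; rewrite Ey -mulrA mulrV //.
  by rewrite mulr1.
right.
have [_ [D [_ Drg Dfg HD]]] :=
  hom_gcd (mulf_neq0 r0 g0) (mulf_neq0 f0 g0) (homM Hr Hg) (homM Hf Hg).
have rD : dv r D by apply: HD => //; apply: dv_mulr; apply: dv_refl.
have [x Ex] : dv g D by apply: HD; apply: dv_mull; apply: dv_refl.
have ux : x \is a GRing.unit.
  apply: (dv_unit uu); apply: Hu; apply: (dv_mul2l g0); rewrite -Ex.
    by rewrite mulrC.
  by rewrite mulrC.
apply: dv_trans rD _; rewrite Ex; exists x^-1; by rewrite -mulrA mulrV ?mulr1.
Qed.

Lemma hprime_ex c f : f != 0 -> hom c f -> f \isn't a GRing.unit ->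
  exists2 r, hprime r & dv r f.
Proof.
move=> f0; have [k nk] := fps_neq0_ford f0.
elim: k c f f0 nk => [|k IH] c f f0 nk Hf nf; first by case: nk.
have [[d [g [h [Hg E ng nh]]]]|H] := pselect (exists d g h, [/\ hom d g,
    f = g * h, g \isn't a GRing.unit & h \isn't a GRing.unit]).
  have g0 : g != 0 by apply: contra_neq f0; rewrite E => ->; rewrite mul0r.
  have [|r pr rg] := IH d g g0 _ Hg ng.
    by apply: (not_fordM (f := h)) => //; rewrite mulrC -E.
  by exists r => //; rewrite E; apply: dv_mulr.
exists f; last exact: dv_refl.
apply: (@hirr_prime c) => // d g h Hg E.
apply: contrapT => /not_orP[/negP ng /negP nh]; apply: H.
by exists d, g, h.
Qed.

Lemma hprimeX r k c f : hprime r -> hom c f -> dv r (f ^+ k) -> dv r f.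
Proof.
move=> [r0 _ nr P] Hf; elim: k => [|k IH].
  by rewrite expr0 => /(dv_unit (unitr1 _)) ur; move: nr; rewrite ur.
by rewrite exprS => /(P _ _ _ _ Hf (homX (k:=k) Hf))[].
Qed.

Lemma dv_hom c d f g : f != 0 -> hom c f -> hom d g -> dv f g ->
  exists2 h, hom (d - c) h & g = f * h.
Proof. by move=> f0 Hf Hg [h E]; exists h => //; apply: (hom_div f0 Hf); rewrite -E. Qed.

Lemma hprime_cancel r k c d e f : hprime r -> hom c e -> hom d f ->
  ~ dv r e -> dv (r ^+ k) (e * f) -> dv (r ^+ k) f.
Proof.
move=> pr He Hf ne; have [r0 [a Ha] nr P] := pr.
elim: k => [|k IH] H; first by rewrite expr0; apply: unit_dv; apply: unitr1.
have /IH/(dv_hom (expf_neq0 k r0) (homX (k:=k) Ha) Hf)[h Hh Ef] : dv (r ^+ k) (e * f).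
  by apply: dv_trans H; rewrite exprSr; apply: dv_mulr; apply: dv_refl.
move: H; rewrite Ef exprSr mulrCA => /(dv_mul2l (expf_neq0 k r0)).
by case/(P _ _ _ _ He Hh) => // rh; apply: dvM => //; apply: dv_refl.
Qed.

(** The divisorial valuation of a homogeneous prime, as a relation. *)
Definition hval r e k := dv (r ^+ k) e /\ ~ dv (r ^+ k.+1) e.

Lemma hval_uniq r e j k : hval r e j -> hval r e k -> j = k.
Proof.
wlog: j k / (j <= k)%N.
  by move=> H; case: (leqP j k) => [|/ltnW] jk ? ?; [|apply/esym]; apply: H.
rewrite leq_eqVlt => /orP[/eqP //|jk] [_ nj] [dk _]; case: nj.
by apply: dv_trans dk; rewrite -(subnK jk) exprD mulrC; apply: dv_mulr; apply: dv_refl.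
Qed.

Lemma hvalM r c d e f j k : hprime r -> hom c e -> hom d f ->
  hval r e j -> hval r f k -> hval r (e * f) (j + k).
Proof.
move=> pr He Hf [de ne] [df nf]; have [r0 [a Ha] _ P] := pr.
split; first by rewrite exprD; apply: dvM.
have [x Hx Ex] := dv_hom (expf_neq0 j r0) (homX (k:=j) Ha) He de.
have [y Hy Ey] := dv_hom (expf_neq0 k r0) (homX (k:=k) Ha) Hf df.
rewrite Ex Ey mulrACA -exprD exprSr.
move=> /(dv_mul2l (expf_neq0 _ r0)) /(P _ _ _ _ Hx Hy)[] H.
  by apply: ne; rewrite exprSr Ex; apply: dvM => //; apply: dv_refl.
by apply: nf; rewrite exprSr Ey; apply: dvM => //; apply: dv_refl.
Qed.

Lemma hval0 r e : ~ dv r e -> hval r e 0.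
Proof. by split; [rewrite expr0; apply: unit_dv; apply: unitr1 | rewrite expr1]. Qed.

Lemma hval_self r : hprime r -> hval r r 1.
Proof.
move=> [r0 _ nr _]; split; first by rewrite expr1; apply: dv_refl.
move=> [x]; rewrite expr2 -mulrA -{1}[r]mulr1 => /(mulfI r0) E.
by case/negP: nr; apply: (dv_unit (unitr1 _)); exists x.
Qed.

Lemma hprime_not_st r : hprime r -> ~ (dv r s /\ dv r t).
Proof.
move=> [_ _ nr _] [[a Ea] [b Eb]].
have f1 := nunit_ford nr.
have ua : a \is a GRing.unit.
  apply: contrapT => /negP /nunit_ford fa; have := fordM f1 fa.
  move=> /(_ U_(i0)%MM); rewrite mdeg1 -Ea fps_varE fps_mono eqxx => /(_ isT).
  by move/eqP; rewrite oner_eq0.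
have : t = s * (a^-1 * b) by rewrite Ea Eb -mulrA mulVKr.
move=> /(congr1 (fun h : B => h U_(i1)%MM)).
rewrite !fps_varE fps_monoM lep1mP mnm1E /= fps_mono eqxx => /eqP.
by rewrite oner_eq0.
Qed.

(** The prime [r'] does not divide both [s] and [t], so it divides [r]; and a
    proper factor of [r] is not divisible by [r]. *)
Lemma hprime_assoc r r' j k : hprime r -> hprime r' ->
  dv r' (r * s ^+ j) -> dv r' (r * t ^+ k) -> dv r' r /\ dv r r'.
Proof.
move=> pr pr' Hs Ht; have [r0 [a Ha] nr P] := pr; have [r0' [a' Ha'] nr' P'] := pr'.
have d' : dv r' r.
  have [//|Hs'] := P' _ _ _ _ Ha (homX (k:=j) (hom_s gam)) Hs.
  have [//|Ht'] := P' _ _ _ _ Ha (homX (k:=k) (hom_t gam)) Ht.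
  case: (hprime_not_st pr'); split.
    exact: hprimeX (hom_s gam) Hs'.
  exact: hprimeX (hom_t gam) Ht'.
split=> //; have [x Hx E] := dv_hom r0' Ha' Ha d'.
have : dv r (r' * x) by rewrite -E; apply: dv_refl.
case/(P _ _ _ _ Ha' Hx) => // -[y Ey].
case/negP: nr'; apply: (dv_unit (unitr1 _)); exists y.
by apply: (mulfI r0); rewrite {1}E Ey; ring.
Qed.

End GradedPrimes.

(** * The divisor class group of the degree zero part of K[[s,t]] *)

Lemma zprojP (V : zmodType) (X : set V) (x y : V) :
  zproj X x = zproj X y <-> subgroup_span X (x - y).
Proof.
rewrite /zproj; split; first by move/eqP; rewrite -Quotient.idealrBE.
by move=> h; apply/eqP; rewrite -Quotient.idealrBE.
Qed.

Lemma zproj_is_zmod (V : zmodType) (X : set V) : zmod_morphism (@zproj V X).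
Proof. exact: pi_is_zmod_morphism. Qed.

Lemma zproj_repr (V : zmodType) (X : set V) (u : zquot X) : zproj X (repr u) = u.
Proof. exact: reprK. Qed.

Lemma ideal_span_sub (A : comPzRingType) (J I : set A) :
  is_ideal I -> J `<=` I -> ideal_span J `<=` I.
Proof. by move=> II JI x Hx; apply: Hx. Qed.

Lemma sub_ideal_span (A : comPzRingType) (J : set A) : J `<=` ideal_span J.
Proof. by move=> x Jx I _; apply. Qed.

Lemma zero_prime (A : comPzRingType) (B : idomainType) (f : {rmorphism A -> B}) :
  (forall a, f a = 0 -> a = 0) -> is_prime [set 0 : A].
Proof.
move=> f0; split=> [||x y].
- by split=> [|x y -> ->|a x ->] //=; rewrite ?addr0 ?mulr0.
- by move/(congr1 f); rewrite rmorph0 rmorph1 => /eqP; rewrite oner_eq0.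
- move/(congr1 f); rewrite rmorph0 rmorphM => /eqP; rewrite mulf_eq0.
  by case/orP => /eqP /f0 ->; [left | right].
Qed.

Section GradedClassGroup.
Variables (K : fieldType) (G : zmodType) (gam : G).
Local Notation B := (fps K 2).
Local Notation i0 := (ord0 : 'I_2).
Local Notation i1 := (ord_max : 'I_2).
Local Notation s := (fps_var K i0).
Local Notation t := (fps_var K i1).
Local Notation hom := (@hom K G gam).
Local Notation hprime := (@hprime K G gam).
Implicit Types (e f g h r : B) (c d : G).

Hypothesis gen : forall c, exists j : nat, c = gam *+ j.
Variables (A : comPzRingType) (iota : {rmorphism A -> B}).
Hypothesis iota_inj : injective iota.
Hypothesis iotaP : forall b, hom 0 b <-> exists a, iota a = b.
Implicit Types (a b : A) (q : set A).

Let iota_hom a : hom 0 (iota a). Proof. by apply/iotaP; exists a. Qed.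
Arguments iota_hom a : clear implicits.

Let iota0 a : iota a = 0 -> a = 0.
Proof. by move=> E; apply: iota_inj; rewrite E rmorph0. Qed.

Local Notation zeroP := ([set 0] : set A).

Let zeroP_prime : is_prime zeroP := zero_prime iota0.

(** The contraction of the ideal generated by [r]. *)
Definition contr r : set A := [set a | dv r (iota a)].

Lemma contr_ideal r : is_ideal (contr r).
Proof.
rewrite /contr; split=> /= [|x y|a x].
- by rewrite rmorph0; apply: dv0.
- by rewrite rmorphD; apply: dvD.
- by rewrite rmorphM; apply: dv_mull.
Qed.

Lemma contr_prime r : hprime r -> is_prime (contr r).
Proof.
move=> [r0 _ nr P]; split; first exact: contr_ideal.
  by rewrite /contr /= rmorph1 => /(dv_unit (unitr1 _)); apply/negP.
by move=> x y; rewrite /contr /= rmorphM; apply: P; apply: iota_hom.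
Qed.

(** Powers of [s], and powers of [t], take every degree, because [gam] generates
    the group of degrees as a monoid. *)
Lemma s_twist c : exists j, forall f, hom c f -> exists a, iota a = f * s ^+ j.
Proof.
have [j Ej] := gen c; exists j => f Hf; apply/iotaP.
have := homM Hf (homX (k:=j) (hom_s gam)).
by rewrite mulNrn -Ej subrr.
Qed.

Lemma t_twist c : exists j, forall f, hom c f -> exists a, iota a = f * t ^+ j.
Proof.
have [j Ej] := gen (- c); exists j => f Hf; apply/iotaP.
have := homM Hf (homX (k:=j) (hom_t gam)).
by rewrite -Ej subrr.
Qed.

Lemma contr_nonzero r : hprime r -> exists2 a, contr r a & a <> 0.
Proof.
move=> [r0 [c Hc] _ _]; have [j /(_ _ Hc)[a Ea]] := s_twist c.
exists a; first by rewrite /contr /= Ea; apply: dv_mulr; apply: dv_refl.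
move=> a0; move: Ea; rewrite a0 rmorph0 => /esym/eqP.
by rewrite mulf_eq0 (negPf r0) expf_eq0 (negPf (var_neq0 K i0)) andbF.
Qed.

Lemma contr_sub r r' : hprime r -> hprime r' -> contr r `<=` contr r' ->
  dv r' r /\ dv r r'.
Proof.
move=> pr pr' sub; have [r0 [c Hc] _ _] := pr.
have [j /(_ _ Hc)[a Ea]] := s_twist c; have [k /(_ _ Hc)[b Eb]] := t_twist c.
apply: (@hprime_assoc _ _ gam _ _ j k) => //.
  by rewrite -Ea; apply: sub; rewrite /contr /= Ea; apply: dv_mulr; apply: dv_refl.
by rewrite -Eb; apply: sub; rewrite /contr /= Eb; apply: dv_mulr; apply: dv_refl.
Qed.

(** Starting from an element [e] whose multiples of degree zero lie in [q], remove
    homogeneous prime factors [r]: unless [q] contains the contraction of [r],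
    the multiples of [e / r] lie in [q] too, and a unit is never reached. *)
Lemma prime_contr q a : is_prime q -> q a -> a <> 0 ->
  exists2 r, hprime r & contr r `<=` q.
Proof.
move=> [[_ _ qM] q1 qP] qa a0.
suff H k e c : hom c e -> ~ ford k e -> (forall b, dv e (iota b) -> q b) ->
    exists2 r, hprime r & contr r `<=` q.
  have e0 : iota a != 0 by apply/eqP => /iota0.
  have [k nk] := fps_neq0_ford e0.
  apply: (H k _ _ (iota_hom a) nk) => b [h Eb].
  have : hom (0 - 0) h by apply: (hom_div e0 (iota_hom a)); rewrite -Eb.
  rewrite subrr => /iotaP[x Ex]; rewrite (_ : b = x * a); first exact: qM.
  by apply: iota_inj; rewrite rmorphM Ex mulrC -Eb.
elim: k e c => [|k IH] e c He nk eq; first by case: nk.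
have e0 : e != 0 by apply: contra_notN nk => /eqP ->; apply: ford_zero.
have [ue|ne] := boolP (e \is a GRing.unit).
  by case: q1; apply: eq; apply: unit_dv.
have [r pr re] := hprime_ex e0 He ne; have [r0 [d Hd] nr _] := pr.
have [e' He' Ee] := dv_hom r0 Hd He re.
have [sub|/existsNP[h /not_implyP[rh nqh]]] := pselect (contr r `<=` q).
  by exists r.
apply: (IH e' _ He'); first by apply: (not_fordM (f := r)) => //; rewrite -Ee.
move=> b eb; have /eq/qP[] // : dv e (iota (h * b)).
by rewrite rmorphM Ee; apply: dvM.
Qed.

Lemma contr_height1 r : hprime r -> is_height (contr r) 1.
Proof.
move=> pr; split.
  exists (fun i => if i is 0%N then zeroP else contr r) => //; split.
    by case=> [|[|//]] _; [exact: zeroP_prime | exact: contr_prime].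
  case=> [|//] _; split; first by move=> x ->; have [] := contr_ideal r.
  by move=> sub; have [a ra /eqP a0] := contr_nonzero pr; case/eqP: a0; apply: sub.
move=> [c [cp cs] c2].
have [_ n01] := cs 0%N isT; have [_ n12] := cs 1%N isT.
have [sub12 _] := cs 1%N isT; rewrite c2 in sub12 n12.
have [[c00 _ _] _ _] := cp 0%N isT.
have [a [c1a na]] : exists a, c 1%N a /\ ~ c 0%N a.
  by apply: contrapT => H; apply: n01 => x c1x; apply: contrapT => ?; apply: H; exists x.
have a0 : a <> 0 by move=> E; apply: na; rewrite E.
have [r' pr' sub'] := prime_contr (cp 1%N isT) c1a a0.
have [_ H] := contr_sub pr' pr (subset_trans sub' sub12).
by apply: n12 => x /= rx; apply: sub'; apply: dv_trans rx.
Qed.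

Lemma prime_divisorE (Q : prime_divisor A) : exists2 r, hprime r & sval Q = contr r.
Proof.
case: Q => /= q hq; have /asboolP[qp [[c [cp cs] c1] n2]] := hq.
have [sub n01] := cs 0%N isT; rewrite c1 in sub n01.
have [[c00 _ _] _ _] := cp 0%N isT.
have [a [qa na]] : exists a, q a /\ ~ c 0%N a.
  by apply: contrapT => H; apply: n01 => x c1x; apply: contrapT => ?; apply: H; exists x.
have a0 : a <> 0 by move=> E; apply: na; rewrite E.
have [r pr rq] := prime_contr qp qa a0; exists r => //.
apply/seteqP; split=> //; apply: contrapT => nq; apply: n2.
exists (fun i => if i is 0%N then zeroP else if i is 1%N then contr r else q) => //.
split; first by case=> [|[|[|//]]] _ //; exact: contr_prime.
case=> [|[|//]] _ /=; split=> //.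
  by move=> x ->; have [] := contr_ideal r.
by move=> H; have [b rb /eqP b0] := contr_nonzero pr; case/eqP: b0; apply: H.
Qed.

Definition contr_divisor r (pr : hprime r) : prime_divisor A :=
  exist _ (contr r) (asboolT (conj (contr_prime pr) (contr_height1 pr))).

(** Multiplication by a power of one of [s] and [t] clears denominators, so that
    symbolic powers are given by divisibility in K[[s,t]]. *)
Lemma symbolicE r k a : hprime r -> symbolic_pow (contr r) k a <-> dv (r ^+ k) (iota a).
Proof.
move=> pr; have [r0 [c Hc] nr P] := pr; split.
  move=> [x nx H].
  have powdv j : ideal_pow (contr r) j `<=` [set y | dv (r ^+ j) (iota y)].
    elim: j => [|j IH] y /=; first by rewrite expr0 => _; apply: unit_dv; apply: unitr1.
    move=> Hy; apply: (@ideal_span_sub _ _ (contr (r ^+ j.+1)) (@contr_ideal _) _ y Hy).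
    by move=> _ [y1 [y2 [H1 H2 ->]]]; rewrite /contr /= rmorphM exprS; apply: dvM => //; apply: IH.
  have := powdv _ _ H; rewrite /= rmorphM.
  exact: hprime_cancel (iota_hom _) (iota_hom _) nx.
move=> ra.
have [f' Hf' Ef'] := dv_hom (expf_neq0 k r0) (homX (k:=k) Hc) (iota_hom a) ra.
suff main x d : hom d x -> ~ dv r x -> (forall c, exists j : nat, c = d *+ j) ->
    symbolic_pow (contr r) k a.
  have [rs|] := pselect (dv r s).
    apply: (main t _ (hom_t gam)); last exact: gen.
    by move=> rt; apply: (hprime_not_st pr).
  move=> nrs; apply: (main s _ (hom_s gam) nrs) => c'.
  by have [j Ej] := gen (- c'); exists j; rewrite mulNrn -Ej opprK.
move=> Hx nrx genx.
have [j Ej] := genx (- c); have [l El] := genx (- (d *+ (j * k))).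
have /iotaP[h Eh] : hom 0 (r * x ^+ j).
  by have := homM Hc (homX (k:=j) Hx); rewrite -Ej subrr.
have /iotaP[y Ey] : hom 0 (x ^+ (j * k + l)).
  by have := homX (k:=j * k + l) Hx; rewrite mulrnDr -El subrr.
have /iotaP[b Eb] : hom 0 (f' * x ^+ l).
  have := homM Hf' (homX (k:=l) Hx).
  by rewrite -El mulrnA -Ej sub0r mulNrn opprK addNr.
exists y.
  rewrite /contr /= Ey => /(hprimeX pr Hx); exact: nrx.
have -> : y * a = h ^+ k * b.
  apply: iota_inj; rewrite !rmorphM rmorphXn /= Ey Ef' Eh Eb exprMn exprD exprM.
  ring.
have hc : contr r h by rewrite /contr /= Eh; apply: dv_mulr; apply: dv_refl.
have powI i : is_ideal (ideal_pow (contr r) i).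
  by case: i => [|i]; [split | exact: is_ideal_span].
have [_ _ M] := powI k; rewrite mulrC; apply: M.
elim: (k) => [|i IH] //=; rewrite exprS; apply: (@sub_ideal_span _ _ (h * h ^+ i)).
by exists h, (h ^+ i).
Qed.

(** ** Divisors of homogeneous elements *)

Let rep (Q : prime_divisor A) := s2val (cid2 (prime_divisorE Q)).
Let rep_prime Q : hprime (rep Q). Proof. exact: (s2valP (cid2 (prime_divisorE Q))). Qed.
Let repE Q : sval Q = contr (rep Q). Proof. exact: (s2valP' (cid2 (prime_divisorE Q))). Qed.
Let rep_wt_ex Q : exists c, hom c (rep Q). Proof. by case: (rep_prime Q). Qed.
Let rep_wt Q : G := projT1 (cid (rep_wt_ex Q)).
Let rep_hom Q : hom (rep_wt Q) (rep Q).
Proof. exact: (projT2 (cid (rep_wt_ex Q))). Qed.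
Arguments rep_hom Q : clear implicits.

Definition is_hdiv e (D : weil_divisor A) : Prop :=
  forall Q, exists2 k : nat, coeff Q D = k%:Z & hval (rep Q) e k.

Definition divwt (D : weil_divisor A) : G :=
  fglift (rep_wt : prime_divisor A -> zmodule G) D.

Lemma divwtB D D' : divwt (D - D') = divwt D - divwt D'.
Proof. exact: (lift_is_additive (rep_wt : prime_divisor A -> zmodule G) D D'). Qed.
Lemma divwt0 : divwt 0 = 0.
Proof. by rewrite -[0](subrr (0 : weil_divisor A)) divwtB subrr. Qed.
Lemma divwtD D D' : divwt (D + D') = divwt D + divwt D'.
Proof. by have := divwtB D (0 - D'); rewrite [divwt (0 - D')]divwtB divwt0 opprB subr0 sub0r opprK. Qed.
Lemma divwtU Q : divwt << Q >> = rep_wt Q.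
Proof. by rewrite /divwt liftU; exact: mulr1z. Qed.

Lemma is_hdivM c d e f D D' : hom c e -> hom d f -> is_hdiv e D -> is_hdiv f D' ->
  is_hdiv (e * f) (D + D').
Proof.
move=> He Hf HD HD' Q; have [k Ek vk] := HD Q; have [l El vl] := HD' Q.
exists (k + l)%N; first by rewrite coeffD Ek El.
exact: hvalM (rep_prime Q) He Hf vk vl.
Qed.

Lemma is_hdiv_uniq e D D' : is_hdiv e D -> is_hdiv e D' -> D = D'.
Proof.
move=> H H'; apply/eqP/freeg_eqP => Q; have [k -> vk] := H Q; have [l -> vl] := H' Q.
by rewrite (hval_uniq vk vl).
Qed.

Lemma rep_eq Q Q' : dv (rep Q') (rep Q) -> Q = Q'.
Proof.
move=> d; suff E : sval Q = sval Q' by apply: val_inj.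
have sub : contr (rep Q) `<=` contr (rep Q') by move=> a /=; apply: dv_trans.
have [_ d'] := contr_sub (rep_prime Q) (rep_prime Q') sub.
by rewrite !repE; apply/seteqP; split=> // a /=; apply: dv_trans.
Qed.

Lemma is_hdiv_rep Q : is_hdiv (rep Q) << Q >>.
Proof.
move=> Q'; rewrite coeffU mul1r; have [<-|ne] := eqVneq Q Q'.
  by exists 1%N => //; exact: hval_self.
by exists 0%N => //; apply: hval0 => /rep_eq /eqP; apply/negP.
Qed.

Lemma is_hdiv_unit e : e \is a GRing.unit -> is_hdiv e 0.
Proof.
move=> ue Q; exists 0%N; first by rewrite coeff0.
by apply: hval0 => /(dv_unit ue); apply/negP; case: (rep_prime Q).
Qed.

Lemma hdiv_ex c e : hom c e -> e != 0 -> exists2 D, is_hdiv e D & divwt D = c.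
Proof.
move=> He e0; have [k nk] := fps_neq0_ford e0.
elim: k c e He e0 nk => [|k IH] c e He e0 nk; first by case: nk.
have [ue|ne] := boolP (e \is a GRing.unit).
  exists 0; first exact: is_hdiv_unit.
  by rewrite (hom_unit He ue) divwt0.
have [r pr re] := hprime_ex e0 He ne; pose Q := contr_divisor pr.
have [_ Qr] : dv r (rep Q) /\ dv (rep Q) r.
  by apply: contr_sub => //; rewrite -?repE.
have [q0 _ nq _] := rep_prime Q.
have [e' He' Ee] := dv_hom q0 (rep_hom Q) He (dv_trans Qr re).
have e'0 : e' != 0 by apply: contra_neq e0 => E; rewrite Ee E mulr0.
have [|D HD wD] := IH _ _ He' e'0.
  by apply: (not_fordM (f := rep Q)) => //; rewrite -Ee.
exists (<< Q >> + D); last by rewrite divwtD divwtU wD addrC subrK.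
by rewrite Ee; apply: is_hdivM (rep_hom Q) He' (is_hdiv_rep Q) HD.
Qed.

Lemma divisor_hdiv a D : a <> 0 ->
  is_divisor_of (ideal_span [set a]) D <-> is_hdiv (iota a) D.
Proof.
move=> a0.
have spanE Q k : ideal_span [set a] `<=` symbolic_pow (sval Q) k <->
    dv (rep Q ^+ k) (iota a).
  rewrite repE; split=> [H|H].
    by apply/symbolicE => //; apply: H; apply: sub_ideal_span.
  move=> x Hx; apply/symbolicE => //.
  have : contr (rep Q ^+ k) x by apply: Hx => [|_ ->] //; apply: contr_ideal.
  by [].
split=> H Q; have := H Q.
  by move=> [k [Ek /spanE H1 H2]]; exists k => //; split=> // /spanE.
by move=> [k Ek [/spanE H1 H2]]; exists k; split=> // /spanE.
Qed.

Local Notation principal := [set D : weil_divisor A |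
  exists2 f : A, f != 0 & is_divisor_of (ideal_span [set f]) D].

Lemma principal_wt D : subgroup_span principal D -> divwt D = 0.
Proof.
move=> /asboolP/(_ [set D | divwt D = 0]); apply=> /=.
- exact: divwt0.
- by move=> y z /= Hy Hz; rewrite divwtB Hy Hz subrr.
move=> D' [f /eqP f0 /(divisor_hdiv _ f0) HD] /=.
have [|D2 HD2 <-] := hdiv_ex (iota_hom f); first by apply/eqP => /iota0.
by rewrite (is_hdiv_uniq HD HD2).
Qed.

Lemma hdiv_diff (D : weil_divisor A) : exists c1 c2 e1 e2 D1 D2,
  [/\ hom c1 e1, hom c2 e2, e1 != 0 & e2 != 0] /\
  [/\ is_hdiv e1 D1, is_hdiv e2 D2 & D = D1 - D2].
Proof.
have pw Q j : is_hdiv (rep Q ^+ j) (<< Q >> *+ j).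
  elim: j => [|j IH]; first by rewrite expr0 mulr0n; apply: is_hdiv_unit; apply: unitr1.
  by rewrite exprS mulrS; apply: is_hdivM (rep_hom Q) (homX (k:=j) (rep_hom Q)) _ IH; apply: is_hdiv_rep.
elim/freeg_ind_dom0: D => [|k Q D _ _ [c1 [c2 [e1 [e2 [D1 [D2 [[h1 h2 z1 z2] [d1 d2 ->]]]]]]]]].
  exists 0, 0, 1, 1, 0, 0; split; split; rewrite ?subrr ?oner_neq0 //; try exact: hom1.
    by apply: is_hdiv_unit; apply: unitr1.
  by apply: is_hdiv_unit; apply: unitr1.
have zq j : rep Q ^+ j != 0 by apply: expf_neq0; case: (rep_prime Q).
have hq j := homX (k:=j) (rep_hom Q).
case: k => j.
  exists (rep_wt Q *+ j + c1), c2, (rep Q ^+ j * e1), e2, (<< Q >> *+ j + D1), D2.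
  split; split; rewrite ?mulf_neq0 //; first exact: homM.
    exact: is_hdivM (hq j) h1 (pw Q j) d1.
  by rewrite freegU_muln addrA natz.
exists c1, (rep_wt Q *+ j.+1 + c2), e1, (rep Q ^+ j.+1 * e2), D1, (<< Q >> *+ j.+1 + D2).
split; split; rewrite ?mulf_neq0 //; first exact: homM.
  exact: is_hdivM (hq j.+1) h2 (pw Q j.+1) d2.
by rewrite freegU_muln NegzE -freegUN natz opprD addrCA.
Qed.

Lemma wt_principal D : divwt D = 0 -> subgroup_span principal D.
Proof.
move=> wD; have [c1 [c2 [e1 [e2 [D1 [D2 [[h1 h2 z1 z2] [d1 d2 ED]]]]]]]] := hdiv_diff D.
have w1 : divwt D1 = c1.
  by have [D' HD' <-] := hdiv_ex h1 z1; rewrite (is_hdiv_uniq d1 HD').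
have w2 : divwt D2 = c2.
  by have [D' HD' <-] := hdiv_ex h2 z2; rewrite (is_hdiv_uniq d2 HD').
have E12 : c1 = c2.
  by apply/eqP; rewrite -subr_eq0 -w1 -w2 -divwtB -ED wD.
have [j tw] := s_twist c1; have [a1 Ea1] := tw _ h1.
have [a2 Ea2] : exists a, iota a = e2 * s ^+ j by apply: tw; rewrite E12.
have hs := homX (k:=j) (hom_s gam (K := K)).
have sj0 : s ^+ j != 0 by apply: expf_neq0; apply: var_neq0.
have [Ds HDs _] := hdiv_ex hs sj0.
have -> : D = (D1 + Ds) - (D2 + Ds) by rewrite ED opprD addrACA subrr addr0.
have nz a e : e != 0 -> iota a = e * s ^+ j -> a != 0.
  move=> e0 E; apply/eqP => a0; move: E; rewrite a0 rmorph0 => /esym/eqP.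
  by rewrite mulf_eq0 (negPf e0) (negPf sj0).
apply/asboolP => H H0 HB Hp; apply: HB; apply: Hp.
  exists a1; first exact: nz z1 Ea1.
  apply/divisor_hdiv; first by apply/eqP; exact: nz z1 Ea1.
    by rewrite Ea1; exact: is_hdivM h1 hs d1 HDs.
exists a2; first exact: nz z2 Ea2.
apply/divisor_hdiv; first by apply/eqP; exact: nz z2 Ea2.
  by rewrite Ea2; exact: is_hdivM h2 hs d2 HDs.
Qed.

Definition class_wt (x : class_group A) : G := divwt (repr x).

Lemma class_wtE D : class_wt (divisor_class D) = divwt D.
Proof.
apply/eqP; rewrite -subr_eq0 -divwtB; apply/eqP/principal_wt.
by apply/zprojP; rewrite zproj_repr.
Qed.

Lemma class_wt_is_zmod : zmod_morphism class_wt.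
Proof.
move=> x y; rewrite -[x]zproj_repr -[y]zproj_repr -(zproj_is_zmod principal).
by rewrite !class_wtE divwtB.
Qed.

Lemma class_wt_bij : bijective class_wt.
Proof.
have /choice[inv Hinv] : forall c, exists x, class_wt x = c.
  move=> c; have [j Ej] := gen c.
  have [|D _ wD] := hdiv_ex (homX (k:=j) (hom_t gam (K := K))).
    by apply: expf_neq0; apply: var_neq0.
  by exists (divisor_class D); rewrite class_wtE wD Ej.
exists inv => // x; rewrite -[LHS]zproj_repr -[RHS]zproj_repr.
apply/zprojP; apply: wt_principal; rewrite divwtB -!/(class_wt _) Hinv subrr //.
Qed.

(** A valuation that is positive on [I] is positive at [x ^+ n], hence is that of
    [x], and its value at [x * x'] is one. *)
Lemma ideal_class (I : set A) (x x' : B) c n y z : hom c x -> x != 0 ->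
  (forall f g, dv x (f * g) -> dv x f \/ dv x g) -> ~ dv x x' ->
  (forall a, I a -> dv x (iota a)) ->
  I y -> iota y = x ^+ n -> I z -> iota z = x * x' ->
  exists2 D, is_divisor_of I D & divwt D = c.
Proof.
move=> Hx x0 xP nxx Isub Iy Ey Iz Ez.
have [D HD wD] := hdiv_ex Hx x0; exists D => // Q.
have [k Ek vk] := HD Q; exists k.
rewrite repE; have pQ := rep_prime Q; have [q0 [d Hd] nq P] := pQ.
have [qx|nqx] := pselect (dv (rep Q) x); last first.
  have k0 : k = 0%N by apply: hval_uniq vk _; apply: hval0.
  rewrite k0 in Ek *; split=> //.
    by move=> a _; apply/symbolicE => //; rewrite expr0; apply: unit_dv; apply: unitr1.
  move=> /(_ _ Iy) /symbolicE -/(_ pQ); rewrite expr1 Ey.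
  by move/(hprimeX pQ Hx).
have xq : dv x (rep Q).
  have [w Ew] := qx; have : dv x (rep Q * w) by rewrite -Ew; apply: dv_refl.
  case/xP => // -[v Ev]; case/negP: nq; apply: (dv_unit (unitr1 _)).
  by exists v; apply: (mulfI x0); rewrite {1}Ew Ev; ring.
have k1 : k = 1%N.
  apply: hval_uniq vk _; split; first by rewrite expr1.
  move=> qq; have [_ ] := hval_self pQ; apply.
  by apply: dv_trans qq _.
rewrite k1 in Ek *; split=> //.
  move=> a /Isub xa; apply/symbolicE => //; rewrite expr1; exact: dv_trans qx xa.
move=> /(_ _ Iz) /symbolicE -/(_ pQ); rewrite Ez => H; apply: nxx.
apply: (dv_mul2l x0); apply: dv_trans H; rewrite expr2; exact: dvM.
Qed.

End GradedClassGroup.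

(** * The hypersurface xy = z^n as the degree zero part of K[[s,t]] *)

Local Notation j0 := (ord0 : 'I_3).
Local Notation j1 := (inord 1 : 'I_3).
Local Notation j2 := (inord 2 : 'I_3).

Lemma I3_case (P : 'I_3 -> Prop) : P j0 -> P j1 -> P j2 -> forall j, P j.
Proof.
move=> P0 P1 P2 [[|[|[|//]]] hj].
- by rewrite (_ : Ordinal hj = j0) //; apply: val_inj.
- by rewrite (_ : Ordinal hj = j1) //; apply: val_inj; rewrite /= inordK.
- by rewrite (_ : Ordinal hj = j2) //; apply: val_inj; rewrite /= inordK.
Qed.

Lemma j01 : (j0 == j1) = false. Proof. by rewrite -val_eqE /= inordK. Qed.
Lemma j02 : (j0 == j2) = false. Proof. by rewrite -val_eqE /= inordK. Qed.
Lemma j12 : (j1 == j2) = false. Proof. by rewrite -val_eqE /= !inordK. Qed.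
Definition jE := (j01, j02, j12, eq_sym j1 j0, eq_sym j2 j0, eq_sym j2 j1, eqxx).

Lemma big_I3 (R : Type) (idx : R) (op : Monoid.com_law idx) (F : 'I_3 -> R) :
  \big[op/idx]_(j < 3) F j = op (F j0) (op (F j1) (F j2)).
Proof.
rewrite !big_ord_recl big_ord0 Monoid.mulm1; congr (op _ (op (F _) (F _))).
  by apply: val_inj; rewrite /= inordK.
by apply: val_inj; rewrite /= inordK.
Qed.

Lemma mnm3P (a b : 'X_{1..3}) : a j0 = b j0 -> a j1 = b j1 -> a j2 = b j2 -> a = b.
Proof. by move=> H0 H1 H2; apply/mnmP; apply: I3_case. Qed.

Section Invariants.
Variables (K : fieldType) (n : nat).
Hypothesis n_gt0 : (0 < n)%N.
Local Notation i0 := (ord0 : 'I_2).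
Local Notation i1 := (ord_max : 'I_2).
Local Notation s := (fps_var K i0).
Local Notation t := (fps_var K i1).
Local Notation x := (fps_var K j0).
Local Notation y := (fps_var K j1).
Local Notation z := (fps_var K j2).
Implicit Types (f q : fps K 3) (mu nu : 'X_{1..3}) (m : 'X_{1..2}).

(** The exponent of the monomial in [s], [t] to which a monomial in
    [x = s ^+ n], [y = t ^+ n] and [z = s * t] is sent. *)
Definition rho mu : 'X_{1..2} :=
  (U_(i0) *+ (n * mu j0 + mu j2) + U_(i1) *+ (n * mu j1 + mu j2))%MM.

Lemma rho0 mu : rho mu i0 = (n * mu j0 + mu j2)%N.
Proof. by rewrite /rho mnmDE !mulmnE !mnm1E /= mul1n mul0n addn0. Qed.
Lemma rho1 mu : rho mu i1 = (n * mu j1 + mu j2)%N.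
Proof. by rewrite /rho mnmDE !mulmnE !mnm1E /= mul1n mul0n add0n. Qed.

Lemma mnm2P (a b : 'X_{1..2}) : a i0 = b i0 -> a i1 = b i1 -> a = b.
Proof.
move=> H0 H1; apply/mnmP; case=> -[|[|//]] hj.
  by rewrite (_ : Ordinal hj = i0) //; apply: val_inj.
by rewrite (_ : Ordinal hj = i1) //; apply: val_inj.
Qed.

Lemma rhoD mu nu : rho (mu + nu)%MM = (rho mu + rho nu)%MM.
Proof. by apply: mnm2P; rewrite mnmDE !(rho0, rho1) !mnmDE; ring. Qed.

Lemma mdeg_rho mu : (mdeg mu <= mdeg (rho mu))%N.
Proof.
rewrite !mdegE big_I3 !big_ord_recl big_ord0 /=.
rewrite (_ : fintype.lift ord0 ord0 = i1); last exact: val_inj.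
by rewrite rho0 rho1 addn0; have := leq_pmull (mu j0) n_gt0; have := leq_pmull (mu j1) n_gt0; lia.
Qed.

Definition phi_var (j : 'I_3) : fps K 2 := mono (rho U_(j)).
Definition Phi : fps K 3 -> fps K 2 := ev phi_var.
HB.instance Definition _ := GRing.RMorphism.on Phi.

Lemma phi_var_ford j : ford 1 (phi_var j).
Proof.
apply: fordW (@ford_mono K 2 (rho U_(j))).
by apply: leq_trans (mdeg_rho _); rewrite mdeg1.
Qed.

Lemma Phi_mono mu : Phi (mono mu) = mono (rho mu).
Proof.
rewrite /Phi ev_mono; last exact: phi_var_ford.
rewrite /mmap1 /phi_var.
rewrite [in RHS](multinomUE_id mu).
have rho_0 : rho 0%MM = 0%MM by apply: mnm2P; rewrite ?rho0 ?rho1 !mnm0E muln0.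
rewrite (big_morph rho rhoD rho_0) -mprodXE rmorph_prod /=.
apply: eq_bigr => j _; rewrite -rmorphXn /= mpolyXn; congr (fps_of (mpolyX _ _)).
by elim: (mu j) => [|i IH]; rewrite ?mulm0n ?mulmS ?rhoD ?rho_0 // IH.
Qed.

Lemma Phi_x : Phi x = s ^+ n.
Proof.
rewrite fps_varE Phi_mono fps_varE -rmorphXn /= mpolyXn; congr (fps_of (mpolyX _ _)).
by apply: mnm2P; rewrite ?rho0 ?rho1 mulmnE !mnm1E !jE /=; lia.
Qed.
Lemma Phi_y : Phi y = t ^+ n.
Proof.
rewrite fps_varE Phi_mono fps_varE -rmorphXn /= mpolyXn; congr (fps_of (mpolyX _ _)).
by apply: mnm2P; rewrite ?rho0 ?rho1 mulmnE !mnm1E !jE /=; lia.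
Qed.
Lemma Phi_z : Phi z = s * t.
Proof.
rewrite fps_varE Phi_mono !fps_varE -fps_monoD; congr (fps_of (mpolyX _ _)).
by apply: mnm2P; rewrite ?rho0 ?rho1 mnmDE !mnm1E !jE /=; lia.
Qed.

Definition Ak_eqn : fps K 3 := x * y - z ^+ n.

Lemma Phi_eqn : Phi Ak_eqn = 0.
Proof. by rewrite /Ak_eqn rmorphB rmorphM rmorphXn /= Phi_x Phi_y Phi_z exprMn subrr. Qed.

Definition normal mu := (mu j0 == 0%N) || (mu j1 == 0%N).

Lemma rho_inj mu nu : normal mu -> normal nu -> rho mu = rho nu -> mu = nu.
Proof.
rewrite /normal => /orP Hm /orP Hn E.
have := congr1 (fun m : 'X_{1..2} => m i0) E; have := congr1 (fun m : 'X_{1..2} => m i1) E.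
rewrite !rho0 !rho1 => E1 E0.
by apply: mnm3P; case: Hm => /eqP Hm; case: Hn => /eqP Hn; rewrite Hm Hn in E0 E1 *; nia.
Qed.

Lemma Phi_coef f m : Phi f m =
  \sum_(mu : 'X_{1..3 < (mdeg m).+1}) f mu * (rho mu == m)%:R.
Proof.
rewrite /Phi /ev -ev_of -/Phi [fps_of _](_ : _ =
  \sum_(mu : 'X_{1..3 < (mdeg m).+1}) fps_const (f mu) * mono mu).
  rewrite rmorph_sum fps_sum; apply: eq_bigr => mu _.
  by rewrite rmorphM /= [Phi (fps_const _)]ev_const Phi_mono fps_constM fps_mono.
rewrite /fps_trunc rmorph_sum; apply: eq_bigr => mu _.
by rewrite -mul_mpolyC rmorphM /= fps_ofC.
Qed.

Lemma Phi_normal f mu : (forall nu, ~~ normal nu -> f nu = 0) -> normal mu ->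
  Phi f (rho mu) = f mu.
Proof.
move=> nf Hmu; rewrite Phi_coef.
have hmu : (mdeg mu < (mdeg (rho mu)).+1)%N by rewrite ltnS mdeg_rho.
rewrite (bigD1 (BMultinom hmu)) //= eqxx mulr1 big1 ?addr0 // => nu ne.
have [Hn|/nf ->] := boolP (normal nu); last by rewrite mul0r.
case: eqP => [/(rho_inj Hn Hmu) E|_]; last by rewrite mulr0.
by case/negP: ne; rewrite bmeqP /= E.
Qed.

(** The quotient is explicit: its coefficients are finite sums, because each
    exchange of [x * y] against [z ^+ n] raises the exponent of [z]. *)
Lemma division_by_Ak f : exists q f', f = Ak_eqn * q + f' /\
  forall mu, ~~ normal mu -> f' mu = 0.
Proof.
pose e := (U_(j0) + U_(j1))%MM.
pose F nu i := f (nu + e *+ i.+1 - U_(j2) *+ (n * i))%MM.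
pose q : fps K 3 := fun nu => \sum_(0 <= i < (nu j2).+1 | (n * i <= nu j2)%N) F nu i.
have qE nu N : (nu j2 < N)%N -> q nu = \sum_(0 <= i < N | (n * i <= nu j2)%N) F nu i.
  move=> hN; rewrite /q (big_nat_widen _ _ _ _ _ hN); apply: eq_bigl => i.
  by have H := leq_pmull i n_gt0; lia.
exists q, (f - Ak_eqn * q); split; first by rewrite addrC subrK.
move=> mu; rewrite /normal negb_or -!lt0n => /andP[m0 m1].
have e0 : e j0 = 1%N by rewrite /e mnmDE !mnm1E !jE.
have e1 : e j1 = 1%N by rewrite /e mnmDE !mnm1E !jE.
have e2 : e j2 = 0%N by rewrite /e mnmDE !mnm1E !jE.
have le : (e <= mu)%MM.
  by apply/mnm_lepP; apply: I3_case; rewrite ?e0 ?e1 ?e2.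
rewrite /Ak_eqn !fps_varE -rmorphXn mpolyXn -fps_monoD -/e mulrBl !fpsB !fps_monoM le.
have -> : q (mu - e)%MM = f mu + \sum_(0 <= i < mu j2 | (n * i.+1 <= mu j2)%N)
    f (mu + e *+ i.+1 - U_(j2) *+ (n * i.+1))%MM.
  rewrite (qE _ (mu j2).+1) mnmBE e2 subn0 // big_mkcond big_nat_recl //.
  rewrite muln0 leq0n /F muln0 mulm0n subm0 mulm1n submK //; congr (_ + _).
  rewrite -big_mkcond; apply: eq_bigr => i _; congr (f _).
  by rewrite (mulmS e i.+1) addmA submK.
have -> : (if (U_(j2) *+ n <= mu)%MM then q (mu - U_(j2) *+ n)%MM else 0) =
   \sum_(0 <= i < mu j2 | (n * i.+1 <= mu j2)%N)
    f (mu + e *+ i.+1 - U_(j2) *+ (n * i.+1))%MM.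
  case: ifPn => [le2|nle2].
    have nm : (n <= mu j2)%N.
      by move/mnm_lepP/(_ j2): le2; rewrite mulmnE mnm1E eqxx mul1n.
    rewrite (qE _ (mu j2)); last by rewrite mnmBE mulmnE mnm1E eqxx mul1n; lia.
    apply: eq_big => [i|i _].
      by rewrite mnmBE mulmnE mnm1E eqxx mul1n mulnS; lia.
    rewrite /F; congr (f _); apply: mnm3P;
      rewrite !(mnmBE, mnmDE, mulmnE, mnm1E, e0, e1, e2) !jE /=; lia.
  rewrite big1 // => i H; case/negP: nle2; apply/mnm_lepP.
  apply: I3_case; rewrite mulmnE mnm1E !jE ?mul0n // mul1n.
  by apply: leq_trans H; rewrite leq_pmulr.
ring.
Qed.

Lemma Phi_ker f : Phi f = 0 <-> exists q, f = Ak_eqn * q.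
Proof.
split=> [|[q ->]]; last by rewrite rmorphM /= Phi_eqn mul0r.
have [q [f' [-> nf]]] := division_by_Ak f.
rewrite rmorphD rmorphM /= Phi_eqn mul0r add0r => Pf'; exists q.
rewrite (_ : f' = 0) ?addr0 //; apply: fps_eq => mu; rewrite fps0.
have [Hm|/nf //] := boolP (normal mu).
by rewrite -(Phi_normal nf Hm) Pf' fps0.
Qed.

Lemma Phi_ford d f : ford d f -> ford d (Phi f).
Proof. exact: ev_ford. Qed.

Section Image.
Variables (G : zmodType) (gam : G).
Hypothesis gamP : forall i j : nat, gam *+ i = gam *+ j <-> i = j %[mod n].

Lemma rho_ex m : wt gam m = 0 -> exists2 mu, normal mu & rho mu = m.
Proof.
move=> /eqP; rewrite /wt subr_eq0 => /eqP /gamP E.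
have [le|/ltnW le] := leqP (m i0) (m i1).
  have /dvdnP[k Ek] : (n %| m i1 - m i0)%N by rewrite -eqn_mod_dvd // E.
  exists (U_(j1) *+ k + U_(j2) *+ m i0)%MM.
    by rewrite /normal !mnmDE !mulmnE !mnm1E !jE /= ?mul0n ?addn0 ?eqxx.
  by apply: mnm2P; rewrite ?rho0 ?rho1 !mnmDE !mulmnE !mnm1E !jE /=; lia.
have /dvdnP[k Ek] : (n %| m i0 - m i1)%N by rewrite -eqn_mod_dvd // E.
exists (U_(j0) *+ k + U_(j2) *+ m i1)%MM.
  by rewrite /normal !mnmDE !mulmnE !mnm1E !jE /= ?mul0n ?addn0 ?eqxx ?orbT.
by apply: mnm2P; rewrite ?rho0 ?rho1 !mnmDE !mulmnE !mnm1E !jE /=; lia.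
Qed.

Lemma wt_rho mu : wt gam (rho mu) = 0.
Proof.
apply/eqP; rewrite /wt subr_eq0; apply/eqP/gamP; rewrite rho0 rho1.
by rewrite !(mulnC n) !modnMDl.
Qed.

Lemma Phi_hom f : hom gam 0 (Phi f).
Proof.
move=> m; rewrite Phi_coef => H; apply: contrapT => Hm; case/eqP: H.
rewrite big1 // => mu _; case: eqP => [E|]; last by rewrite mulr0.
by case: Hm; rewrite -E wt_rho.
Qed.

Lemma Phi_image b : hom gam 0 b <-> exists f, Phi f = b.
Proof.
split=> [Hb|[f <-]]; last exact: (@Phi_hom f).
pose f : fps K 3 := fun mu => if normal mu then b (rho mu) else 0.
exists f; apply: fps_eq => m; have [/rho_ex[mu nmu <-]|nm] := eqVneq (wt gam m) 0.
  rewrite Phi_normal // /f ?nmu // => nu; by case: ifP.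
have z (h : fps K 2) : hom gam 0 h -> h m = 0.
  by move=> Hh; apply/eqP/negPn/negP => /Hh E; move: nm; rewrite E eqxx.
by rewrite (z _ Hb) (z _ (@Phi_hom f)).
Qed.
End Image.
End Invariants.

(** * Completion of a surface with a coordinate system of type A_k *)

Section Zmodn.
Variable n : nat.
Hypothesis n_gt0 : (0 < n)%N.

Lemma Zmod_proj_is_zmod : zmod_morphism (Zmod_proj n).
Proof. exact: zproj_is_zmod. Qed.

HB.instance Definition _ :=
  GRing.isZmodMorphism.Build int (Zmod n) (Zmod_proj n) Zmod_proj_is_zmod.

Lemma Zmod_proj_eq (i j : int) : Zmod_proj n i = Zmod_proj n j <-> (n %| i - j)%Z.
Proof.
rewrite /Zmod_proj zprojP; split.
  move=> /asboolP/(_ [set k | (n %| k)%Z]); apply=> /=.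
  - exact: dvdz0.
  - by move=> y z; apply: rpredB.
  - by move=> _ ->; apply: dvdzz.
move=> /dvdzP[k ->]; apply/asboolP => H H0 HB Hn.
have HN y : H y -> H (- y) by move=> Hy; rewrite -sub0r; apply: HB.
have HD y z : H y -> H z -> H (y + z).
  by move=> Hy Hz; rewrite -[z]opprK; apply: HB => //; apply: HN.
have Hnat (l : nat) : H (l%:Z * n).
  elim: l => [|l IH]; first by rewrite mul0r.
  by rewrite intS mulrDl mul1r; apply: HD => //; apply: Hn.
by case: k => l; [apply: Hnat | rewrite NegzE mulNr; apply: HN].
Qed.

Local Notation gam := (Zmod_proj n 1).

Lemma Zmod_nat (j : nat) : gam *+ j = Zmod_proj n j%:Z.
Proof. by rewrite -(raddfMn (Zmod_proj n)); congr (Zmod_proj n _); exact: natz. Qed.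

Lemma Zmod_gen (c : Zmod n) : exists j : nat, c = gam *+ j.
Proof.
rewrite -[c]zproj_repr -/(Zmod_proj n _); set k := repr c.
exists `|(k %% n)%Z|%N; rewrite Zmod_nat; apply/Zmod_proj_eq.
rewrite gez0_abs ?modz_ge0 //; last by lia.
by rewrite {1}(divz_eq k n) addrK dvdz_mull.
Qed.

Lemma Zmod_natP (i j : nat) : gam *+ i = gam *+ j <-> i = j %[mod n].
Proof.
rewrite !Zmod_nat Zmod_proj_eq -eqz_mod_dvd !modz_nat eqz_nat.
by split=> [/eqP|->].
Qed.
End Zmodn.

Section CoordinateSystem.
Variables (K : fieldType) (O : comPzRingType) (cst : K -> O).

(** [tau] identifies the completion of the local [K]-algebra [O] with the algebra
    of power series, without mentioning the completion: it is compatible with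
    the filtrations by powers of the maximal ideals, and has dense image. *)
Definition coords (tau : O -> fps K 3) : Prop :=
  [/\ forall c, tau (cst c) = fps_const c,
      forall k f, ideal_pow (@nonunits O) k f <-> ford k (tau f)
    & forall (g : fps K 3) k, exists f, ford k (tau f - g)].

Lemma coords_auto (tau : O -> fps K 3) (kappa : {rmorphism fps K 3 -> fps K 3}) :
  coords tau -> fps_auto kappa -> coords (kappa \o tau).
Proof.
move=> [tc tf td] [kc kf ks]; split=> /= [c|k f|g k].
- by rewrite tc kc.
- by rewrite tf; split=> /kf.
have [g' <-] := ks g; have [f Hf] := td g' k.
by exists f; rewrite -rmorphB; apply/kf.
Qed.
End CoordinateSystem.

Lemma is_ideal_pow (A : comPzRingType) (J : set A) k : is_ideal (ideal_pow J k).
Proof. by case: k => [|k]; [split | exact: is_ideal_span]. Qed.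

Lemma ideal_span_id (A : comPzRingType) (J : set A) : is_ideal J -> ideal_span J = J.
Proof.
move=> JI; apply/seteqP; split; last exact: sub_ideal_span.
by apply: ideal_span_sub.
Qed.

Lemma ideal_span1 (A : comPzRingType) (a x : A) :
  ideal_span [set a] x <-> exists y, x = a * y.
Proof.
split=> [H|[y ->] I [_ _ M] sub]; last by rewrite mulrC; apply: M; apply: sub.
apply: (H [set x | exists y, x = a * y]) => [|_ ->]; last by exists 1; rewrite mulr1.
split=> /= [|_ _ [u ->] [v ->]|b _ [u ->]]; first by exists 0; rewrite mulr0.
  by exists (u + v); rewrite mulrDr.
by exists (b * u); rewrite mulrCA.
Qed.

Section Completed.
Variables (K : fieldType) (O : comPzRingType) (cst : K -> O).
Variables (tau : {rmorphism O -> fps K 3}) (k : nat).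
Hypothesis tauP : coords cst tau.
Local Notation n := k.+1.
Variables (phi : O) (u : fps K 3) (I : set O).
Hypothesis u_unit : u \is a GRing.unit.
Hypothesis tau_phi : tau phi = u * Ak_eqn K n.
Hypothesis IE : forall g, I g <-> exists h, g = phi * h.

Local Notation L := (rquot I : comPzRingType).
Local Notation Ahat := (completion (@nonunits L)).
Local Notation pim i g := (rproj (ideal_pow (@nonunits L) i) (rproj I g)).
Implicit Types (f g h : O) (F : fps K 3).

Let tauF i f : ideal_pow (@nonunits O) i f <-> ford i (tau f).
Proof. by case: tauP. Qed.
Let tauD F i : exists f, ford i (tau f - F).
Proof. by case: tauP. Qed.

Lemma I_ideal : is_ideal I.
Proof.
split=> [|x y /IE[a ->] /IE[b ->]|a x /IE[b ->]]; apply/IE.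
- by exists 0; rewrite mulr0.
- by exists (a + b); rewrite mulrDr.
- by exists (a * b); rewrite mulrCA.
Qed.

Lemma nonunits_ford f : nonunits f <-> ford 1 (tau f).
Proof.
split=> [nf|H [y fy]].
  apply/tauF => /=; apply: sub_ideal_span; exists f, 1; rewrite mulr1; split=> //.
have := fordMr (tau y) H; rewrite -rmorphM fy rmorph1 => /ford1E/eqP.
by rewrite fps1 eqxx oner_eq0.
Qed.

Lemma phi_ford1 : ford 1 (tau phi).
Proof.
rewrite tau_phi; apply: fordMl; apply: fordB.
  by apply: fordMr; apply: ford_var.
by rewrite exprS; apply: fordMr; apply: ford_var.
Qed.

Lemma rproj_eq g h : rproj I g = rproj I h <-> exists w, g - h = phi * w.
Proof. by rewrite rprojP (ideal_span_id I_ideal) IE. Qed.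

Lemma nonunits_L g : nonunits (rproj I g : L) <-> ford 1 (tau g).
Proof.
rewrite -nonunits_ford; split=> [H [y gy]|H [v gv]].
  by apply: H; exists (rproj I y); rewrite -rmorphM gy rmorph1.
move: gv; rewrite -[v]rproj_surj -rmorphM -(rmorph1 (@rproj _ I)).
move=> /rproj_eq[w Ew]; have /ford1E/eqP : ford 1 (tau (g * repr v - 1)).
  by rewrite Ew rmorphM; apply: fordMr; exact: phi_ford1.
have : ford 1 (tau (g * repr v)).
  by rewrite rmorphM; apply: fordMr; apply/nonunits_ford.
move=> /ford1E E; rewrite rmorphB rmorph1 fpsB E fps1 eqxx sub0r oppr_eq0.
by rewrite oner_eq0.
Qed.

Lemma pow_L i (l : L) : ideal_pow (@nonunits L) i l <->
  exists2 g, rproj I g = l & ford i (tau g).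
Proof.
split.
  elim: i l => [|i IH] l; first by exists (repr l); [exact: rproj_surj | exact: ford0n].
  move=> /= /(_ [set l | exists2 g, rproj I g = l & ford i.+1 (tau g)]); apply.
    split=> /= [|_ _ [g <- Hg] [h <- Hh]|a _ [g <- Hg]].
    - by exists 0; rewrite ?rmorph0 //; apply: ford_zero.
    - by exists (g + h); rewrite ?rmorphD //; apply: fordD.
    - exists (repr a * g); first by rewrite rmorphM /= rproj_surj.
      by rewrite rmorphM; apply: fordMl.
  move=> _ [a [b [Ha /IH[h <- Hh] ->]]]; exists (repr a * h).
    by rewrite rmorphM /= rproj_surj.
  rewrite rmorphM /=; apply: (@fordM _ _ 1 i) => //; apply/nonunits_L.
  by rewrite rproj_surj.
move=> [g <- /tauF]; elim: i g => [//|i IH] g.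
have [P0 PD PM] := is_ideal_pow (@nonunits L) i.+1.
move=> /(_ [set g | ideal_pow (@nonunits L) i.+1 (rproj I g)]); apply.
  split=> [|x y Hx Hy|a x Hx]; rewrite /= ?rmorph0 ?rmorphD ?rmorphM //.
    exact: PD.
  exact: PM.
move=> _ [a [b [Ha Hb ->]]]; rewrite [X in X _]/=; apply: sub_ideal_span.
exists (rproj I a), (rproj I b); split; last exact: rmorphM.
  by apply/nonunits_L/nonunits_ford.
exact: IH.
Qed.

Lemma pi_eq i g h : (pim i g) = (pim i h) <-> exists w, ford i (tau (g - h - phi * w)).
Proof.
rewrite rprojP (ideal_span_id (is_ideal_pow _ _)) -rmorphB pow_L; split.
  move=> [v /esym/rproj_eq[w Ew] Hv]; exists w; rewrite -Ew.
  by rewrite (_ : _ - _ = v); last ring.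
move=> [w Hw]; exists (g - h - phi * w) => //; apply/rproj_eq.
by exists (- w); ring.
Qed.

Lemma pi_ford i g h : ford i (tau g - tau h) -> (pim i g) = (pim i h).
Proof. by move=> H; apply/pi_eq; exists 0; rewrite mulr0 subr0 rmorphB. Qed.

Let approx F i := projT1 (cid (tauD F i)).
Let approxP F i : ford i (tau (approx F i) - F).
Proof. exact: (projT2 (cid (tauD F i))). Qed.

Lemma Psi_coherent F : coherent (fun i => (pim i (approx F i))).
Proof.
move=> i; exists (rproj I (approx F i.+1)); split=> //; apply: pi_ford.
apply: ford_trans (@approxP F i) _; apply: fordBC.
exact: fordW (@approxP F i.+1).
Qed.

(** The quotient map of the algebra of power series onto the completion, which
    sends a series to the coherent sequence of its approximations in [O]. *)
Definition Psi F : Ahat := exist _ _ (Psi_coherent F).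

Lemma PsiE F i g : ford i (tau g - F) -> projT1 (Psi F) i = (pim i g).
Proof. by move=> H; apply: pi_ford; apply: ford_trans (@approxP F i) _; apply: fordBC. Qed.

Lemma Psi_is_zmod : zmod_morphism Psi.
Proof.
move=> F F'; apply: completion_eq => i.
have H : ford i (tau (approx F i - approx F' i) - (F - F')).
  rewrite rmorphB /= (_ : _ - _ = (tau (approx F i) - F) - (tau (approx F' i) - F')).
    by apply: fordB; apply: approxP.
  by ring.
by rewrite (PsiE H) !rmorphB.
Qed.

Lemma Psi_tau g : Psi (tau g) = to_completion _ (rproj I g).
Proof. by apply: completion_eq => i; rewrite (@PsiE _ i g) // subrr; apply: ford_zero. Qed.

Lemma Psi_is_monoid : monoid_morphism Psi.
Proof.
split; first by rewrite -(rmorph1 tau) Psi_tau !rmorph1.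
move=> F F'; apply: completion_eq => i.
have H : ford i (tau (approx F i * approx F' i) - F * F').
  rewrite rmorphM /= (_ : _ - _ = (tau (approx F i) - F) * tau (approx F' i) +
    F * (tau (approx F' i) - F')); last by ring.
  by apply: fordD; [apply: fordMr | apply: fordMl]; apply: approxP.
by rewrite (PsiE H) !rmorphM.
Qed.

HB.instance Definition _ := GRing.isZmodMorphism.Build _ _ Psi Psi_is_zmod.
HB.instance Definition _ := GRing.isMonoidMorphism.Build _ _ Psi Psi_is_monoid.

Lemma zero_comp i : projT1 (0 : Ahat) i = pim i 0.
Proof. by rewrite rmorph0. Qed.

(** The ideal of the surface is closed in the algebra of power series, because it
    is the kernel of the continuous morphism [Phi]. *)
Lemma Psi_ker F : Psi F = 0 <-> Phi n F = 0.
Proof.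
have e0 : Phi n (tau phi) = 0 by rewrite tau_phi rmorphM /= Phi_eqn ?mulr0.
split=> [H|/Phi_ker[//|q ->]].
  apply: ford_eq0 => i.
  have : (pim i (approx F i)) = (pim i 0).
    by rewrite -zero_comp -H.
  move=> /pi_eq[w]; rewrite subr0 rmorphB rmorphM /= => Hw.
  have -> : Phi n F = Phi n (tau (approx F i) - tau phi * tau w -
      (tau (approx F i) - F)).
    by rewrite !rmorphB rmorphM /= e0; ring.
  by apply: Phi_ford => //; apply: fordB => //; apply: approxP.
apply: completion_eq => i.
have [w Hw] := tauD (u^-1 * q) i.
have H : ford i (tau (phi * w) - Ak_eqn K n * q).
  rewrite rmorphM /= tau_phi.
  rewrite [X in _ - X](_ : _ = u * Ak_eqn K n * (u^-1 * q)).
    by rewrite -mulrBr; apply: fordMl.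
  by rewrite mulrACA divrr // mul1r.
rewrite (PsiE H); rewrite zero_comp.
apply/pi_eq; exists w; rewrite subr0 subrr rmorph0; exact: ford_zero.
Qed.

Lemma Psi_eq F F' : Psi F = Psi F' <-> Phi n F = Phi n F'.
Proof.
split=> /eqP; rewrite -subr_eq0 -rmorphB => /eqP/Psi_ker/eqP; rewrite rmorphB subr_eq0.
  by move/eqP.
by move/eqP.
Qed.

Lemma Psi_surj (a : Ahat) : exists F, Psi F = a.
Proof.
case: a => s Hs.
have lift i (l : rquot (ideal_pow (@nonunits L) i)) : exists g, l = (pim i g).
  by exists (repr (repr l)); rewrite !rproj_surj.
have step (p : nat * O) : exists g', s p.1 = (pim (p.1) p.2) ->
    s p.1.+1 = (pim (p.1.+1) g') /\ ford p.1 (tau g' - tau p.2).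
  case: p => i g /=; have [Eg|ne] := pselect (s i = (pim i g)); last by exists 0.
  have [a [E1 E2]] := Hs i; pose b := repr a.
  have /pi_eq[w Hw] : (pim i b) = (pim i g) by rewrite -Eg E1 rproj_surj.
  exists (b - phi * w) => _; split; last by rewrite -rmorphB addrAC.
  have E : pim i.+1 b = pim i.+1 (b - phi * w).
    apply/pi_eq; exists w.
    by rewrite opprB addrCA subrr addr0 subrr rmorph0; apply: ford_zero.
  by apply: etrans E2 (etrans _ E); rewrite rproj_surj.
have [st Hst] := choice step; have [g0 Eg0] := lift _ (s 0%N).
pose G := fix G i := if i is i'.+1 then st (i', G i') else g0.
have GE i : s i = (pim i (G i)).
  by elim: i => [|i IH]; [exact: Eg0 | have [] := Hst (i, G i) IH].
have [i|F HF] := @fps_limit _ _ (fun i => tau (G i)).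
  by have [] := Hst (i, G i) (GE i).
exists F; apply: completion_eq => i; rewrite (@PsiE _ i (G i)) ?GE //.
exact: fordBC.
Qed.

Let lft (a : Ahat) := projT1 (cid (Psi_surj a)).
Let lftP a : Psi (lft a) = a. Proof. exact: (projT2 (cid (Psi_surj a))). Qed.

(** ** The two models of the completed local ring *)

Definition to_graded (a : Ahat) : fps K 2 := Phi n (lft a).

Lemma to_gradedE F : to_graded (Psi F) = Phi n F.
Proof. by apply/Psi_eq; rewrite lftP. Qed.

Lemma to_graded_is_zmod : zmod_morphism to_graded.
Proof. by move=> a b; rewrite -[a]lftP -[b]lftP -rmorphB !to_gradedE rmorphB. Qed.
Lemma to_graded_is_monoid : monoid_morphism to_graded.
Proof.
split; first by rewrite -(rmorph1 Psi) to_gradedE rmorph1.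
by move=> a b; rewrite -[a]lftP -[b]lftP -rmorphM !to_gradedE rmorphM.
Qed.
HB.instance Definition _ := GRing.isZmodMorphism.Build _ _ to_graded to_graded_is_zmod.
HB.instance Definition _ :=
  GRing.isMonoidMorphism.Build _ _ to_graded to_graded_is_monoid.

Lemma to_graded_inj : injective to_graded.
Proof. by move=> a b; rewrite -[a]lftP -[b]lftP !to_gradedE => /Psi_eq. Qed.

Local Notation gam := (Zmod_proj n 1).

Lemma to_gradedP b : hom gam 0 b <-> exists a, to_graded a = b.
Proof.
rewrite (Phi_image _ (@Zmod_natP n)) //; split=> [[F <-]|[a <-]]; last by exists (lft a).
by exists (Psi F); apply: to_gradedE.
Qed.

Definition to_Ak (a : Ahat) : Ak_ring K k := rproj _ (lft a).

Lemma Ak_eq F F' : rproj _ F = rproj _ F' :> Ak_ring K k <-> Phi n F = Phi n F'.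
Proof.
rewrite rprojP ideal_span1 -/(Ak_eqn K n) -(Phi_ker (isT : (0 < n)%N)) rmorphB /=.
by split=> [/eqP|->]; rewrite ?subrr // subr_eq0 => /eqP.
Qed.

Lemma to_AkE F : to_Ak (Psi F) = rproj _ F.
Proof. by apply/Ak_eq/Psi_eq; rewrite lftP. Qed.

Lemma to_Ak_is_zmod : zmod_morphism to_Ak.
Proof. by move=> a b; rewrite -[a]lftP -[b]lftP -rmorphB !to_AkE rmorphB. Qed.
Lemma to_Ak_is_monoid : monoid_morphism to_Ak.
Proof.
split; first by rewrite -(rmorph1 Psi) to_AkE rmorph1.
by move=> a b; rewrite -[a]lftP -[b]lftP -rmorphM !to_AkE rmorphM.
Qed.
HB.instance Definition _ := GRing.isZmodMorphism.Build _ _ to_Ak to_Ak_is_zmod.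
HB.instance Definition _ := GRing.isMonoidMorphism.Build _ _ to_Ak to_Ak_is_monoid.

Lemma to_Ak_bij : bijective to_Ak.
Proof.
exists (fun v => Psi (repr v)) => [a|v]; last by rewrite to_AkE rproj_surj.
rewrite -[RHS]lftP; apply/Psi_eq/Ak_eq; rewrite rproj_surj.
by rewrite /to_Ak.
Qed.

Lemma completed_Ak : exists chi : {rmorphism Ahat -> Ak_ring K k},
  bijective chi /\ forall c, chi (to_completion _ (rproj I (cst c))) = Ak_const k c.
Proof.
exists to_Ak; split=> [|c]; first exact: to_Ak_bij.
by rewrite -Psi_tau [LHS]to_AkE; case: tauP => -> _ _.
Qed.

Definition completed (C : set O) : set Ahat :=
  ideal_span [set to_completion _ (rproj I g) | g in C].

(** [C] generates the ideal [(a, b)] of the completion of [O]; for the curves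
    below, two elements of [C] suffice to express a generator. *)
Definition generates (C : set O) (a b : fps K 3) : Prop :=
  (forall g, C g -> exists c d, tau g = c * a + d * b) /\
  forall F, F = a \/ F = b -> exists g h c d, [/\ C g, C h & F = c * tau g + d * tau h].

Lemma completed_sub C a b (x : fps K 2) : generates C a b ->
  dv x (Phi n a) -> dv x (Phi n b) -> forall c, completed C c -> dv x (to_graded c).
Proof.
move=> [sub _] xa xb c; apply: (ideal_span_sub (I := [set c | dv x (to_graded c)])).
  split=> /= [|v w|v w]; rewrite ?rmorph0 ?rmorphD ?rmorphM; first exact: dv0.
    exact: dvD.
  exact: dv_mull.
move=> _ [g /sub[v [w E]] <-] /=; rewrite -Psi_tau to_gradedE E rmorphD !rmorphM.
by apply: dvD; apply: dv_mull.
Qed.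

Lemma completed_mem C a b F : generates C a b -> F = a \/ F = b ->
  completed C (Psi F).
Proof.
move=> [_ gens] /gens[g [h [c [d [Cg Ch ->]]]]].
have [_ D M] := is_ideal_span [set to_completion (@nonunits L) (rproj I g) | g in C].
rewrite rmorphD !rmorphM /= !Psi_tau; apply: D; apply: M; apply: sub_ideal_span.
  by exists g.
by exists h.
Qed.

Lemma completed_class (C1 C2 : set O) :
  generates C1 (fps_var K (inord 1)) (fps_var K (inord 2)) ->
  generates C2 (fps_var K ord0) (fps_var K (inord 2)) ->
  exists psi : {additive class_group Ahat -> Zmod n},
    [/\ bijective psi,
        exists2 c1, is_class_of (completed C1) c1 & psi c1 = Zmod_proj n 1
      & exists2 c2, is_class_of (completed C2) c2 & psi c2 = Zmod_proj n (- 1)].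
Proof.
move=> g1 g2.
have gen := @Zmod_gen n isT.
pose cw := class_wt gen to_graded_inj to_gradedP.
pose cwz := GRing.isZmodMorphism.Build _ _ cw
  (class_wt_is_zmod gen to_graded_inj to_gradedP).
pose psi : {additive class_group Ahat -> Zmod n} := HB.pack cw cwz.
exists psi; split.
- exact: class_wt_bij.
- have [||||||||D HD wD] := @ideal_class K (Zmod n) gam gen Ahat to_graded
    to_graded_inj to_gradedP (completed C1) (fps_var K ord_max) (fps_var K ord0)
    gam n (Psi (fps_var K (inord 1))) (Psi (fps_var K (inord 2))) (hom_t gam).
  + exact: var_neq0.
  + exact: prime_var.
  + exact: var_ndv.
  + apply: (completed_sub g1); rewrite ?Phi_y ?Phi_z //.
      by rewrite exprS; apply: dv_mulr; apply: dv_refl.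
    by apply: dv_mull; apply: dv_refl.
  + by apply: (completed_mem g1); left.
  + by rewrite [LHS]to_gradedE Phi_y.
  + by apply: (completed_mem g1); right.
  + by rewrite [LHS]to_gradedE Phi_z // mulrC.
  by exists (divisor_class D); [exists D | rewrite [LHS]class_wtE].
- have [||||||||D HD wD] := @ideal_class K (Zmod n) gam gen Ahat to_graded
    to_graded_inj to_gradedP (completed C2) (fps_var K ord0) (fps_var K ord_max)
    (- gam) n (Psi (fps_var K ord0)) (Psi (fps_var K (inord 2))) (hom_s gam).
  + exact: var_neq0.
  + exact: prime_var.
  + exact: var_ndv.
  + apply: (completed_sub g2); rewrite ?Phi_x ?Phi_z //.
      by rewrite exprS; apply: dv_mulr; apply: dv_refl.
    by apply: dv_mulr; apply: dv_refl.
  + by apply: (completed_mem g2); left.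
  + by rewrite [LHS]to_gradedE Phi_x.
  + by apply: (completed_mem g2); right.
  + by rewrite [LHS]to_gradedE Phi_z.
  exists (divisor_class D); first by exists D.
  by rewrite [LHS]class_wtE wD raddfN.
Qed.
End Completed.

(** * Regular parameters of K[[x,y,z]] *)

Section RegularCoordinates.
Variable K : fieldType.
Local Notation S := (fps K 3).
Implicit Types (f g a b c : S) (i j l : 'I_3) (m : 'X_{1..3}).

Definition ideal2 a b f := exists g h, f = g * a + h * b.

(** Linear independence of the linear parts. *)
Definition indep1 a := forall k : K, ford 2 (fps_const k * a) -> k = 0.
Definition indep2 a b := forall k l : K,
  ford 2 (fps_const k * a + fps_const l * b) -> k = 0 /\ l = 0.
Definition indep3 a b c := forall k l n : K,
  ford 2 (fps_const k * a + fps_const l * b + fps_const n * c) ->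
  [/\ k = 0, l = 0 & n = 0].

Lemma fps_auto_id : fps_auto (idfun : S -> S).
Proof. by split=> // g; exists g. Qed.

Lemma fps_auto_comp (k1 k2 : S -> S) : fps_auto k1 -> fps_auto k2 -> fps_auto (k2 \o k1).
Proof.
move=> [c1 f1 s1] [c2 f2 s2]; split=> /= [k|d f|g].
- by rewrite c1 c2.
- by rewrite f2 f1.
by have [h <-] := s2 g; have [h' <-] := s1 h; exists h'.
Qed.

Lemma fps_auto_inj (kappa : {rmorphism S -> S}) : fps_auto kappa -> injective kappa.
Proof.
move=> [_ kf _] f g E; apply: ford_eq => d; apply/kf; rewrite rmorphB E subrr.
exact: ford_zero.
Qed.

Lemma auto_dv (kappa : {rmorphism S -> S}) a f : fps_auto kappa ->
  dv (kappa a) (kappa f) <-> dv a f.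
Proof.
move=> ka; have kI := fps_auto_inj ka; have [_ _ ks] := ka; split=> [[h]|[h ->]].
  by have [h' <-] := ks h; rewrite -rmorphM => /kI ->; exists h'.
by rewrite rmorphM; exists (kappa h).
Qed.

Lemma auto_ideal2 (kappa : {rmorphism S -> S}) a b f : fps_auto kappa ->
  ideal2 (kappa a) (kappa b) (kappa f) <-> ideal2 a b f.
Proof.
move=> ka; have kI := fps_auto_inj ka; have [_ _ ks] := ka; split=> [[g [h]]|[g [h ->]]].
  have [g' <-] := ks g; have [h' <-] := ks h.
  by rewrite -!rmorphM -rmorphD => /kI ->; exists g', h'.
by rewrite rmorphD !rmorphM; exists (kappa g), (kappa h).
Qed.

(** Substituting the series for the [j]-th variable, and keeping the others, is
    invertible to first order. *)
Lemma coord_step (kappa : {rmorphism S -> S}) g j : fps_auto kappa -> ford 1 g ->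
  kappa g U_(j)%MM != 0 ->
  exists kappa' : {rmorphism S -> S}, [/\ fps_auto kappa', kappa' g = fps_var K j
    & forall f i, i != j -> kappa f = fps_var K i -> kappa' f = fps_var K i].
Proof.
move=> ka g1 gj; have [kc kf ks] := ka.
pose v i := if i == j then kappa g else fps_var K i.
have hv i : ford 1 (v i).
  by rewrite /v; case: ifP => _; [apply/kf | apply: ford_var].
have [|k' [k'a k'v]] := formal_inverse hv.
  rewrite -row_free_unit; apply: inj_row_free => w /matrixP Hw; apply/rowP => i.
  have wE l : \sum_i w 0 i * v i U_(l)%MM = 0.
    have := Hw 0 l; rewrite !mxE => E; rewrite -[RHS]E.
    by apply: eq_bigr => i' _; rewrite !mxE.
  have vE i' l : i' != j -> v i' U_(l)%MM = (i' == l)%:R.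
    by move=> ne; rewrite /v (negPf ne) fps_varE fps_mono eq_mnm1.
  have wj : w 0 j = 0.
    have := wE j; rewrite (bigD1 j) //= big1 => [|i' ne]; last first.
      by rewrite vE // (negPf ne) mulr0.
    by rewrite addr0 /v eqxx => /eqP; rewrite mulf_eq0 (negPf gj) orbF => /eqP.
  rewrite mxE; have [-> //|ne] := eqVneq i j.
  have := wE i; rewrite (bigD1 i) //= vE // eqxx mulr1 big1 ?addr0 // => i' ne'.
  have [->|ne2] := eqVneq i' j; first by rewrite wj mul0r.
  by rewrite vE // (negPf ne') mulr0.
pose kk : {rmorphism S -> S} := GRing.RMorphism.clone _ _ (k' \o kappa) _.
exists kk; split.
- exact: fps_auto_comp.
- by have := k'v j; rewrite /v eqxx.
- by move=> f i ne E; change (k' (kappa f) = fps_var K i); rewrite E; have := k'v i; rewrite /v (negPf ne).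
Qed.

Lemma lin_zero g : ford 1 g -> (forall i, g U_(i)%MM = 0) -> ford 2 g.
Proof.
move=> g1 H; rewrite -[g](subrK (\sum_j fps_const (g U_(j)%MM) * fps_var K j)).
apply: fordD; first exact: ford1_lin.
by apply: ford_sum => j _; rewrite H rmorph0 mul0r; apply: ford_zero.
Qed.

Lemma coords1 a : ford 1 a -> indep1 a ->
  exists (kappa : {rmorphism S -> S}) i, fps_auto kappa /\ kappa a = fps_var K i.
Proof.
move=> a1 ia; have [i ai] : exists i, a U_(i)%MM != 0.
  apply: contrapT => H; suff /eqP : (1 : K) = 0 by rewrite oner_eq0.
  apply: ia; rewrite rmorph1 mul1r; apply: lin_zero => // i.
  by apply/eqP/negPn/negP => ?; apply: H; exists i.
have [k [ka E _]] := @coord_step (GRing.RMorphism.clone _ _ idfun _) a i fps_auto_id a1 ai.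
by exists k, i.
Qed.

Lemma indep2_1 a b : indep2 a b -> indep1 a.
Proof.
by move=> H k Hk; have [] // := H k 0; rewrite rmorph0 mul0r addr0.
Qed.

Lemma coords2 a b : ford 1 a -> ford 1 b -> indep2 a b ->
  exists (kappa : {rmorphism S -> S}) i j,
   [/\ fps_auto kappa, i != j, kappa a = fps_var K i & kappa b = fps_var K j].
Proof.
move=> a1 b1 iab; have [k [i [ka E]]] := coords1 a1 (indep2_1 iab).
have [kc kf ks] := ka; have kb1 : ford 1 (k b) by apply/kf.
have [j ij bj] : exists2 j, i != j & k b U_(j)%MM != 0.
  apply: contrapT => H.
  have [|_ /eqP] := iab (- (k b U_(i)%MM)) 1; last by rewrite oner_eq0.
  apply/kf; rewrite rmorphD !rmorphM /= !kc E rmorph1 mul1r; apply: lin_zero.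
    by apply: fordD => //; apply: fordMl; apply: ford_var.
  move=> j; rewrite fpsD fps_constM fps_varE fps_mono eq_mnm1.
  have [<-|ne] := eqVneq i j; first by rewrite mulr1 addNr.
  rewrite mulr0 add0r; apply/eqP/negPn/negP => ?; apply: H; by exists j.
have [k' [k'a Eb H]] := coord_step ka b1 bj.
by exists k', i, j; split=> //; apply: H.
Qed.

Lemma coords3 a b c : ford 1 a -> ford 1 b -> ford 1 c -> indep3 a b c ->
  exists kappa : {rmorphism S -> S}, [/\ fps_auto kappa, kappa a = fps_var K ord0,
   kappa b = fps_var K (inord 1) & kappa c = fps_var K (inord 2)].
Proof.
move=> a1 b1 c1 iabc.
pose v i := if i == ord0 then a else if i == inord 1 then b else c.
have hv i : ford 1 (v i) by rewrite /v; case: ifP => // _; case: ifP.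
have [|k [ka kv]] := formal_inverse hv.
  rewrite -row_free_unit; apply: inj_row_free => w /matrixP Hw.
  have [|w0 w1 w2] := iabc (w 0 ord0) (w 0 (inord 1)) (w 0 (inord 2)).
    apply: lin_zero => [|l].
      by apply: fordD; [apply: fordD|]; apply: fordMl.
    have := Hw 0 l; rewrite !mxE big_I3 !mxE /v !jE => E.
    by rewrite !fpsD !fps_constM -addrA.
  by apply/rowP => i; rewrite mxE; move: i; apply: I3_case.
exists k; split=> //; first by have := kv ord0; rewrite /v !jE.
  by have := kv (inord 1); rewrite /v !jE.
by have := kv (inord 2); rewrite /v !jE.
Qed.

Lemma prime_dv a f g : ford 1 a -> indep1 a -> dv a (f * g) -> dv a f \/ dv a g.
Proof.
move=> a1 ia; have [k [i [ka E]]] := coords1 a1 ia.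
rewrite -(auto_dv a (f * g) ka) -(auto_dv a f ka) -(auto_dv a g ka) E rmorphM.
exact: prime_var.
Qed.

Lemma ideal2_var i j f : i != j ->
  ideal2 (fps_var K i) (fps_var K j) f <-> (forall m, m i = 0%N -> m j = 0%N -> f m = 0).
Proof.
move=> ij; split=> [[g [h ->]] m mi mj|H].
  by rewrite fpsD ![_ * fps_var _ _]mulrC !var_mul0 // addr0.
pose f1 : S := fun m => if m i == 0%N then f m else 0.
have [|h Eh] := @dv_var _ _ j f1.
  by move=> m mj; rewrite /f1; case: eqP => // mi; apply: H.
have [|g Eg] := @dv_var _ _ i (f - f1).
  by move=> m mi; rewrite fpsB /f1 mi eqxx subrr.
by exists g, h; rewrite mulrC -Eg mulrC -Eh subrK.
Qed.

Lemma prime_ideal2 a b f g : ford 1 a -> ford 1 b -> indep2 a b ->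
  ideal2 a b (f * g) -> ideal2 a b f \/ ideal2 a b g.
Proof.
move=> a1 b1 iab; have [k [i [j [ka ij Ea Eb]]]] := coords2 a1 b1 iab.
rewrite -(auto_ideal2 a b (f * g) ka) -(auto_ideal2 a b f ka) -(auto_ideal2 a b g ka).
rewrite Ea Eb rmorphM /= !ideal2_var // => H.
have dK : GRing.integral_domain_axiom K by move=> x y /eqP; rewrite mulf_eq0.
have P m m' : ((m + m')%MM i == 0%N) && ((m + m')%MM j == 0%N) =
    ((m i == 0%N) && (m j == 0%N)) && ((m' i == 0%N) && (m' j == 0%N)).
  by rewrite !mnmDE !addn_eq0 andbACA.
case: (@face_prime K 3 (fun m => (m i == 0%N) && (m j == 0%N)) P (k f) (k g) _ dK).
- by move=> m /andP[/eqP mi /eqP mj]; apply: H.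
- by move=> H1; left=> m mi mj; apply: H1; rewrite mi mj.
- by move=> H1; right=> m mi mj; apply: H1; rewrite mi mj.
Qed.

Lemma ideal2_ford1 a b f : ford 1 a -> ford 1 b -> ideal2 a b f -> ford 1 f.
Proof. by move=> a1 b1 [g [h ->]]; apply: fordD; apply: fordMl. Qed.

Lemma lin_dim (w : 'I_2 -> S) :
  ~ (forall g, ford 1 g -> exists c : 'I_2 -> K, ford 2 (g - \sum_i fps_const (c i) * w i)).
Proof.
move=> H.
have /choice[c Hc] i : exists c : 'I_2 -> K,
    ford 2 (fps_var K i - \sum_i fps_const (c i) * w i).
  exact: H (@ford_var K 3 i).
pose C := \matrix_(i < 3, j < 2) c i j; pose W := \matrix_(i < 2, l < 3) w i U_(l)%MM.
have E : C *m W = 1%:M.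
  apply/matrixP => i l; rewrite !mxE; have := Hc i U_(l)%MM.
  rewrite mdeg1 => /(_ isT) /eqP; rewrite fpsB fps_sum subr_eq0 fps_varE fps_mono.
  rewrite eq_mnm1 => /eqP ->; apply: eq_bigr => j _; rewrite !mxE fps_constM //.
have := mxrankM_maxl C W; rewrite E mxrank1 => H3.
by have := leq_trans H3 (rank_leq_col C).
Qed.

End RegularCoordinates.

(** * Noetherian local rings: the theorems of Nakayama and Krull *)

Section Quotients.
Variables (A : comPzRingType) (I : set A).
Hypothesis II : is_ideal I.
Implicit Types (J L q : set A).

Lemma rproj_eqI (x y : A) : rproj I x = rproj I y <-> I (x - y).
Proof. by rewrite rprojP (ideal_span_id II). Qed.

Definition image_q J : set (rquot I) := [set l | exists2 x, J x & rproj I x = l].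
Definition preim_q (J : set (rquot I)) : set A := [set x | J (rproj I x)].

Lemma image_q_ideal J : is_ideal J -> is_ideal (image_q J).
Proof.
case=> J0 JD JM; split=> [|_ _ [x Jx <-] [y Jy <-]|a _ [x Jx <-]].
- by exists 0; rewrite ?rmorph0.
- by exists (x + y); [exact: JD | rewrite rmorphD].
- exists (repr a * x); first exact: JM.
  by rewrite rmorphM /= rproj_surj.
Qed.

Lemma preim_q_ideal (J : set (rquot I)) : is_ideal J -> is_ideal (preim_q J).
Proof.
case=> J0 JD JM; rewrite /preim_q; split=> [|x y|a x] /=.
- by rewrite rmorph0.
- by rewrite rmorphD; apply: JD.
- by rewrite rmorphM; apply: JM.
Qed.

Lemma image_qE J x : is_ideal J -> I `<=` J -> image_q J (rproj I x) -> J x.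
Proof.
move=> [_ JD _] IJ [y Jy /esym/rproj_eqI Ixy]; rewrite -[x](subrK y).
by apply: JD => //; apply: IJ.
Qed.

Lemma preim_q_prime (q : set (rquot I)) : is_prime q -> is_prime (preim_q q).
Proof.
move=> [qI q1 qM]; split; first exact: preim_q_ideal.
  by rewrite /preim_q /= rmorph1.
by move=> x y; rewrite /preim_q /= rmorphM; apply: qM.
Qed.

Lemma image_q_prime q : is_prime q -> I `<=` q -> is_prime (image_q q).
Proof.
move=> [qI q1 qM] Iq; split; first exact: image_q_ideal.
  by rewrite -(rmorph1 (@rproj _ I)) => /(image_qE qI Iq).
move=> a b; rewrite -[a]rproj_surj -[b]rproj_surj -rmorphM.
move=> /(image_qE qI Iq)/qM[] H; [left | right]; first by exists (repr a).
by exists (repr b).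
Qed.

Lemma preim_q_sub (q : set (rquot I)) : is_ideal q -> I `<=` preim_q q.
Proof.
move=> [q0 _ _] x Ix; rewrite /preim_q /= (_ : rproj I x = 0) //.
by rewrite -(rmorph0 (@rproj _ I)); apply/rproj_eqI; rewrite subr0.
Qed.

Lemma preim_q_proper (q q' : set (rquot I)) : q `<` q' -> preim_q q `<` preim_q q'.
Proof.
move=> [sub n]; split=> [x|H]; first exact: sub.
apply: n => l; rewrite -[l]rproj_surj; exact: H.
Qed.

Lemma image_q_proper q q' : is_ideal q -> I `<=` q -> q `<` q' -> image_q q `<` image_q q'.
Proof.
move=> qI Iq [sub n]; split=> [_ [x qx <-]|H]; first by exists x => //; apply: sub.
by apply: n => x q'x; apply: (image_qE qI Iq); apply: H; exists x.
Qed.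
End Quotients.

Section Chain.
Variable A : comPzRingType.
Implicit Types (I J L M N W q : set A).

Definition ideal_add I (x : A) : set A := [set y | exists i a, I i /\ y = i + a * x].

Lemma ideal_add_ideal I x : is_ideal I -> is_ideal (ideal_add I x).
Proof.
move=> [I0 ID IM]; split=> [|_ _ [i [a [Hi ->]]] [j [b [Hj ->]]]|c _ [i [a [Hi ->]]]].
- by exists 0, 0; rewrite mul0r addr0.
- by exists (i + j), (a + b); split; [exact: ID | ring].
- by exists (c * i), (c * a); split; [exact: IM | ring].
Qed.
Lemma ideal_add_sub I x : I `<=` ideal_add I x.
Proof. by move=> y Iy; exists y, 0; rewrite mul0r addr0. Qed.
Lemma ideal_add_mem I x : is_ideal I -> ideal_add I x x.
Proof. by move=> [I0 _ _]; exists 0, 1; rewrite mul1r add0r. Qed.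
Lemma ideal_add_min I x J : is_ideal J -> I `<=` J -> J x -> ideal_add I x `<=` J.
Proof. by move=> [_ JD JM] IJ Jx _ [i [a [Hi ->]]]; apply: JD; [apply: IJ | apply: JM]. Qed.

(** The quotient by [I] is noetherian, in terms of the ideals of the ring
    itself. *)
Definition acc I : Prop := forall F : set (set A),
  (exists J, F J) -> (forall J, F J -> is_ideal J /\ I `<=` J) ->
  exists2 J, F J & forall L, F L -> J `<=` L -> L `<=` J.

Lemma noetherian_acc I : is_ideal I -> noetherian (rquot I) -> acc I.
Proof.
move=> II noeth F [J0 FJ0] HF; apply: contrapT => nomax.
have step (J : set A) : exists L : set A, F J -> [/\ F L, J `<=` L & ~ L `<=` J].
  have [FJ|nF] := pselect (F J); last by exists J.
  apply: contrapT => H; apply: nomax; exists J => // L FL JL; apply: contrapT => nLJ.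
  by apply: H; exists L.
have [st Hst] := choice step.
pose J := fix J i := if i is i'.+1 then st (J i') else J0.
have FJ i : F (J i) by elim: i => //= i /Hst[].
have Jmono i j : (i <= j)%N -> J i `<=` J j.
  move=> /subnKC <-; elim: (j - i)%N => [|l IH]; first by rewrite addn0.
  rewrite addnS; apply: subset_trans IH _.
  by have [] := Hst _ (FJ (i + l)%N).
pose U : set A := [set x | exists i, J i x].
have UI : is_ideal U.
  split=> [|x y [i Hx] [j Hy]|a x [i Hx]].
  - by exists 0%N; have [[]] := HF _ FJ0.
  - exists (maxn i j); have [[_ D _] _] := HF _ (FJ (maxn i j)).
    by apply: D; [apply: Jmono Hx; exact: leq_maxl | apply: Jmono Hy; exact: leq_maxr].
  - by exists i; have [[_ _ M] _] := HF _ (FJ i); apply: M.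
have [s Es] := noeth _ (image_q_ideal I UI).
have [m Hm] : exists m, forall l, l \in s -> image_q (J m) l.
  have : forall l, l \in s -> image_q U l.
    by move=> l ls; rewrite Es; apply: sub_ideal_span.
  elim: (s) => [|l s' IH] H; first by exists 0%N.
  have [|m Hm] := IH; first by move=> l' h; apply: H; rewrite inE h orbT.
  have [|x [i Jx] Ex] := H l; first by rewrite inE eqxx.
  exists (maxn i m) => l'; rewrite inE => /orP[/eqP ->|/Hm[y Jy Ey]].
    by exists x => //; apply: Jmono Jx; exact: leq_maxl.
  by exists y => //; apply: Jmono Jy; exact: leq_maxr.
have [JmI IJm] := HF _ (FJ m).
have [_ _] := Hst _ (FJ m); apply => x Hx.
have : image_q U (rproj I x) by exists x => //; exists m.+1.
rewrite Es => /(_ (image_q (J m))) H; apply: (image_qE II JmI IJm).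
by apply: H; [exact: image_q_ideal | move=> l /Hm].
Qed.

Definition ideal_mul M N : set A := ideal_span [set z | exists x y, [/\ M x, N y & z = x * y]].

Section Local.
Variable M : set A.
Hypotheses (MI : is_ideal M) (M1 : forall x, M x -> exists y, (1 - x) * y = 1).

Lemma nakayama I0 I N : acc I0 -> is_ideal I -> is_ideal N -> I0 `<=` I -> I `<=` N ->
  (forall y, N y -> exists i w, [/\ I i, ideal_mul M N w & y = i + w]) -> N `<=` I.
Proof.
move=> ac II NI I0I IN HN; apply: contrapT => nNI.
have [L [LI IL LN nNL] maxL] : exists2 L, [/\ is_ideal L, I `<=` L, L `<=` N & ~ N `<=` L]
    & forall L', [/\ is_ideal L', I `<=` L', L' `<=` N & ~ N `<=` L'] ->
      L `<=` L' -> L' `<=` L.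
  apply: (ac [set L | [/\ is_ideal L, I `<=` L, L `<=` N & ~ N `<=` L]]).
    by exists I; split=> //; apply: subset_refl.
  by move=> J [JI IJ _ _]; split=> //; apply: subset_trans IJ.
have [y [Ny nLy]] : exists y, N y /\ ~ L y.
  by apply: contrapT => H; apply: nNL => y Ny; apply: contrapT => ?; apply: H; exists y.
have NL : N `<=` ideal_add L y.
  apply: contrapT => H; apply: nLy; apply: (maxL (ideal_add L y)).
  - split=> //; first exact: ideal_add_ideal.
      exact: subset_trans IL (@ideal_add_sub _ _).
    exact: ideal_add_min.
  - exact: ideal_add_sub.
  - exact: ideal_add_mem.
have [L0 LD LM] := LI; have [M0 MD MM] := MI.
have [i [w [Ii Hw Ey]]] := HN _ Ny.
have [l [x [Ll Mx Ew]]] : exists l x, [/\ L l, M x & w = l + x * y].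
  apply: (Hw [set w | exists l x, [/\ L l, M x & w = l + x * y]]).
    split=> [|_ _ [l [x [Hl Hx ->]]] [l' [x' [Hl' Hx' ->]]]|a _ [l [x [Hl Hx ->]]]].
    - by exists 0, 0; rewrite mul0r addr0.
    - by exists (l + l'), (x + x'); split; [exact: LD | exact: MD | ring].
    - by exists (a * l), (a * x); split; [exact: LM | exact: MM | ring].
  move=> _ [x [z [Mx /NL[l [a [Ll ->]]] ->]]].
  by exists (x * l), (a * x); split; [exact: LM | exact: MM | ring].
have [v Hv] := M1 Mx; apply: nLy.
have -> : y = v * (i + l).
  have : (1 - x) * y = i + l by rewrite mulrBl mul1r {1}Ey Ew; ring.
  by move=> <-; rewrite mulrA [v * _]mulrC Hv mul1r.
by apply: LM; apply: LD => //; apply: IL.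
Qed.

Lemma ideal_pow_sub J L k : J `<=` L -> ideal_pow J k `<=` ideal_pow L k.
Proof.
move=> JL; elim: k => //= k IH; apply: ideal_span_sub; first exact: is_ideal_span.
by move=> _ [x [y [Jx Hy ->]]]; apply: sub_ideal_span; exists x, y; split; auto.
Qed.

Lemma ideal_powS_sub J k : ideal_pow J k.+1 `<=` ideal_pow J k.
Proof.
move=> x /=; apply: ideal_span_sub; first exact: is_ideal_pow.
by move=> _ [y [z [_ Hz ->]]]; have [_ _ PM] := is_ideal_pow J k; apply: PM.
Qed.

Lemma ideal_pow_mono J j k : (j <= k)%N -> ideal_pow J k `<=` ideal_pow J j.
Proof.
move=> /subnKC <-; elim: (k - j)%N => [|l IH]; first by rewrite addn0.
by rewrite addnS; apply: subset_trans IH; exact: ideal_powS_sub.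
Qed.

(** A product of [a + b] elements of [L + (e)] expands into terms with at least
    [a] factors in [L] or at least [b] factors [e]. *)
Lemma ideal_pow_add J L e a b : is_ideal J -> ideal_pow L a `<=` J -> J (e ^+ b) ->
  ideal_pow (ideal_add L e) (a + b) `<=` J.
Proof.
move=> JI La Je; have [J0 JD JM] := JI.
suff H i x : ideal_pow (ideal_add L e) i x ->
    ideal_span [set z | exists j g, [/\ (j <= i)%N, ideal_pow L j g & z = e ^+ (i - j) * g]] x.
  move=> x /H; apply: ideal_span_sub => // _ [j [g [ji Hg ->]]].
  have [aj|ja] := leqP a j; first by apply: JM; apply: La; apply: ideal_pow_mono Hg.
  rewrite -(@subnK b (a + b - j)) ?exprD; last by lia.
  by rewrite mulrAC; apply: JM.
elim: i x => [|i IH] x.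
  move=> _; apply: sub_ideal_span; exists 0%N, x; split=> //.
  by rewrite expr0 mul1r.
set T := ideal_span _; have TI : is_ideal T by apply: is_ideal_span.
move=> /=; apply: ideal_span_sub => // _ [y [z [[l [c [Ll ->]]] /IH Hz ->]]].
apply: (Hz [set z | T ((l + c * e) * z)]) => /=.
  have [T0 TD TM] := TI; split=> [|z1 z2 /= H1 H2|d z1 /= H1] /=; rewrite ?mulr0 ?mulrDr //.
    exact: TD.
  by rewrite mulrCA; apply: TM.
move=> _ [j [g [ji Hg ->]]] /=; rewrite mulrDl; have [_ TD TM] := TI; apply: TD.
  apply: sub_ideal_span; exists j.+1, (l * g); split=> //.
    by apply: sub_ideal_span; exists l, g.
  by rewrite subSS; ring.
rewrite -mulrA; apply: TM; apply: sub_ideal_span; exists j, g; split=> //.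
  exact: leqW.
by rewrite subSn // exprS; ring.
Qed.

Lemma ideal_pow_fg J L (s : seq A) : is_ideal J ->
  (forall e, e \in s -> exists b, J (e ^+ b)) ->
  (forall W, is_ideal W -> J `<=` W -> (forall e, e \in s -> W e) -> L `<=` W) ->
  exists k, ideal_pow L k `<=` J.
Proof.
move=> JI Hs HL.
pose span s := foldr (fun e W => ideal_add W e) J s.
have spanI s' : is_ideal (span s') by elim: s' => //= e s' IH; apply: ideal_add_ideal.
suff [k Hk] : exists k, ideal_pow (span s) k `<=` J.
  exists k; apply: subset_trans Hk; apply: ideal_pow_sub; apply: HL => //.
    elim: (s) => //= e s' IH; apply: subset_trans IH _; exact: ideal_add_sub.
  elim: (s) => //= e s' IH e'; rewrite inE => /orP[/eqP ->|/IH H].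
    exact: ideal_add_mem.
  exact: ideal_add_sub.
elim: s Hs {HL} => [|e s IH] Hs /=.
  exists 1%N; apply: ideal_span_sub => // _ [x [y [Jx _ ->]]].
  by rewrite mulrC; have [_ _ JM] := JI; apply: JM.
have [|a Ha] := IH; first by move=> e' h; apply: Hs; rewrite inE h orbT.
have [|b Hb] := Hs e; first by rewrite inE eqxx.
by exists (a + b)%N; apply: ideal_pow_add.
Qed.

(** Krull's intersection theorem for the quotient by [I]. An ideal [J] that is
    maximal among those meeting the intersection [N] inside [I + M N] contains a
    power of [M], whence [N = I + M N]; then Nakayama applies. *)
Lemma krull_intersection I0 I (s : seq A) f : acc I0 -> is_ideal I -> I0 `<=` I ->
  (forall e, e \in s -> M e) ->
  (forall W, is_ideal W -> I0 `<=` W -> (forall e, e \in s -> W e) -> M `<=` W) ->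
  (forall k, exists2 i, I i & ideal_pow M k (f - i)) -> I f.
Proof.
move=> ac II I0I sM Ms.
pose N : set A := [set f | forall k, exists2 i, I i & ideal_pow M k (f - i)].
rewrite -/(N f); suff NsubI : N `<=` I by exact: NsubI.
have [I00 ID IM] := II.
have NI : is_ideal N.
  split=> [k|x y Hx Hy k|a x Hx k]; have [P0 PD PM] := is_ideal_pow M k.
  - by exists 0; rewrite ?subrr.
  - have [i Ii Hi] := Hx k; have [j Ij Hj] := Hy k.
    exists (i + j); first exact: ID.
    by rewrite opprD addrACA; apply: PD.
  - have [i Ii Hi] := Hx k; exists (a * i); first exact: IM.
    by rewrite -mulrBr; apply: PM.
have IN : I `<=` N.
  by move=> x Ix k; exists x => //; rewrite subrr; case: (is_ideal_pow M k).
have [N0 ND NM] := NI.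
pose W : set A := [set y | exists i w, [/\ I i, ideal_mul M N w & y = i + w]].
have MNI : is_ideal (ideal_mul M N) := is_ideal_span _.
have MNN : ideal_mul M N `<=` N.
  by apply: ideal_span_sub => // _ [x [y [_ Ny ->]]]; apply: NM.
have WI : is_ideal W.
  have [P0 PD PM] := MNI.
  split=> [|_ _ [i [w [Hi Hw ->]]] [j [v [Hj Hv ->]]]|a _ [i [w [Hi Hw ->]]]].
  - by exists 0, 0; rewrite addr0.
  - by exists (i + j), (w + v); split; [exact: ID | exact: PD | ring].
  - by exists (a * i), (a * w); split; [exact: IM | exact: PM | ring].
have IW : I `<=` W.
  by move=> x Ix; exists x, 0; rewrite addr0; split=> //; case: MNI.
apply: (nakayama ac II NI I0I IN) => y Ny; rewrite -/(W y).
have [J [JI WJ JN] maxJ] : exists2 J, [/\ is_ideal J, W `<=` J & J `&` N `<=` W] &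
    forall L, [/\ is_ideal L, W `<=` L & L `&` N `<=` W] -> J `<=` L -> L `<=` J.
  apply: (ac [set J | [/\ is_ideal J, W `<=` J & J `&` N `<=` W]]).
    by exists W; split=> // x [].
  by move=> J [JI WJ _]; split=> //; apply: subset_trans I0I (subset_trans IW WJ).
have [J0 JD JM] := JI.
have powJ x : M x -> exists b, J (x ^+ b).
  move=> Mx.
  pose co b : set A := [set c | J (x ^+ b * c)].
  have coI b : is_ideal (co b).
    split=> [|c d Hc Hd|a c Hc]; rewrite /co /= ?mulr0 ?mulrDr //; first exact: JD.
    by rewrite mulrCA; apply: JM.
  have coJ b : J `<=` co b by move=> c Jc; apply: JM.
  have [_ [b _ <-] maxb] : exists2 L, (exists2 b, True & co b = L) &
      forall L', (exists2 b, True & co b = L') -> L `<=` L' -> L' `<=` L.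
    apply: (ac [set L | exists2 b, True & co b = L]).
      by exists (co 0%N), 0%N.
    move=> _ [b _ <-]; split; first exact: coI.
    exact: subset_trans I0I (subset_trans IW (subset_trans WJ (@coJ b))).
  exists b; apply: (maxJ (ideal_add J (x ^+ b))); last exact: ideal_add_mem.
    split; first exact: ideal_add_ideal.
      exact: subset_trans WJ (@ideal_add_sub _ _).
    move=> _ [[j [c [Jj ->]]] Nz]; apply: JN; split=> //.
    have Jxz : J (x * (j + c * x ^+ b)).
      apply: WJ; exists 0, (x * (j + c * x ^+ b)); rewrite add0r; split=> //.
      by apply: sub_ideal_span; exists x, (j + c * x ^+ b).
    have : co b.+1 c.
      rewrite /co /= exprS -[_ * c](_ : x * (j + c * x ^+ b) - x * j = _); last by ring.
      by apply: JD => //; apply: is_idealN => //; apply: JM.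
    move/(maxb (co b.+1)) => Hc; apply: JD => //; rewrite mulrC.
    apply: Hc; first by exists b.+1.
    by move=> d; rewrite /co /= exprS -mulrA; apply: JM.
  exact: ideal_add_sub.
have [k Hk] : exists k, ideal_pow M k `<=` J.
  apply: (ideal_pow_fg JI (s := s)); first by move=> e /sM/powJ.
  move=> V VI JV; apply: Ms => //.
  exact: subset_trans I0I (subset_trans IW (subset_trans WJ JV)).
have [i Ii Hi] := Ny k; apply: JN; split=> //.
rewrite -[y](subrK i); apply: JD; first exact: Hk.
exact: WJ (IW _ Ii).
Qed.

End Local.
End Chain.

(** * Ideals of surfaces, curves and multiplicity structures at a smooth point *)

Section Structure.
Variables (K : fieldType) (O : comPzRingType) (cst : K -> O).
Variable tau : {rmorphism O -> fps K 3}.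
Hypothesis tauP : coords cst tau.
Hypothesis tau_inj : forall f, tau f = 0 -> f = 0.
Hypothesis dim3 : ~ exists c : nat -> set O, prime_chain 4 c.
Implicit Types (f g h a u x : O) (I J T C Z W q : set O).

Local Notation M := (@nonunits O).
Let MP f : M f <-> ford 1 (tau f) := nonunits_ford tauP f.
Let powP k f : ideal_pow M k f <-> ford k (tau f).
Proof. by case: tauP. Qed.
Let dens (F : fps K 3) k : exists f, ford k (tau f - F).
Proof. by case: tauP. Qed.

Lemma M_ideal : is_ideal M.
Proof.
split=> [|x y /MP Hx /MP Hy|a x /MP Hx]; apply/MP.
- by rewrite rmorph0; apply: ford_zero.
- by rewrite rmorphD; apply: fordD.
- by rewrite rmorphM; apply: fordMl.
Qed.

Lemma M_not1 : ~ M 1. Proof. by apply; exists 1; rewrite mulr1. Qed.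

Lemma M_prime : is_prime M.
Proof.
split; [exact: M_ideal | exact: M_not1 | move=> x y /MP/ford1E].
rewrite rmorphM fpsM0 => /eqP; rewrite mulf_eq0 => /orP[]/eqP H; [left | right];
  by apply/MP/ford1E.
Qed.

Lemma not_M_unit x : ~ M x -> exists y, x * y = 1.
Proof. by move=> H; apply: contrapT => H'; apply: H. Qed.

Lemma M_inv x : M x -> exists y, (1 - x) * y = 1.
Proof.
move=> Mx; apply: not_M_unit => H; apply: M_not1; have [_ D _] := M_ideal.
by rewrite -[1](subrK x); apply: D.
Qed.

Lemma ideal_sub_M I : is_ideal I -> ~ I 1 -> I `<=` M.
Proof.
move=> [_ _ IM] I1 x Ix; apply: contrapT => /not_M_unit[y Hy]; apply: I1.
by rewrite -Hy mulrC; apply: IM.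
Qed.

Lemma prime_sub_M q : is_prime q -> q `<=` M.
Proof. by move=> [qI q1 _]; apply: ideal_sub_M. Qed.

Local Notation zero_set := ([set 0] : set O).

Let zero_set_prime : is_prime zero_set := zero_prime tau_inj.

Lemma no_chain q0 q1 q2 q3 q4 : is_prime q0 -> is_prime q1 -> is_prime q2 ->
  is_prime q3 -> is_prime q4 ->
  q0 `<` q1 -> q1 `<` q2 -> q2 `<` q3 -> q3 `<` q4 -> False.
Proof.
move=> ? ? ? ? ? ? ? ? ?; apply: dim3.
exists (fun i => match i with 0 => q0 | 1 => q1 | 2 => q2 | 3 => q3 | _ => q4 end)%N.
by split; case=> [|[|[|[|[|//]]]]].
Qed.

(** The contractions of the ideals [(a)] and [(a, u)] of the completion. *)
Definition dvI a : set O := [set f | dv (tau a) (tau f)].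
Definition id2I a u : set O := [set f | ideal2 (tau a) (tau u) (tau f)].

Lemma dvI_ideal a : is_ideal (dvI a).
Proof.
rewrite /dvI; split=> /= [|x y|b x]; first by rewrite rmorph0; apply: dv0.
  by rewrite rmorphD; apply: dvD.
by rewrite rmorphM; apply: dv_mull.
Qed.

Lemma id2I_ideal a u : is_ideal (id2I a u).
Proof.
rewrite /id2I; split=> /= [|x y [g [h E]] [g' [h' E']]|b x [g [h E]]].
- by exists 0, 0; rewrite rmorph0; ring.
- by exists (g + g'), (h + h'); rewrite rmorphD E E'; ring.
- by exists (tau b * g), (tau b * h); rewrite rmorphM E; ring.
Qed.

Lemma dvI_prime a : M a -> indep1 (tau a) -> is_prime (dvI a).
Proof.
move=> /MP a1 ia; split; first exact: dvI_ideal.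
  move=> [h E]; have := fordMr h a1; rewrite -E rmorph1 => /ford1E/eqP.
  by rewrite fps1 eqxx oner_eq0.
by move=> x y; rewrite /dvI /= rmorphM; apply: prime_dv.
Qed.

Lemma id2I_prime a u : M a -> M u -> indep2 (tau a) (tau u) -> is_prime (id2I a u).
Proof.
move=> /MP a1 /MP u1 iau; split; first exact: id2I_ideal.
  move=> /(ideal2_ford1 a1 u1) /ford1E/eqP.
  by rewrite rmorph1 fps1 eqxx oner_eq0.
by move=> x y; rewrite /id2I /= rmorphM; apply: prime_ideal2.
Qed.

Lemma dvI_self a : dvI a a. Proof. exact: dv_refl. Qed.
Lemma id2I_r a u : id2I a u u. Proof. by exists 0, 1; ring. Qed.

Lemma indep1_neq0 a : indep1 (tau a) -> a <> 0.
Proof.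
move=> ia a0; suff /eqP : (1 : K) = 0 by rewrite oner_eq0.
by apply: ia; rewrite a0 rmorph0 mulr0; apply: ford_zero.
Qed.

Lemma zero_dvI a : indep1 (tau a) -> zero_set `<` dvI a.
Proof.
move=> ia; split; first by move=> x ->; case: (dvI_ideal a).
by move=> /(_ a (dvI_self a)); apply: indep1_neq0.
Qed.

Lemma dvI_id2I a u : M a -> indep2 (tau a) (tau u) -> dvI a `<` id2I a u.
Proof.
move=> /MP a1 iau; split; first by move=> x [h E]; exists h, 0; rewrite E; ring.
move=> /(_ u (id2I_r a u)) [h E].
have [|_ /eqP] := iau (- h 0%MM) 1; last by rewrite oner_eq0.
rewrite rmorph1 mul1r E rmorphN [X in ford _ X](_ : _ = (h - fps_const (h 0%MM)) * tau a).
  by apply: (@fordM _ _ 1 1) => //; apply: ford1_const.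
ring.
Qed.

(** ** Ideals with regular quotient *)

(** What Krull's intersection theorem requires of the quotient by [T]. *)
Definition fin_over T : Prop := acc T /\ exists s : seq O, (forall e, e \in s -> M e) /\
  forall W, is_ideal W -> T `<=` W -> (forall e, e \in s -> W e) -> M `<=` W.

Section RegularQuotient.
Variables (T : set O) (d : nat) (x : 'I_d -> rquot T).
Hypotheses (TI : is_ideal T) (TM : T `<=` M).
Hypothesis xP : @nonunits (rquot T) = ideal_span (range x).

Lemma nonunits_q f : @nonunits (rquot T) (rproj T f) <-> M f.
Proof.
split=> [H [y fy]|H [v gv]]; first by apply: H; exists (rproj T y); rewrite -rmorphM fy rmorph1.
move: gv; rewrite -[v]rproj_surj -rmorphM -(rmorph1 (@rproj _ T)).
move=> /(rproj_eqI TI)/TM H1; apply: M_not1; have [_ D Mm] := M_ideal.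
rewrite -[1](subrK (f * repr v)); apply: D; last by rewrite mulrC; apply: Mm.
by rewrite -opprB; exact: (is_idealN M_ideal).
Qed.

Lemma regular_gen_M i : M (repr (x i)).
Proof.
apply/nonunits_q; rewrite rproj_surj xP; apply: sub_ideal_span.
by exists i.
Qed.

Lemma regular_gen W : is_ideal W -> T `<=` W -> (forall i, W (repr (x i))) -> M `<=` W.
Proof.
move=> WI TW Hx f /nonunits_q; rewrite xP => /(_ _ (image_q_ideal T WI)) H.
apply: (image_qE TI WI TW); apply: H => _ [i _ <-].
by exists (repr (x i)) => //; exact: rproj_surj.
Qed.

(** The maximal ideal is generated by [T] and the [x i], and to first order the
    coefficients can be replaced by their constant terms. *)
Lemma regular_lin (F : fps K 3) : ford 1 F -> exists t (c : 'I_d -> K),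
  T t /\ ford 2 (F - tau t - \sum_i fps_const (c i) * tau (repr (x i))).
Proof.
move=> F1; have [f Hf] := dens F 2.
pose W : set O := [set f | exists t (c : 'I_d -> K),
  T t /\ ford 2 (tau f - tau t - \sum_i fps_const (c i) * tau (repr (x i)))].
have [T0 TD TMm] := TI.
suff : M `<=` [set f | M f /\ W f].
  have Mf : M f.
    apply/MP; rewrite -[tau f](subrK F); apply: fordD => //; exact: fordW Hf.
  move=> /(_ f Mf)[_ [t [c [Tt Ht]]]]; exists t, c; split=> //.
  rewrite (_ : F - _ - _ = (tau f - tau t - \sum_i fps_const (c i) * tau (repr (x i))) -
    (tau f - F)); last by ring.
  exact: fordB.
apply: regular_gen.
- have [M0 MD MM] := M_ideal.
  split=> /= [|f1 f2 [H1 [t1 [c1 [T1 E1]]]] [H2 [t2 [c2 [T2 E2]]]]|b f1 [H1 [t1 [c1 [T1 E1]]]]].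
  + split=> //; exists 0, (fun _ => 0); split=> //.
    rewrite big1 ?rmorph0 => [|i _]; first by rewrite !subr0; apply: ford_zero.
    by rewrite mul0r.
  + split; first exact: MD.
    exists (t1 + t2), (fun i => c1 i + c2 i); split; first exact: TD.
    under eq_bigr => i _ do rewrite rmorphD mulrDl.
    rewrite big_split /= !rmorphD /=.
    set s1 := \sum_i _ in E1 *; set s2 := \sum_i _ in E2 *.
    rewrite (_ : _ - _ = (tau f1 - tau t1 - s1) + (tau f2 - tau t2 - s2)); last by ring.
    exact: fordD.
  + split; first exact: MM.
    pose b0 := (tau b) 0%MM.
    exists (b * t1), (fun i => b0 * c1 i); split; first exact: TMm.
    under eq_bigr => i _ do rewrite rmorphM -mulrA.
    rewrite -mulr_sumr !rmorphM /=.
    have s1F : ford 1 (\sum_i fps_const (c1 i) * tau (repr (x i))).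
      by apply: ford_sum => i _; apply: fordMl; apply/MP; apply: regular_gen_M.
    set s1 := \sum_i _ in E1 s1F *.
    rewrite (_ : _ - _ = tau b * (tau f1 - tau t1 - s1) + (tau b - fps_const b0) * s1).
      apply: fordD; first exact: fordMl.
      by apply: (@fordM _ _ 1 1) => //; apply: ford1_const.
    ring.
- move=> t Tt; split; first exact: TM.
  exists t, (fun _ => 0); split=> //; rewrite big1 => [|i _].
    by rewrite subrr subr0; apply: ford_zero.
  by rewrite rmorph0 mul0r.
- move=> i; split; first exact: regular_gen_M.
  exists 0, (fun j => (j == i)%:R); split=> //.
  rewrite (bigD1 i) //= eqxx rmorph1 mul1r big1 => [|j ne].
    by rewrite rmorph0 subr0 addr0 subrr; apply: ford_zero.
  by rewrite (negPf ne) rmorph0 mul0r.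
Qed.
End RegularQuotient.

Lemma regular_fin T d : is_ideal T -> T `<=` M -> regular_local (rquot T) d -> fin_over T.
Proof.
move=> TI TM [noeth _ _ [x xP]]; split; first exact: noetherian_acc.
exists [seq repr (x i) | i <- enum 'I_d]; split.
  by move=> e /mapP[i _ ->]; apply: regular_gen_M xP i.
move=> W WI TW Hx; apply: (regular_gen TI TM xP WI TW) => i.
by apply: Hx; apply: map_f; rewrite mem_enum.
Qed.

(** Ideals containing [T] are closed, so membership can be tested in the
    completion, to every finite order. *)
Lemma krull T I f : fin_over T -> is_ideal I -> T `<=` I ->
  (forall k, exists2 i, I i & ford k (tau f - tau i)) -> I f.
Proof.
move=> [ac [s [sM Ms]]] II TI H.
apply: (@krull_intersection _ M M_ideal M_inv T I s f) => // k.
by have [i Ii Hi] := H k; exists i => //; apply/powP; rewrite rmorphB.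
Qed.

Lemma dv_approx I a f k : is_ideal I -> I a -> dv (tau a) (tau f) ->
  exists2 i, I i & ford k (tau f - tau i).
Proof.
move=> [_ _ IM] Ia [F E]; have [g Hg] := dens F k.
exists (g * a); first exact: IM.
by rewrite rmorphM E mulrC -mulrBl; apply: fordMr; apply: fordBC.
Qed.

Lemma ideal2_approx I a u f k : is_ideal I -> I a -> I u ->
  ideal2 (tau a) (tau u) (tau f) -> exists2 i, I i & ford k (tau f - tau i).
Proof.
move=> [_ ID IM] Ia Iu [F [G E]]; have [g Hg] := dens F k; have [h Hh] := dens G k.
exists (g * a + h * u); first by apply: ID; apply: IM.
rewrite rmorphD !rmorphM E (_ : _ - _ = (F - tau g) * tau a + (G - tau h) * tau u) /=.
  by apply: fordD; apply: fordMr; apply: fordBC.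
ring.
Qed.

(** The ideal of a smooth surface is the contraction of a principal ideal: any
    other ideal with regular two-dimensional quotient would give a chain of
    primes of length four. *)
Theorem surface_ideal T : is_ideal T -> T `<=` M -> regular_local (rquot T) 2 ->
  exists a, [/\ T a, M a, indep1 (tau a) & T = dvI a].
Proof.
move=> TI TM reg; have fin := regular_fin TI TM reg.
have [_ _ [[c [cp cs]] _] [x xP]] := reg.
have [a [Ta a2]] : exists a, T a /\ ~ ford 2 (tau a).
  apply: contrapT => H; apply: (@lin_dim K (fun i => tau (repr (x i)))) => F F1.
  have [t [k [Tt Ht]]] := regular_lin TI TM xP F1; exists k.
  rewrite (_ : F - _ = (F - tau t - \sum_i fps_const (k i) * tau (repr (x i))) + tau t).
    by apply: fordD => //; apply: contrapT => ?; apply: H; exists t.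
  by ring.
have ia : indep1 (tau a).
  move=> k Hk; have [//|k0] := eqVneq k 0; case: a2.
  rewrite -[tau a]mul1r -(rmorph1 (@fps_const K 3)) -(mulVf k0) rmorphM -mulrA.
  exact: fordMl.
exists a; have Ma := TM a Ta; split=> //; apply/seteqP; split; last first.
  by move=> f fa; apply: (krull fin) => // k; apply: dv_approx fa.
apply: contrapT => nTa.
pose q i := preim_q (c i).
have qp i : (i <= 2)%N -> is_prime (q i) by move=> /cp; apply: preim_q_prime.
have qs i : (i < 2)%N -> q i `<` q i.+1 by move=> /cs; apply: preim_q_proper.
have Tq : T `<=` q 0%N by apply: (preim_q_sub TI); case: (cp 0%N isT).
apply: (@no_chain zero_set (dvI a) (q 0%N) (q 1%N) (q 2%N)); try exact: qp; try exact: qs.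
- exact: zero_set_prime.
- exact: dvI_prime.
- exact: zero_dvI.
- split; last by move=> H; apply: nTa; apply: subset_trans H.
  by apply: subset_trans Tq => f fa; apply: (krull fin) => // k; apply: dv_approx fa.
Qed.

Section OnSurface.
Variables (T : set O) (a : O).
Hypotheses (TI : is_ideal T) (fin : fin_over T) (Ta : T a) (Ma : M a).
Hypotheses (ia : indep1 (tau a)) (TE : T = dvI a).

(** By Nakayama's lemma the ideal of the curve is the smaller prime of a chain in
    its quotient. It contains an element with linear part independent of that of
    [a], as the linear forms have dimension three, and the resulting prime
    [(a, u)] cannot be smaller without giving a chain of primes of length four. *)
Theorem curve_ideal C : is_ideal C -> C `<=` M -> regular_local (rquot C) 1 ->
  (forall q, is_prime q -> C `<=` q -> T `<=` q) ->
  exists u, [/\ C u, M u & indep2 (tau a) (tau u)] /\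
    [/\ is_prime C, ~ M `<=` C, T `<=` C, C = id2I a u & C = ideal_add T u].
Proof.
move=> CI CM reg CT; have [noeth _ [[c [cp cs]] _] [x xP]] := reg.
have acC : acc C by exact: noetherian_acc.
pose q i := preim_q (c i).
have qp i : (i <= 1)%N -> is_prime (q i) by move=> /cp; apply: preim_q_prime.
have Cq0 : C `<=` q 0%N by apply: (preim_q_sub CI); case: (cp 0%N isT).
have [q01 nq] : q 0%N `<` q 1%N by apply: preim_q_proper; apply: cs.
have [q0I _ q0M] := qp 0%N isT.
pose y := repr (x ord0); have My : M y by apply: (regular_gen_M CI CM xP).
have nMq : ~ M `<=` q 0%N.
  by move=> H; apply: nq => f /(prime_sub_M (qp 1%N isT)); apply: H.
have nyq : ~ q 0%N y.
  move=> qy; apply: nMq; apply: (regular_gen CI CM xP) => // i.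
  by rewrite (_ : i = ord0) ?ord1.
have MC : M `<=` ideal_add C y.
  apply: (regular_gen CI CM xP); [exact: ideal_add_ideal | exact: ideal_add_sub |].
  by move=> i; rewrite (_ : i = ord0) ?ord1 //; apply: ideal_add_mem.
have EC : C = q 0%N.
  apply/seteqP; split=> //; apply: (nakayama M_ideal M_inv acC CI q0I) => // f qf.
  have [i [b [Ci Ef]]] := MC f (prime_sub_M (qp 0%N isT) qf).
  exists i, (b * y); split=> //; apply: sub_ideal_span; exists y, b; split=> //; last exact: mulrC.
  have : q 0%N (b * y).
    rewrite (_ : b * y = f - i); last by rewrite Ef; ring.
    by have [_ D _] := q0I; apply: D => //; apply: (is_idealN q0I); apply: Cq0.
  by case/q0M.
have Cp : is_prime C by rewrite EC; apply: qp.
have nMC : ~ M `<=` C by rewrite EC.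
have TC : T `<=` C by apply: CT.
have [u [Cu iu]] : exists u, C u /\ forall k, ~ ford 2 (tau u - fps_const k * tau a).
  apply: contrapT => H.
  apply: (@lin_dim K (fun i : 'I_2 => if i == ord0 then tau a else tau y)) => F F1.
  have [t [k [Ct Ht]]] := regular_lin CI CM xP F1.
  have [l Hl] : exists l, ford 2 (tau t - fps_const l * tau a).
    by apply: contrapT => H2; apply: H; exists t; split=> // l ?; apply: H2; exists l.
  exists (fun i : 'I_2 => if i == ord0 then l else k ord0).
  move: Ht; rewrite big_ord1 -/y !big_ord_recl big_ord0 addr0 /= => Ht.
  rewrite (_ : F - _ = (F - tau t - fps_const (k ord0) * tau y) +
    (tau t - fps_const l * tau a)); last by ring.
  exact: fordD.
have iau : indep2 (tau a) (tau u).
  move=> k l Hkl; have [l0|l0] := eqVneq l 0.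
    by move: Hkl; rewrite l0 rmorph0 mul0r addr0 => /ia ->.
  case: (iu (- (l^-1 * k))); move: (fordMl (fps_const l^-1) Hkl).
  rewrite mulrDr !mulrA -!rmorphM mulVf // rmorph1 mul1r rmorphN mulNr opprK.
  by rewrite addrC.
have Mu := CM u Cu.
have sub : id2I a u `<=` C.
  move=> f Hf; apply: (krull fin) => // k.
  by apply: ideal2_approx Hf => //; apply: TC.
have EC2 : C = id2I a u.
  apply/seteqP; split=> //; apply: contrapT => nC.
  apply: (@no_chain zero_set (dvI a) (id2I a u) C M) => //.
  - exact: dvI_prime.
  - exact: id2I_prime.
  - exact: M_prime.
  - exact: zero_dvI.
  - exact: dvI_id2I.
exists u; split=> //; split=> //.
apply/seteqP; split; last exact: ideal_add_min.
move=> f; rewrite EC2 => f0.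
apply: (krull fin); [exact: ideal_add_ideal | exact: ideal_add_sub |] => k.
apply: ideal2_approx f0; [exact: ideal_add_ideal | | exact: ideal_add_mem].
exact: ideal_add_sub.
Qed.

Section Multiplicity.
Variables (C Z : set O) (u : O).
Hypotheses (Cp : is_prime C) (nMC : ~ M `<=` C) (TC : T `<=` C) (Mu : M u).
Hypotheses (iau : indep2 (tau a) (tau u)) (CE : C = id2I a u) (CE' : C = ideal_add T u).

(** On the surface the curve is a Cartier divisor, with equation [u], and by
    Krull's theorem only [0] is divisible by all its powers. *)
Lemma curve_div f : ~ T f -> exists j g t, [/\ T t, ~ C g & f = u ^+ j * g + t].
Proof.
have [T0 TD TMm] := TI => nTf.
have [|[|j] nj minj] := @ex_least (fun j => ~ ideal_add T (u ^+ j) f).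
- apply: contrapT => H; apply: nTf; apply: (krull fin) => // k.
  have [i [b [Ti Ef]]] : ideal_add T (u ^+ k) f.
    by apply: contrapT => ?; apply: H; exists k.
  exists i => //; rewrite Ef rmorphD rmorphM rmorphXn /= addrAC subrr add0r.
  by apply: fordMl; rewrite -[k in ford k]muln1; apply: fordX; apply/MP.
- by case: nj; exists 0, f; rewrite expr0 mulr1 add0r.
have [i [b [Ti Ef]]] : ideal_add T (u ^+ j) f.
  by apply: contrapT => /minj; apply.
exists j, b, i; split=> //; last by rewrite Ef addrC mulrC.
rewrite CE' => -[t [c [Tt Eb]]]; apply: nj; exists (i + u ^+ j * t), c; split.
  by apply: TD => //; apply: TMm.
by rewrite Ef Eb exprS; ring.
Qed.

Hypotheses (ZI : is_ideal Z) (TZ : T `<=` Z) (ZC : Z `<=` C).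
Hypothesis Zprimes : forall q, is_prime q -> Z `<=` q -> C `<=` q.
Hypothesis ZCM : cohen_macaulay_local (rquot Z).

Lemma prime_over q : is_prime q -> Z `<=` q -> q `<=` C \/ M `<=` q.
Proof.
move=> qp Zq; have Cq := Zprimes qp Zq; apply: contrapT => /not_orP[nqC nMq].
apply: (@no_chain zero_set (dvI a) C q M) => //.
- exact: dvI_prime.
- exact: M_prime.
- exact: zero_dvI.
- by rewrite CE; exact: dvI_id2I.
- by split=> //; exact: prime_sub_M.
Qed.

(** The depth is positive because the dimension is, as shown by the primes [C]
    and [M]. *)
Lemma CM_regular : exists2 x, M x & forall f, Z (x * f) -> Z f.
Proof.
have [_ _ [d [[_ ndim] [x xreg]]]] := ZCM.
have ZM : Z `<=` M by apply: subset_trans ZC (prime_sub_M Cp).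
case: d => [|d] in ndim x xreg *.
  case: ndim; exists (fun i => if i is 0%N then image_q C else image_q M).
  split; first by case=> [|[|//]] _; apply: image_q_prime => //; exact: M_prime.
  case=> [|//] _; apply: image_q_proper => //; first by case: Cp.
  by split=> //; exact: prime_sub_M.
have [nx reg] := xreg ord0; exists (repr (x ord0)).
  by apply/(nonunits_q ZI ZM); rewrite rproj_surj.
move=> f Zxf.
have /reg H : ideal_span [set x j | j in [set j : 'I_d.+1 | (j < @ord0 d)%N]]
    (x ord0 * rproj Z f).
  rewrite -[x ord0]rproj_surj -rmorphM /=.
  rewrite (_ : rproj Z _ = 0); last first.
    by rewrite -(rmorph0 (@rproj _ Z)); apply/(rproj_eqI ZI); rewrite subr0.
  by case: (is_ideal_span [set x j | j in [set j : 'I_d.+1 | (j < @ord0 d)%N]]).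
have : [set 0 : rquot Z] (rproj Z f).
  apply: (H [set 0 : rquot Z]) => [|_ [j /= jlt <-]]; last by [].
  by split=> [|v w -> ->|v w ->] //=; rewrite ?addr0 ?mulr0.
move=> /= E; rewrite -[f]subr0; apply/(rproj_eqI ZI).
by rewrite E rmorph0.
Qed.

(** Without embedded point, the ideal of the multiplicity structure is primary:
    an annihilator [(Z : h)] maximal among the proper ones is prime, and it is
    not the maximal ideal. *)
Lemma Z_primary s h : ~ C s -> Z (s * h) -> Z h.
Proof.
move=> nCs Zsh; apply: contrapT => nZh; have [x Mx xreg] := CM_regular.
have [Z0 ZD ZMm] := ZI.
pose ann g : set O := [set b | Z (b * g)].
have annI g : is_ideal (ann g).
  split=> [|b c Hb Hc|b c Hc]; rewrite /ann /= ?mul0r ?mulrDl //; first exact: ZD.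
  by rewrite -mulrA; apply: ZMm.
have [_ [g [nZg Zsg] <-] maxg] : exists2 L, (exists2 g, ~ Z g /\ Z (s * g) & ann g = L) &
    forall L', (exists2 g, ~ Z g /\ Z (s * g) & ann g = L') -> L `<=` L' -> L' `<=` L.
  have [ac _] := fin; apply: (ac [set L | exists2 g, ~ Z g /\ Z (s * g) & ann g = L]).
    by exists (ann h), h.
  move=> _ [g _ <-]; split; first exact: annI.
  by move=> t Tt; rewrite /ann /= mulrC; apply: ZMm; apply: TZ.
have pg : is_prime (ann g).
  split; [exact: annI | by rewrite /ann /= mul1r | move=> b c Zbc].
  have [Hc|nc] := pselect (ann g c); [by right | left].
  apply: (maxg (ann (c * g))); first exists (c * g) => //.
  - split=> //; rewrite mulrCA; exact: ZMm.
  - by move=> d Hd; rewrite /ann /= mulrCA; apply: ZMm.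
  - by rewrite /ann /= mulrA.
have Zg : Z `<=` ann g by move=> z Zz; rewrite /ann /= mulrC; apply: ZMm.
case: (prime_over pg Zg) => H; first by apply: nCs; apply: H.
by apply: nZg; apply: xreg; exact: (H x Mx).
Qed.

(** An ideal maximal among those containing [Z] but no power of [u] would be a
    prime over [Z], hence contain [C] and [u]. *)
Lemma u_nilp : exists k, Z (u ^+ k).
Proof.
apply: contrapT => H; have [Z0 ZD ZMm] := ZI.
have [ac _] := fin.
have [q [qI Zq qu] maxq] : exists2 q, [/\ is_ideal q, Z `<=` q & forall k, ~ q (u ^+ k)] &
    forall q', [/\ is_ideal q', Z `<=` q' & forall k, ~ q' (u ^+ k)] -> q `<=` q' -> q' `<=` q.
  apply: (ac [set q | [/\ is_ideal q, Z `<=` q & forall k, ~ q (u ^+ k)]]).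
    by exists Z; split=> // k Zk; apply: H; exists k.
  by move=> q [qI Zq _]; split=> //; apply: subset_trans Zq.
have [q0 qD qM] := qI.
have meet b : ~ q b -> exists k, ideal_add q b (u ^+ k).
  move=> nqb; apply: contrapT => nk; apply: nqb; apply: (maxq (ideal_add q b)).
  - split; first exact: ideal_add_ideal.
      exact: subset_trans Zq (@ideal_add_sub _ _ _).
    by move=> k Hk; apply: nk; exists k.
  - exact: ideal_add_sub.
  - exact: ideal_add_mem.
have qp : is_prime q.
  split=> // [|b c qbc]; first by move=> q1; apply: (qu 0%N); rewrite expr0.
  apply: contrapT => /not_orP[/meet[k [i [d [qi Ek]]]] /meet[l [j [e [qj El]]]]].
  apply: (qu (k + l)%N); rewrite exprD Ek El.
  rewrite (_ : _ * _ = (j + e * c) * i + d * b * j + d * e * (b * c)); last by ring.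
  by apply: (qD); [apply: qD | ]; apply: qM.
apply: (qu 1%N); rewrite expr1; apply: (Zprimes qp Zq).
by rewrite CE; apply: id2I_r.
Qed.

(** By [curve_div] and primality an element of [Z] is, modulo [T], a power of [u]
    times a factor that can be cancelled; [k] is the least exponent that occurs. *)
Theorem mult_ideal : exists k, Z = ideal_add T (u ^+ k) /\
  forall j s, (j < k)%N -> ~ C s -> ~ Z (s * u ^+ j).
Proof.
have [k Zk mink] := ex_least u_nilp; exists k; split; last first.
  by move=> j s jk nCs /(Z_primary nCs); apply: mink.
apply/seteqP; split; last exact: ideal_add_min.
move=> f Zf; have [Tf|/curve_div[j [g [t [Tt nCg Ef]]]]] := pselect (T f).
  exact: ideal_add_sub.
have Zug : Z (g * u ^+ j).
  rewrite (_ : _ * _ = f - t); last by rewrite Ef; ring.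
  by have [_ D _] := ZI; apply: D => //; apply: (is_idealN ZI); apply: TZ.
have [jk|kj] := ltnP j k; first by case: (mink j jk); apply: Z_primary Zug.
exists t, (u ^+ (j - k) * g); split=> //.
by rewrite Ef -(subnK kj) exprD addnK; ring.
Qed.
End Multiplicity.

End OnSurface.
End Structure.

(** * Chains of primes in dimension three *)

Section AlgebraicDependence.
Variable K : fieldType.
Local Notation P3 := {mpoly K[3]}.
Implicit Types (f g : P3) (m : 'X_{1..3}).

Definition degle d f := forall m, (d < mdeg m)%N -> f@_m = 0.

Lemma degleW d e f : (d <= e)%N -> degle d f -> degle e f.
Proof. by move=> de H m em; apply: H; apply: leq_ltn_trans em. Qed.

Lemma degle_mul d e f g : degle d f -> degle e g -> degle (d + e) (f * g).
Proof.
move=> Hf Hg m Hm; rewrite mcoeffM big1 // => -[[k1 h1] [k2 h2]] /= /eqP E.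
have [h|h] := ltnP d (mdeg k1); first by rewrite Hf // mul0r.
by rewrite (Hg k2) ?mulr0 //; move: Hm; rewrite E mdegD; lia.
Qed.

Lemma degle_exp d f i : degle d f -> degle (i * d) (f ^+ i).
Proof.
move=> H; elim: i => [|i IH]; last by rewrite exprS mulSn; apply: degle_mul.
by move=> m; rewrite expr0 mcoeff1 -mdeg_eq0; case: (mdeg m).
Qed.

Lemma kernel_ex r c (M : 'M[K]_(r, c)) : (c < r)%N -> exists2 v : 'rV_r, v != 0 & v *m M = 0.
Proof.
move=> cr; have : kermx M != 0.
  rewrite kermx_eq0 /row_free; apply: contraTneq cr => <-.
  by rewrite -leqNgt; exact: rank_leq_col.
move=> /matrix0Pn[i [j nz]]; exists (row i (kermx M)).
  by apply: contraNneq nz => /rowP/(_ j); rewrite !mxE => ->.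
by rewrite -row_mul mulmx_ker; apply/rowP => l; rewrite !mxE.
Qed.

(** Four polynomials in three variables are algebraically dependent: there are
    N^4 monomials in them with exponents below N, and these lie in a space of
    dimension O(N^3). *)
Lemma alg_dep (q : 'I_4 -> P3) : exists N (k : nat -> nat -> nat -> nat -> K),
  (exists a b c d, [/\ (a < N)%N, (b < N)%N, (c < N)%N & (d < N)%N] /\ k a b c d != 0) /\
  \sum_(a < N) q (inord 0) ^+ a * \sum_(b < N) q (inord 1) ^+ b *
    \sum_(c < N) q (inord 2) ^+ c * \sum_(d < N) q (inord 3) ^+ d * (k a b c d)%:MP = 0.
Proof.
pose e := \max_(i < 4) msize (q i).
have qd i : degle e (q i).
  move=> m em; apply: memN_msupp_eq0; apply: msize_mdeg_ge.
  by apply: leq_trans (ltnW em); apply: (leq_bigmax i).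
pose N := ((4 * e + 1) ^ 3).+1; pose D := (4 * (N * e)).+1.
pose I := ('I_N * 'I_N * 'I_N * 'I_N)%type; pose J := ('I_D * 'I_D * 'I_D)%type.
pose mon (t : I) := q (inord 0) ^+ t.1.1.1 * (q (inord 1) ^+ t.1.1.2 *
  (q (inord 2) ^+ t.1.2 * q (inord 3) ^+ t.2)).
have mond t : degle (4 * (N * e)) (mon t).
  have p1 i (j : 'I_N) : degle (N * e) (q i ^+ j).
    by apply: degleW (degle_exp (i := j) (qd i)); rewrite leq_mul2r ltnW ?orbT.
  rewrite (_ : 4 * (N * e) = N * e + (N * e + (N * e + N * e)))%N; last by lia.
  by do 3 apply: degle_mul => //.
pose mu (j : J) : 'X_{1..3} := (U_(ord0) *+ j.1.1 + (U_(inord 1) *+ j.1.2 + U_(inord 2) *+ j.2))%MM.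
pose M := \matrix_(i < #|{: I}|, j < #|{: J}|) (mon (enum_val i))@_(mu (enum_val j)).
have [|v v0 vM] := kernel_ex M.
  rewrite !card_prod !card_ord /D.
  have DN : ((4 * (N * e)).+1 <= N * (4 * e + 1))%N by rewrite /N; nia.
  apply: (@leq_ltn_trans ((N * (4 * e + 1)) * (N * (4 * e + 1)) * (N * (4 * e + 1)))%N).
    by rewrite !leq_mul.
  rewrite (_ : _ * _ * _ = N * N * N * ((4 * e + 1) ^ 3))%N; last by rewrite !expnS expn0; ring.
  by rewrite ltn_pmul2l ?muln_gt0.
have rel : \sum_(t : I) v 0 (enum_rank t) *: mon t = 0.
  apply/mpolyP => m; rewrite mcoeff0 raddf_sum /=.
  have [big|small] := ltnP (4 * (N * e)) (mdeg m).
    by apply: big1 => t _; rewrite mcoeffZ mond ?mulr0.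
  have hm i : (m i < D)%N.
    by rewrite ltnS; apply: leq_trans small; rewrite mdegE (bigD1 i) //= leq_addr.
  pose j : J := (Ordinal (hm ord0), Ordinal (hm (inord 1)), Ordinal (hm (inord 2))).
  have Em : mu j = m.
    by apply: mnm3P; rewrite /mu !mnmDE !mulmnE !mnm1E !jE /=; lia.
  have /rowP/(_ (enum_rank j)) := vM; rewrite !mxE => E; rewrite -[RHS]E.
  rewrite (reindex (@enum_val {: I} predT)) /=; last first.
    by apply: onW_bij; apply: enum_val_bij.
  by apply: eq_bigr => i _; rewrite mcoeffZ mxE enum_rankK Em enum_valK.
have N0 : (0 < N)%N by [].
pose k a b c d := v 0 (enum_rank ((inord a, inord b, inord c, inord d) : I)).
exists N, k; split.
  move: v0 => /matrix0Pn[z [i vi]]; rewrite (ord1 z) in vi.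
  exists (enum_val i).1.1.1, (enum_val i).1.1.2, (enum_val i).1.2, (enum_val i).2.
  split; first by split; apply: ltn_ord.
  by rewrite /k !inord_val -!surjective_pairing enum_valK.
rewrite -[RHS]rel; transitivity (\sum_(a < N) \sum_(b < N) \sum_(c < N) \sum_(d < N)
    v 0 (enum_rank ((a, b, c, d) : I)) *: mon (a, b, c, d)).
  apply: eq_bigr => a _; rewrite mulr_sumr; apply: eq_bigr => b _.
  rewrite !mulr_sumr; apply: eq_bigr => c _; rewrite !mulr_sumr.
  apply: eq_bigr => d _; rewrite /k !inord_val /mon /=.
  by rewrite [_ * _%:MP]mulrC mul_mpolyC -!scalerAr.
by rewrite !pair_bigA /=; apply: eq_bigr => -[[[a b] c] d] _.
Qed.

(** Let [p i] lie in the prime [c i.+1] of a chain [c] of length four, but not in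
    [c i]. In a relation between the [p i], written as a polynomial in [p 0] with
    coefficients in the others, the lowest coefficient lies in [c 1]; repeating
    this with [p 1], [p 2] and [p 3] puts a nonzero constant into [c 4]. *)
Section ChainBound.
Variables (O : comPzRingType) (pi : {rmorphism P3 -> O}).
Hypothesis pi_frac : forall u : O, exists w v p, w * v = 1 /\ u * w = pi p.
Implicit Types (q : set O) (x : O).

Lemma prime_unit q x y : is_prime q -> x * y = 1 -> ~ q x.
Proof. by move=> [[_ _ qM] q1 _] xy qx; apply: q1; rewrite -xy mulrC; apply: qM. Qed.

Lemma prime_exp q x i : is_prime q -> q (x ^+ i) -> q x.
Proof.
move=> [_ q1 qP]; elim: i => [|i IH]; first by rewrite expr0.
by rewrite exprS => /qP[].
Qed.

Lemma lowest_coef q q' N (F : nat -> O) x a : is_prime q -> is_prime q' -> q `<=` q' ->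
  ~ q x -> q' x -> (a < N)%N -> (forall b, (b < a)%N -> F b = 0) ->
  q (\sum_(b < N) x ^+ b * F b) -> q' (F a).
Proof.
move=> qp qp' sub nqx qx' aN F0 H.
have [_ _ qM] := qp; have [[_ qD' qM'] _ _] := qp'.
have E : \sum_(b < N) x ^+ b * F b =
    x ^+ a * (F a + x * \sum_(b < N | (a < b)%N) x ^+ (b - a.+1) * F b).
  rewrite (bigD1 (Ordinal aN)) //= mulrDr; congr (_ + _).
  rewrite !mulr_sumr (bigID (fun b : 'I_N => (a < b)%N)) /= [X in _ + X]big1 ?addr0.
    apply: eq_big => [b|b ab].
      by rewrite andb_idl // => ab; apply: contraTneq ab => ->; rewrite /= ltnn.
    move: ab => /andP[_ ab].
    by rewrite !mulrA -exprSr -exprD; congr (_ ^+ _ * _); lia.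
  move=> b /andP[ne nab]; rewrite F0 ?mulr0 //.
  by rewrite ltn_neqAle leqNgt nab andbT; apply: contra ne => /eqP ?; apply/eqP/val_inj.
move: H; rewrite E => /qM[/(prime_exp qp) //|/sub H].
rewrite -[F a](addrK (x * \sum_(b < N | (a < b)%N) x ^+ (b - a.+1) * F b)).
apply: qD' => //; have qI' : is_ideal q' by case: qp'.
by apply: (is_idealN qI'); rewrite mulrC; apply: qM'.
Qed.

Lemma chain_bound : ~ exists c : nat -> set O, prime_chain 4 c.
Proof.
move=> [c [cp cs]].
have ex i : (i < 4)%N -> exists p, ~ c i (pi p) /\ c i.+1 (pi p).
  move=> i4; have [sub nsub] := cs i i4.
  have [x [cx ncx]] : exists x, c i.+1 x /\ ~ c i x.
    by apply: contrapT => H; apply: nsub => x cx; apply: contrapT => ?; apply: H; exists x.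
  have [w [v [p [wv E]]]] := pi_frac x; exists p; rewrite -E.
  have [_ _ qM] := cp i (ltnW i4); have [[_ _ qM'] _ _] := cp i.+1 i4.
  split; last by rewrite mulrC; apply: qM'.
  by move=> /qM[//|]; apply: prime_unit wv; apply: cp; exact: ltnW.
have /choice[p Hp] (i : 'I_4) : exists p, ~ c i (pi p) /\ c i.+1 (pi p).
  exact: ex (ltn_ord i).
have [N [k [[a0 [b0 [c0 [d0 [[ha hb hc hd] nz]]]]] rel]]] := alg_dep p.
have P i (i4 : (i < 4)%N) : ~ c i (pi (p (inord i))) /\ c i.+1 (pi (p (inord i))).
  by have := Hp (inord i); rewrite inordK.
have cs' i : (i < 4)%N -> c i `<=` c i.+1 by move=> /cs[].
have cp' i : (i < 4)%N -> is_prime (c i) by move=> /ltnW/cp.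
pose F3 a b d e := (k a b d e)%:MP : P3.
pose F2 a b d := \sum_(e < N) p (inord 3) ^+ e * F3 a b d e.
pose F1 a b := \sum_(d < N) p (inord 2) ^+ d * F2 a b d.
pose F0 a := \sum_(b < N) p (inord 1) ^+ b * F1 a b.
have sumz (r : 'I_4) (F : nat -> P3) : (forall b, (b < N)%N -> F b = 0) ->
  \sum_(b < N) p r ^+ b * F b = 0.
  by move=> H; apply: big1 => b _; rewrite H ?mulr0.
have pis (r : 'I_4) (F : nat -> P3) : pi (\sum_(b < N) p r ^+ b * F b) =
    \sum_(b < N) pi (p r) ^+ b * pi (F b).
  by rewrite rmorph_sum; apply: eq_bigr => b _; rewrite rmorphM rmorphXn.
have H0 : c 0%N (pi (\sum_(b < N) p (inord 0) ^+ b * F0 b)).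
  by rewrite [X in pi X]rel rmorph0; have [[]] := cp 0%N isT.
have least (Q : nat -> Prop) (x : nat) : (x < N)%N -> Q x ->
    exists y, [/\ (y < N)%N, Q y & forall z, (z < y)%N -> ~ Q z].
  move=> xN Qx; have [y [yN Qy] miny] : exists2 y, (y < N)%N /\ Q y &
      forall z, (z < y)%N -> ~ ((z < N)%N /\ Q z) by apply: ex_least; exists x.
  by exists y; split=> // z zy Qz; apply: (miny z zy); split=> //; apply: ltn_trans zy yN.
have [a [aN [b1 [d1 [e1 [hb1 hd1 he1 nz1]]]] mina]] := least (fun a =>
  exists b d e, [/\ (b < N)%N, (d < N)%N, (e < N)%N & k a b d e != 0]) a0 ha
  (ex_intro _ b0 (ex_intro _ c0 (ex_intro _ d0 (And4 hb hc hd nz)))).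
have [b [bN [d2 [e2 [hd2 he2 nz2]]] minb]] := least (fun b =>
  exists d e, [/\ (d < N)%N, (e < N)%N & k a b d e != 0]) b1 hb1
  (ex_intro _ d1 (ex_intro _ e1 (And3 hd1 he1 nz1))).
have [d [dN [e3 [he3 nz3]] mind]] := least (fun d =>
  exists e, (e < N)%N /\ k a b d e != 0) d2 hd2 (ex_intro _ e2 (conj he2 nz2)).
have [e [eN nz4 mine]] := least (fun e => k a b d e != 0) e3 he3 nz3.
have z3 a' b' d' e' : (~ k a' b' d' e' != 0) -> F3 a' b' d' e' = 0.
  by move=> /negP; rewrite negbK /F3 => /eqP ->; rewrite mpolyC0.
have z0 z : (z < a)%N -> F0 z = 0.
  move=> za; apply: (sumz _ (F1 z)) => b' hb'; apply: (sumz _ (F2 z b')) => d' hd'.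
  apply: (sumz _ (F3 z b' d')) => e' he'; apply: z3 => nzz.
  by apply: (mina z za); exists b', d', e'.
have z1 z : (z < b)%N -> F1 a z = 0.
  move=> zb; apply: (sumz _ (F2 a z)) => d' hd'; apply: (sumz _ (F3 a z d')) => e' he'.
  by apply: z3 => nzz; apply: (minb z zb); exists d', e'.
have z2 z : (z < d)%N -> F2 a b z = 0.
  move=> zd; apply: (sumz _ (F3 a b z)) => e' he'; apply: z3 => nzz.
  by apply: (mind z zd); exists e'.
have step i r y (F : nat -> P3) : (i < 4)%N -> r = inord i -> (y < N)%N ->
    (forall z, (z < y)%N -> F z = 0) ->
    c i (pi (\sum_(b < N) p r ^+ b * F b)) -> c i.+1 (pi (F y)).
  move=> i4 -> yN F0' H; have [ni yi] := P i i4.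
  rewrite pis in H; apply: (lowest_coef (F := fun j => pi (F j)) _ _ (cs' i i4) ni yi yN _ H).
  - exact: cp'.
  - exact: cp.
  - by move=> z /F0' ->; rewrite rmorph0.
have H1 := step 0%N _ a F0 isT erefl aN z0 H0.
have H2 := step 1%N _ b (F1 a) isT erefl bN z1 H1.
have H3 := step 2%N _ d (F2 a b) isT erefl dN z2 H2.
have H4 : c 4%N (pi (F3 a b d e)).
  apply: (step 3%N _ e (F3 a b d) isT erefl eN _ H3) => z ze; apply: z3; exact: mine.
apply: (@prime_unit (c 4%N) (pi (F3 a b d e)) (pi (k a b d e)^-1%:MP)) => //.
  exact: cp.
by rewrite -rmorphM -mpolyCM mulfV // mpolyC1 rmorph1.
Qed.
End ChainBound.
End AlgebraicDependence.

(** * The local ring of P^3 at a closed point *)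

Lemma mpoly_hom_ext (K : fieldType) n (R : comNzRingType)
  (f g : {rmorphism {mpoly K[n]} -> R}) :
  (forall c, f c%:MP = g c%:MP) -> (forall i, f 'X_i = g 'X_i) -> f =1 g.
Proof.
move=> Hc HX q; rewrite [q]mpolyE !rmorph_sum; apply: eq_bigr => m _.
rewrite -mul_mpolyC !rmorphM /= Hc mpolyXE_id !rmorph_prod; congr (_ * _).
by apply: eq_bigr => i _; rewrite !rmorphXn /= HX.
Qed.

Lemma mmap_ext (K : fieldType) n (R : comNzRingType) (c : {rmorphism K -> R})
  (h : 'I_n -> R) (f : {rmorphism {mpoly K[n]} -> R}) :
  (forall a, f a%:MP = c a) -> (forall i, f 'X_i = h i) -> f =1 mmap c h.
Proof.
move=> Hc HX q; rewrite /mmap [q in LHS]mpolyE rmorph_sum; apply: eq_bigr => m _.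
rewrite -mul_mpolyC rmorphM Hc mpolyXE_id rmorph_prod; congr (_ * _).
by apply: eq_bigr => i _; rewrite rmorphXn /= HX.
Qed.

Lemma div_unique (F : fieldType) (x y z : F) : x != 0 -> y = x * z -> z = y / x.
Proof. by move=> x0 ->; rewrite mulrC mulKf. Qed.

Lemma div_cancel (F : fieldType) (x y z w : F) : x != 0 -> y != 0 ->
  z * (y / x) = w / x -> z = w / y.
Proof. by move=> x0 y0; rewrite mulrA => /(mulIf (invr_neq0 x0)) <-; rewrite mulfK. Qed.

Lemma mmap_homog (K : fieldType) n (R : comNzRingType) (c : {rmorphism K -> R})
  (h : 'I_n -> R) (a : R) d (f : {mpoly K[n]}) :
  f \is d.-homog -> mmap c (fun i => a * h i) f = a ^+ d * mmap c h f.
Proof.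
move=> /dhomogP hf; rewrite [in LHS](mpolyE f) [in RHS](mpolyE f) !raddf_sum mulr_sumr /=.
rewrite !big_seq; apply: eq_bigr => m mf.
rewrite !mmapZ !mmapX mulrCA; congr (_ * _); rewrite /mmap1 -(hf m mf) /= mdegE -prodrXr.
by rewrite -big_split; apply: eq_bigr => i _; rewrite exprMn.
Qed.

Section Stalk.
Variables (K : fieldType) (P : ppoint K) (i0 : 'I_4).
Local Notation S := {mpoly K[4]}.
Local Notation O := (stalk P).
Hypothesis Pi0 : ~ pt_ideal P 'X_i0.
Implicit Types (f g : S) (u : O).

Lemma pt_neq0 g : ~ pt_ideal P g -> tofrac g != 0 :> {fraction S}.
Proof.
have [[P0 _ _] _ _] := pt_prime P.
by move=> Pg; rewrite tofrac_eq0; apply: contra_notN Pg => /eqP ->.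
Qed.

Lemma pt_exp i : ~ pt_ideal P ('X_i0 ^+ i).
Proof. by move/(prime_exp (pt_prime P)). Qed.

Lemma pt_mul f g : ~ pt_ideal P f -> ~ pt_ideal P g -> ~ pt_ideal P (f * g).
Proof. by have [_ _ PM] := pt_prime P; move=> nf ng /PM[]. Qed.

Lemma X_homog i : ('X_i : S) \is 1.-homog.
Proof. by rewrite dhomogX /= mdeg1. Qed.

Lemma Xexp_homog i d : ('X_i ^+ d : S) \is d.-homog.
Proof. by have := dhomogMn d (X_homog i); rewrite mul1n. Qed.

Lemma C_homog (c : K) : (c%:MP : S) \is 0.-homog.
Proof. by rewrite -[_%:MP]mulr1 mul_mpolyC rpredZ // dhomog1. Qed.

Lemma local_fracP f g d : f \is d.-homog -> g \is d.-homog -> ~ pt_ideal P g ->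
  local_frac P (tofrac f / tofrac g).
Proof. by move=> hf hg Pg; apply/asboolP; exists d, f, g. Qed.

Definition germ f g d (hf : f \is d.-homog) (hg : g \is d.-homog)
  (Pg : ~ pt_ideal P g) : O := Sub (tofrac f / tofrac g) (local_fracP hf hg Pg).

Lemma germ_ex u : exists d f g, [/\ f \is d.-homog, g \is d.-homog, ~ pt_ideal P g
  & val u = tofrac f / tofrac g].
Proof. by case: u => u /= /asboolP. Qed.

Lemma stalk_const_is_zmod : zmod_morphism (stalk_const P).
Proof. by move=> c d; apply: val_inj; rewrite /= mpolyCB rmorphB. Qed.
Lemma stalk_const_is_monoid : monoid_morphism (stalk_const P).
Proof.
by split=> [|c d]; apply: val_inj; rewrite /= ?rmorph1 ?mpolyC1 ?rmorph1 // mpolyCM rmorphM.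
Qed.
HB.instance Definition _ := GRing.isZmodMorphism.Build _ _ (stalk_const P) stalk_const_is_zmod.
HB.instance Definition _ :=
  GRing.isMonoidMorphism.Build _ _ (stalk_const P) stalk_const_is_monoid.

Definition xs i : O := germ (X_homog i) (X_homog i0) Pi0.

Lemma xs_i0 : xs i0 = 1.
Proof. by apply: val_inj; rewrite /= divff // pt_neq0. Qed.

(** Dehomogenisation with respect to the coordinate [i0]. *)
Definition theta : S -> O := mmap (stalk_const P) xs.
HB.instance Definition _ := GRing.RMorphism.on theta.

Lemma val_theta d f : f \is d.-homog -> val (theta f) = tofrac f / tofrac 'X_i0 ^+ d.
Proof.
move=> hf; have x0 := pt_neq0 Pi0.
pose h : S -> {fraction S} := mmap (val \o stalk_const P) (val \o xs).
have -> : val (theta f) = h f.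
  pose vl : {rmorphism O -> {fraction S}} := val.
  rewrite /h /theta /mmap -[LHS]/(vl _) (rmorph_sum vl); apply: eq_bigr => m _.
  rewrite (rmorphM vl); congr (_ * _); rewrite /mmap1 (rmorph_prod vl).
  by apply: eq_bigr => i _; rewrite (rmorphXn vl).
pose vl : {rmorphism O -> {fraction S}} := val.
pose cc : {rmorphism K -> {fraction S}} := vl \o stalk_const P.
apply: (div_unique (expf_neq0 d x0)).
rewrite -[RHS](mmap_homog cc (val \o xs) (tofrac 'X_i0) hf).
apply: (mmap_ext (c := cc)) => // i.
by rewrite /= mulrC divfK.
Qed.

Lemma theta_X0 : theta 'X_i0 = 1.
Proof. by rewrite /theta mmapX mmap1U xs_i0. Qed.

Lemma theta_inj d f : f \is d.-homog -> theta f = 0 -> f = 0.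
Proof.
move=> hf /(congr1 val); rewrite (val_theta hf) => /eqP; rewrite mulf_eq0 invr_eq0.
by rewrite expf_eq0 (negPf (pt_neq0 Pi0)) andbF orbF tofrac_eq0 => /eqP.
Qed.

Lemma germ_theta u d f g : f \is d.-homog -> g \is d.-homog -> ~ pt_ideal P g ->
  val u = tofrac f / tofrac g -> u * theta g = theta f.
Proof.
move=> hf hg Pg E; apply: val_inj; rewrite rmorphM /= E (val_theta hg) (val_theta hf).
by rewrite mulrA divfK // pt_neq0.
Qed.

Lemma theta_unit d g : g \is d.-homog -> ~ pt_ideal P g -> exists y, theta g * y = 1.
Proof.
move=> hg Pg; exists (germ (Xexp_homog i0 d) hg Pg).
apply: val_inj; rewrite rmorphM /= (val_theta hg) rmorphXn.
by rewrite mulrA divfK ?expf_neq0 ?pt_neq0 // divff // pt_neq0.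
Qed.

(** This replaces the equation between fractions by one in the local ring. *)
Lemma stalk_idealP (I : set S) u : is_ideal I -> stalk_ideal I u <->
  exists d f g, [/\ I f, f \is d.-homog, g \is d.-homog, ~ pt_ideal P g
    & u * theta g = theta f].
Proof.
move=> II; split=> [[d [f [g [If hf hg Pg E]]]]|[d [f [g [If hf hg Pg E]]]]].
  by exists d, f, g; split=> //; exact: (germ_theta hf hg Pg E).
exists d, f, g; split=> //; move/(congr1 val): E; rewrite rmorphM /= (val_theta hg) (val_theta hf).
have x0 : tofrac 'X_i0 ^+ d != 0 :> {fraction S} by rewrite expf_neq0 ?pt_neq0.
exact: div_cancel x0 (pt_neq0 Pg).
Qed.

Lemma stalk_ideal_theta (I : set S) d f : is_ideal I -> f \is d.-homog -> I f ->
  @stalk_ideal _ I P (theta f).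
Proof.
move=> II hf If; apply/stalk_idealP => //; exists d, f, ('X_i0 ^+ d).
split=> //; [exact: Xexp_homog | exact: pt_exp |].
by rewrite rmorphXn /= theta_X0 expr1n mulr1.
Qed.

Lemma stalk_ideal_ideal (I : set S) : is_ideal I -> is_ideal (@stalk_ideal _ I P).
Proof.
move=> II; have [I0 ID IM] := II.
split=> [|u v /(stalk_idealP _ II)[d [f [g [If hf hg Pg E]]]]
   /(stalk_idealP _ II)[d' [f' [g' [If' hf' hg' Pg' E']]]]
   |a u /(stalk_idealP _ II)[d [f [g [If hf hg Pg E]]]]]; apply/stalk_idealP => //.
- exists 0%N, 0, 1; split=> //; rewrite ?dhomog0 ?dhomog1 //.
    by case: (pt_prime P).
  by rewrite rmorph0 mul0r.
- exists (d + d')%N, (g' * f + g * f'), (g * g'); split.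
  + by apply: ID; apply: IM.
  + by apply: rpredD; [rewrite addnC; apply: dhomogM | apply: dhomogM].
  + exact: dhomogM.
  + exact: pt_mul.
  + rewrite rmorphD !rmorphM mulrDl mulrA E [X in X + _]mulrC; congr (_ + _).
    by rewrite mulrCA E'.
- have [d' [f' [g' [hf' hg' Pg' Ea]]]] := germ_ex a.
  have E' := germ_theta hf' hg' Pg' Ea.
  exists (d' + d)%N, (f' * f), (g' * g); split.
  + exact: IM.
  + exact: dhomogM.
  + exact: dhomogM.
  + exact: pt_mul.
  + by rewrite !rmorphM mulrACA E' E.
Qed.

(** ** Primes of the stalk and homogeneous primes *)

(** The coefficients of [lam f] are the dehomogenised components of [f]. A prime
    of the local ring extends to a prime of the polynomial ring (Gauss), whose
    preimage by [lam] is the homogeneous prime of the corresponding point. *)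
Definition lam : S -> {poly O} :=
  mmap (polyC \o stalk_const P) (fun i => 'X * (xs i)%:P).
HB.instance Definition _ := GRing.RMorphism.on lam.

Lemma lam_homog d f : f \is d.-homog -> lam f = (theta f)%:P * 'X^d.
Proof.
move=> hf; rewrite /lam (mmap_homog _ _ _ hf) mulrC; congr (_ * _).
rewrite /theta /mmap rmorph_sum; apply: eq_bigr => m _.
rewrite rmorphM; congr (_ * _); rewrite /mmap1 rmorph_prod.
by apply: eq_bigr => i _; rewrite rmorphXn.
Qed.

Lemma coef_lam f d : (lam f)`_d = theta (pihomog mdeg d f).
Proof.
rewrite {1}(pihomog_partitionE (leqnn (msize f))) rmorph_sum coef_sum /=.
have z e : e != d -> (lam (pihomog mdeg e f))`_d = 0.
  move=> ne; rewrite (lam_homog (pihomogP _ _ _)) coefCM coefXn eq_sym (negPf ne).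
  by rewrite mulr0.
case: (ltnP d (msize f)) => [df|fd].
  rewrite (bigD1 (Ordinal df)) //= big1 ?addr0 => [|i ne].
    by rewrite (lam_homog (pihomogP _ _ _)) coefCM coefXn eqxx mulr1.
  by apply: z; apply: contra ne => /eqP E; apply/eqP/val_inj.
rewrite big1 => [|i _]; last by apply: z; have := ltn_ord i; lia.
suff -> : pihomog mdeg d f = 0 by rewrite rmorph0.
rewrite pihomogE big_seq_cond big1 // => m /andP[mf /eqP md].
by have := msize_mdeg_lt mf; rewrite md ltnNge fd.
Qed.

Lemma coef_prime (q : set O) (a b : {poly O}) : is_prime q ->
  (forall d, q (a * b)`_d) -> (forall d, q a`_d) \/ (forall d, q b`_d).
Proof.
move=> [[q0 qD qM] _ qP] H; apply: contrapT => /not_orP[/existsNP ea /existsNP eb].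
have [i nai mini] := ex_least ea; have [j nbj minj] := ex_least eb.
have := H (i + j)%N; rewrite coefM.
have hi : (i < (i + j).+1)%N by rewrite ltnS leq_addr.
rewrite (bigD1 (Ordinal hi)) //= addKn => Hq.
have qs (F : 'I_(i + j).+1 -> O) (R : pred _) : (forall l, R l -> q (F l)) -> q (\sum_(l | R l) F l).
  by move=> HF; elim/big_rec: _ => // l x Rl qx; apply: qD => //; apply: HF.
have : q (a`_i * b`_j).
  set s := \sum_(_ < _ | _) _ in Hq.
  rewrite -[_ * _](addrK s); apply: qD => //; rewrite -mulN1r; apply: (qM).
  apply: (qs) => l ne; have [li|il] := ltnP l i.
    by rewrite mulrC; apply: (qM); apply: contrapT => /(mini l li).
  apply: qM; apply: contrapT; apply: minj.
  have : (i != l)%N by apply: contra ne => /eqP E; apply/eqP/val_inj.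
  by have := ltn_ord l; lia.
by case/qP.
Qed.

Lemma prime_ppoint (q : set O) : is_prime q -> exists Q : ppoint K,
  forall f, pt_ideal Q f <-> forall d, q (theta (pihomog mdeg d f)).
Proof.
move=> qp; have [[q0 qD qM] q1 qP] := qp.
pose H : set S := [set f | forall d, q (lam f)`_d].
have Hhom : homogeneous_ideal H.
  split; last first.
    move=> f d Hf e; rewrite coef_lam; have [<-|ne] := eqVneq d e.
      by rewrite pihomog_id -coef_lam; apply: Hf.
    by rewrite (pihomog_ne0 ne (pihomogP _ _ _)) rmorph0.
  split=> [d|f g Hf Hg d|a f Hf d].
  - by rewrite rmorph0 coef0.
  - by rewrite rmorphD coefD; exact: (qD _ _ (Hf d) (Hg d)).
  - rewrite rmorphM coefM; elim/big_rec: _ => [|l x _ qx]; first exact: q0.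
    exact: (qD _ _ (qM _ _ (Hf _)) qx).
have Hp : is_prime H.
  split; first by case: Hhom.
    by move=> /(_ 0%N); rewrite rmorph1 coef1.
  by move=> f g Hfg; apply: (coef_prime qp) => d; rewrite -rmorphM; apply: Hfg.
have Hrel : exists i, ~ H 'X_i.
  exists i0 => /(_ 1%N); rewrite coef_lam (pihomog_dE (X_homog i0)) theta_X0.
  exact: q1.
exists (PPoint Hhom Hp Hrel) => f /=.
by split=> Hf d; have := Hf d; rewrite coef_lam.
Qed.

Lemma ppoint_homog (q : set O) (Q : ppoint K) : is_prime q ->
  (forall f, pt_ideal Q f <-> forall d, q (theta (pihomog mdeg d f))) ->
  forall d f, f \is d.-homog -> pt_ideal Q f <-> q (theta f).
Proof.
move=> [[q0 _ _] _ _] QE d f hf; rewrite QE; split=> [/(_ d)|qf e].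
  by rewrite pihomog_dE.
have [<-|ne] := eqVneq d e; first by rewrite pihomog_dE.
by rewrite (pihomog_ne0 ne hf) rmorph0.
Qed.

Lemma lies_on_stalk (q : set O) (Q : ppoint K) (I : set S) : is_prime q ->
  (forall f, pt_ideal Q f <-> forall d, q (theta (pihomog mdeg d f))) ->
  homogeneous_ideal I -> lies_on Q I <-> @stalk_ideal _ I P `<=` q.
Proof.
move=> qp QE [II IH]; have [[q0 qD qM] q1 qP] := qp; split=> [QI u|sub f If].
  move=> /(stalk_idealP _ II)[d [f [g [If hf hg Pg E]]]].
  have : q (u * theta g) by rewrite E; apply/(ppoint_homog qp QE hf); apply: QI.
  by have [y gy] := theta_unit hg Pg; case/qP => // /(prime_unit qp gy).
apply/QE => d; apply: sub; apply: stalk_ideal_theta => //; first exact: pihomogP.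
exact: IH.
Qed.

End Stalk.

Lemma cross_mul (F : fieldType) (x y z w : F) : y != 0 -> w != 0 -> x / y = z / w ->
  x * w = z * y.
Proof. by move=> y0 w0 /eqP; rewrite eqr_div // => /eqP. Qed.

Lemma frac_sub (F : fieldType) (x y z w : F) : y != 0 -> w != 0 ->
  x / y - z / w = (x * w - z * y) / (y * w).
Proof. by move=> y0 w0; rewrite -mulNr addf_div // mulNr. Qed.

Lemma tofrac_inj (D : idomainType) : injective (@tofrac D).
Proof. by move=> x y /eqP; rewrite tofrac_eq => /eqP. Qed.

Section ClosedPoint.
Variables (K : fieldType) (p : 'rV[K]_4) (hp : p != 0) (i0 : 'I_4).
Hypothesis pi0 : p 0 i0 != 0.
Local Notation S := {mpoly K[4]}.
Local Notation P := (cpoint hp).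
Local Notation O := (stalk P).
Local Notation M := (@nonunits O).
Implicit Types (f g : S) (u v : O) (i : 'I_4) (j : 'I_3).

Lemma cpoint_homog d f : f \is d.-homog -> pt_ideal P f <-> f.@[p 0] = 0.
Proof.
move=> hf; split=> [/(_ d)|f0 e]; first by rewrite pihomog_dE.
have [<-|ne] := eqVneq d e; first by rewrite pihomog_dE.
by rewrite (pihomog_ne0 ne hf) meval0.
Qed.

Lemma cpoint_X0 : ~ pt_ideal P 'X_i0.
Proof. by move/(cpoint_homog (X_homog _ i0)); rewrite mevalXU => /eqP; apply/negP. Qed.

Local Notation theta := (theta cpoint_X0).
Local Notation xs := (xs cpoint_X0).

(** Translation of [p] to the origin, in the affine chart where the coordinate
    [i0] is constant. *)
Definition shift i : {mpoly K[3]} := (p 0 i)%:MP + oapp (fun j => 'X_j) 0 (unlift i0 i).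
Definition delta : S -> {mpoly K[3]} := mmap (@mpolyC 3 K) shift.
HB.instance Definition _ := GRing.RMorphism.on delta.

Lemma delta_X i : delta 'X_i = shift i.
Proof. by rewrite /delta mmapX mmap1U. Qed.
Lemma delta_C c : delta c%:MP = c%:MP.
Proof. by rewrite /delta mmapC. Qed.

Definition locparam j : O :=
  stalk_const P (p 0 i0) * xs (fintype.lift i0 j) - stalk_const P (p 0 (fintype.lift i0 j)).
Definition of_poly : {mpoly K[3]} -> O := mmap (stalk_const P) locparam.
HB.instance Definition _ := GRing.RMorphism.on of_poly.

Lemma of_poly_X j : of_poly 'X_j = locparam j.
Proof. by rewrite /of_poly mmapX mmap1U. Qed.
Lemma of_poly_C c : of_poly c%:MP = stalk_const P c.
Proof. by rewrite /of_poly mmapC. Qed.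

Lemma of_poly_delta d f : f \is d.-homog ->
  of_poly (delta f) = stalk_const P (p 0 i0) ^+ d * theta f.
Proof.
move=> hf; rewrite -(mmap_homog _ xs _ hf).
pose od : {rmorphism S -> O} := of_poly \o delta.
apply: (mmap_ext (c := stalk_const P) (f := od)) => [c|i] /=.
  by rewrite delta_C of_poly_C.
rewrite delta_X /shift rmorphD /= of_poly_C.
case: unliftP => [j|] -> /=.
  by rewrite of_poly_X /locparam [LHS]addrC subrK.
by rewrite rmorph0 addr0 xs_i0 mulr1.
Qed.

Lemma delta0 f : (delta f)@_0 = f.@[p 0].
Proof.
pose od : {rmorphism S -> K} := mcoeff 0%MM \o delta.
apply: (mmap_ext (c := idfun) (f := od)) => [c|i] /=.
  by rewrite delta_C mcoeffC eqxx mulr1.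
rewrite delta_X /shift mcoeffD mcoeffC eqxx mulr1.
case: unliftP => [j|] _ /=; last by rewrite mcoeff0 addr0.
by rewrite mcoeffX mnm1_eq0 addr0.
Qed.

Definition taylor : S -> fps K 3 := @fps_of K 3 \o delta.
HB.instance Definition _ := GRing.RMorphism.on taylor.

Lemma taylor_X i : taylor 'X_i = fps_of (shift i).
Proof. by congr (fps_of _); apply: delta_X. Qed.
Lemma taylor_C c : taylor c%:MP = fps_const c.
Proof. by rewrite -fps_ofC; congr (fps_of _); apply: delta_C. Qed.

Lemma taylor0 f : taylor f 0%MM = f.@[p 0].
Proof. exact: delta0. Qed.

Lemma taylor_unit d g : g \is d.-homog -> ~ pt_ideal P g -> taylor g \is a GRing.unit.
Proof. by move=> hg Pg; rewrite fps_unitE taylor0; apply/eqP => /(cpoint_homog hg). Qed.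

(** The quotient of Taylor series depends only on the germ. *)
Lemma tau_ex u : exists F, forall d f g, f \is d.-homog -> g \is d.-homog -> ~ pt_ideal P g ->
  val u = tofrac f / tofrac g -> F * taylor g = taylor f.
Proof.
have [d [f [g [hf hg Pg E]]]] := germ_ex u; exists (taylor f / taylor g).
move=> d' f' g' hf' hg' Pg'; rewrite E => /(cross_mul (pt_neq0 Pg) (pt_neq0 Pg')).
rewrite -!(rmorphM (@tofrac S)) => /tofrac_inj E'.
have ug := taylor_unit hg Pg; apply: (mulIr ug).
by rewrite mulrAC (divrK ug) -!(rmorphM taylor) E'.
Qed.

Definition tau u : fps K 3 := projT1 (cid (tau_ex u)).

Lemma tauE u d f g : f \is d.-homog -> g \is d.-homog -> ~ pt_ideal P g ->
  val u = tofrac f / tofrac g -> tau u * taylor g = taylor f.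
Proof. exact: (projT2 (cid (tau_ex u))). Qed.

Lemma tau_is_zmod : zmod_morphism tau.
Proof.
move=> u v; have [d [f [g [hf hg Pg E]]]] := germ_ex u.
have [d' [f' [g' [hf' hg' Pg' E']]]] := germ_ex v.
have ug := taylor_unit hg Pg; have ug' := taylor_unit hg' Pg'.
have hB : f * g' - f' * g \is (d + d').-homog.
  by apply: rpredB; [exact: dhomogM | rewrite addnC; exact: dhomogM].
have hM := dhomogM hg hg'; have PM := pt_mul Pg Pg'.
apply: (mulIr (taylor_unit hM PM)); rewrite (tauE hB hM PM); last first.
  rewrite (rmorphB (@tofrac S)) !(rmorphM (@tofrac S)) -(frac_sub _ _ (pt_neq0 Pg) (pt_neq0 Pg')).
  by rewrite -E -E'.
rewrite mulrBl rmorphB !rmorphM mulrA (tauE hf hg Pg E); congr (_ - _).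
by rewrite [X in tau v * X]mulrC mulrA (tauE hf' hg' Pg' E').
Qed.

Lemma tau_is_monoid : monoid_morphism tau.
Proof.
have P1 : ~ pt_ideal P 1 by case: (pt_prime P).
split=> [|u v].
  have := @tauE 1 0%N 1 1 (dhomog1 _ _) (dhomog1 _ _) P1.
  by rewrite (rmorph1 taylor) mulr1; apply; rewrite (rmorph1 (@tofrac S)) divr1.
have [d [f [g [hf hg Pg E]]]] := germ_ex u.
have [d' [f' [g' [hf' hg' Pg' E']]]] := germ_ex v.
have hM := dhomogM hg hg'; have PM := pt_mul Pg Pg'.
apply: (mulIr (taylor_unit hM PM)); rewrite (tauE (dhomogM hf hf') hM PM).
  by rewrite !rmorphM mulrACA (tauE hf hg Pg E) (tauE hf' hg' Pg' E').
by rewrite !(rmorphM (@tofrac S)) -mulf_div -E -E'.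
Qed.
HB.instance Definition _ := GRing.isZmodMorphism.Build _ _ tau tau_is_zmod.
HB.instance Definition _ := GRing.isMonoidMorphism.Build _ _ tau tau_is_monoid.

Lemma tau_theta d f : f \is d.-homog -> fps_const (p 0 i0) ^+ d * tau (theta f) = taylor f.
Proof.
move=> hf; have E := @tauE (theta f) d f _ hf (Xexp_homog _ i0 d) (@pt_exp _ _ _ cpoint_X0 d).
rewrite -E; last by rewrite (val_theta _ hf) (rmorphXn (@tofrac S)).
rewrite mulrC (rmorphXn taylor); congr (_ * _ ^+ _).
by rewrite [RHS]taylor_X /shift unlift_none /= addr0 fps_ofC.
Qed.

Lemma tau_const c : tau (stalk_const P c) = fps_const c.
Proof.
have P1 : ~ pt_ideal P 1 by case: (pt_prime P).
have := @tauE (stalk_const P c) 0%N c%:MP 1 (C_homog c) (dhomog1 _ _) P1.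
rewrite (rmorph1 taylor) mulr1 => ->; last by rewrite (rmorph1 (@tofrac S)) divr1.
exact: taylor_C.
Qed.

Lemma tau_of_poly q : tau (of_poly q) = fps_of q.
Proof.
pose f1 : {rmorphism {mpoly K[3]} -> fps K 3} := tau \o of_poly.
apply: (@mpoly_hom_ext K 3 _ f1 (@fps_of K 3)) => [c|j] /=.
  by rewrite of_poly_C tau_const fps_ofC.
rewrite of_poly_X /locparam rmorphB rmorphM /= !tau_const -fps_varE.
have := tau_theta (X_homog K (fintype.lift i0 j)); rewrite expr1.
rewrite /theta mmapX mmap1U => ->.
by rewrite [taylor _]taylor_X /shift liftK /= rmorphD /= fps_ofC addrC addKr fps_varE.
Qed.

Lemma stalk_const_unit (c : K) : c != 0 -> stalk_const P c * stalk_const P c^-1 = 1.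
Proof. by move=> c0; rewrite -rmorphM divff // rmorph1. Qed.

(** Up to a unit, germs are polynomials in the local parameters. *)
Lemma germ_of_poly u : exists w v q, [/\ w * v = 1 :> O & u * w = of_poly q].
Proof.
have [d [f [g [hf hg Pg E]]]] := germ_ex u.
have [y gy] := theta_unit cpoint_X0 hg Pg.
exists (of_poly (delta g)), (stalk_const P (p 0 i0)^-1 ^+ d * y), (delta f).
rewrite (of_poly_delta hf) (of_poly_delta hg); split; last first.
  by rewrite mulrCA (germ_theta cpoint_X0 hf hg Pg E).
by rewrite mulrACA gy mulr1 -exprMn stalk_const_unit // expr1n.
Qed.

Lemma tau_nonunit u : M u <-> ford 1 (tau u).
Proof.
split=> [Mu|F [v uv]]; last first.
  have := fordMr (tau v) F; rewrite -rmorphM uv rmorph1 => /ford1E/eqP.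
  by rewrite fps1 eqxx oner_eq0.
have [d [f [g [hf hg Pg E]]]] := germ_ex u.
have Pf : pt_ideal P f.
  apply: contrapT => Pf; apply: Mu; have [y fy] := theta_unit cpoint_X0 hf Pf.
  exists (theta g * y); by rewrite mulrA (germ_theta cpoint_X0 hf hg Pg E).
have ug := taylor_unit hg Pg; rewrite -[tau u](mulrK ug); apply: fordMr.
by rewrite (tauE hf hg Pg E); apply/ford1E; rewrite taylor0; apply/(cpoint_homog hf).
Qed.

Lemma of_poly_pow k (m : 'X_{1..3}) : (k <= mdeg m)%N -> ideal_pow M k (of_poly 'X_[m]).
Proof.
elim: k m => [|k IH] m km //; have [j mj] : exists j, (0 < m j)%N.
  apply: contrapT => H; move: km; rewrite mdegE big1 // => j _.
  by apply/eqP; rewrite -leqn0 leqNgt; apply/negP => ?; apply: H; exists j.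
have mE : m = (U_(j) + (m - U_(j)))%MM by rewrite addmC submK // lep1mP -lt0n.
rewrite mE mpolyXD rmorphM; apply: sub_ideal_span.
exists (of_poly 'X_j), (of_poly 'X_[m - U_(j)]); split=> //.
  apply/tau_nonunit; rewrite tau_of_poly -fps_varE; exact: ford_var.
by apply: IH; move: km; rewrite {1}mE mdegD mdeg1.
Qed.

Lemma tau_pow k u : ideal_pow M k u <-> ford k (tau u).
Proof.
split; first elim: k u => [|k IH] u //.
  apply: (ideal_span_sub (I := [set u | ford k.+1 (tau u)])).
    split=> /= [|x y Hx Hy|a x Hx]; rewrite ?rmorph0 ?rmorphD ?rmorphM.
    - exact: ford_zero.
    - exact: fordD.
    - exact: fordMl.
  move=> _ [x [y [/tau_nonunit Hx /IH Hy ->]]] /=; rewrite rmorphM -[k.+1]add1n.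
  exact: fordM.
have [w [v [q [wv E]]]] := germ_of_poly u => F.
have [J0 JD JM] := is_ideal_pow M k.
rewrite -[u]mulr1 -wv mulrA E mulrC; apply: (JM).
have Fq : ford k (fps_of q) by rewrite -tau_of_poly -E rmorphM; apply: fordMr.
rewrite [q]mpolyE rmorph_sum; elim/big_rec: _ => // m x _ Hx; apply: (JD) => //.
rewrite -mul_mpolyC rmorphM; have [km|mk] := leqP k (mdeg m).
  by apply: (JM); apply: of_poly_pow.
have -> : q@_m = 0 by exact: Fq.
by rewrite mpolyC0 rmorph0 mul0r.
Qed.

Lemma tau_coords : coords (stalk_const P) tau.
Proof.
split; [exact: tau_const | exact: tau_pow | move=> F k].
exists (of_poly (fps_trunc k F)); rewrite tau_of_poly; apply: fordBC.
exact: fps_of_trunc.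
Qed.

Lemma tau_inj u : tau u = 0 -> u = 0.
Proof.
have [w [v [q [wv E]]]] := germ_of_poly u => F.
have : fps_of q = 0 by rewrite -tau_of_poly -E rmorphM /= F mul0r.
move=> q0; have -> : u = u * w * v by rewrite -mulrA wv mulr1.
rewrite E (_ : q = 0) ?rmorph0 ?mul0r //; apply/mpolyP => m.
by rewrite mcoeff0 -[LHS]/(fps_of q m) q0 fps0.
Qed.

Lemma stalk_dim3 : ~ exists c : nat -> set O, prime_chain 4 c.
Proof.
apply: (@chain_bound K O of_poly) => u.
by have [w [v [q [wv E]]]] := germ_of_poly u; exists w, v, q.
Qed.

End ClosedPoint.

(** * Multiplicity as a length at the generic point *)

Section Length.
Variables (L : comPzRingType) (x : L) (k : nat).
Hypothesis xk : x ^+ k = 0.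
Hypothesis xj : forall j, (j < k)%N -> x ^+ j <> 0.
Hypothesis uniformizer : forall l : L, l = 0 \/ exists i v w, v * w = 1 /\ l = x ^+ i * v.
Implicit Types (I J : set L).

(** Every ideal is generated by a power of [x]; this is the least exponent. *)
Lemma ideal_exponent I : is_ideal I -> exists i, [/\ (i <= k)%N, I (x ^+ i)
  & forall l, I l -> exists y, l = x ^+ i * y].
Proof.
move=> [I0 ID IM]; have [|i Ii mini] := @ex_least (fun i => I (x ^+ i)).
  by exists k; rewrite xk.
exists i; split=> // [|l Il].
  by rewrite leqNgt; apply/negP => /mini; rewrite xk; apply.
have [->|[j [v [w [vw E]]]]] := uniformizer l; first by exists 0; rewrite mulr0.
have [ij|ji] := leqP i j; first by exists (x ^+ (j - i) * v); rewrite mulrA -exprD subnKC.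
case: (mini j ji); rewrite (_ : x ^+ j = w * l); first exact: IM.
by rewrite E mulrCA [w * v]mulrC vw mulr1.
Qed.

Lemma exponent_lt I J i j : is_ideal J -> I `<` J ->
  I (x ^+ i) -> (forall l, J l -> exists y, l = x ^+ j * y) -> is_ideal I -> (j < i)%N.
Proof.
move=> JI [_ nJI] Ii Jj [_ _ IM]; rewrite ltnNge; apply/negP => ij; apply: nJI => l /Jj[y ->].
by rewrite mulrC; apply: (IM); rewrite -(subnK ij) exprD; apply: IM.
Qed.

Lemma chain_le r (c : nat -> set L) : ideal_chain r c -> (r <= k)%N.
Proof.
move=> [cI cs]; suff H i : (i <= r)%N -> exists j, [/\ (j + i <= k)%N,
    c i (x ^+ j) & forall l, c i l -> exists y, l = x ^+ j * y].
  by have [j [jk _ _]] := H r (leqnn r); apply: leq_trans jk; apply: leq_addl.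
elim: i => [|i IH] ir.
  by have [j [jk ? ?]] := ideal_exponent (cI 0%N ir); exists j; rewrite addn0.
have [j [jk cj _]] := IH (ltnW ir).
have [j' [j'k cj' cgen]] := ideal_exponent (cI i.+1 ir); exists j'; split=> //.
have := exponent_lt (cI i.+1 ir) (cs i ir) cj cgen (cI i (ltnW ir)); lia.
Qed.

Lemma chain_powers : exists c : nat -> set L, ideal_chain k c.
Proof.
exists (fun i => [set l | exists y, l = x ^+ (k - i) * y]); split=> i ik.
  split=> [|_ _ [y ->] [z ->]|a _ [y ->]]; first by exists 0; rewrite mulr0.
  - by exists (y + z); rewrite mulrDr.
  - by exists (a * y); rewrite mulrCA.
have E : (k - i = (k - i.+1).+1)%N by lia.
split=> [_ [y ->]|sub]; first by exists (x * y); rewrite E exprSr mulrA.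
have [y Ey] := sub (x ^+ (k - i.+1)) (ex_intro _ 1 (esym (mulr1 _))).
apply: (@xj (k - i.+1)); first by lia.
suff it e : x ^+ (k - i.+1) = x ^+ (k - i.+1 + e) * y ^+ e.
  by rewrite (it k) addnC exprD xk mul0r mul0r.
elim: e => [|e IH]; first by rewrite addn0 mulr1.
by rewrite {1}IH exprD {1}Ey E addnS !exprS exprD; ring.
Qed.

Lemma length_unique r : ring_length L r -> r = k.
Proof.
move=> [[c /chain_le rk] nr]; apply/eqP; rewrite eqn_leq rk leqNgt; apply/negP => kr.
have [d [dI ds]] := chain_powers; apply: nr; exists d; split=> i ir.
  by apply: dI; apply: leq_trans kr.
by apply: ds; apply: leq_trans kr.
Qed.
End Length.

(** Localisation at a prime [C] which, modulo [T], is principal up to [C]-units. *)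
Section LocalizedLength.
Variables (A B : comPzRingType) (j : {rmorphism A -> B}).
Variables (C T Z : set A) (J : set B) (u : A) (k : nat).
Hypothesis Cp : is_prime C.
Hypothesis JI : is_ideal J.
Hypothesis unit_out : forall s, ~ C s -> exists y, j s * y = 1.
Hypothesis frac : forall b, exists s a, ~ C s /\ b * j s = j a.
Hypothesis JE : forall a, J (j a) <-> exists2 s, ~ C s & Z (s * a).
Hypothesis divT : forall f, ~ T f -> exists i g t, [/\ T t, ~ C g & f = u ^+ i * g + t].
Hypothesis TZ : T `<=` Z.
Hypothesis Zk : Z (u ^+ k).
Hypothesis nZ : forall i s, (i < k)%N -> ~ C s -> ~ Z (s * u ^+ i).

Lemma localized_length r : ring_length (rquot J) r -> r = k.
Proof.
have [_ C1 _] := Cp; have [J0 JD JM] := JI.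
have ZJ a : Z a -> J (j a) by move=> Za; apply/JE; exists 1 => //; rewrite mul1r.
have X i : rproj J (j u) ^+ i = rproj J (j (u ^+ i)) by rewrite !rmorphXn.
have r0 b : rproj J b = 0 <-> J b.
  by rewrite -(rmorph0 (@rproj _ J)) (rproj_eqI JI) subr0.
apply: (@length_unique _ (rproj J (j u))) => [|i ik|l].
- by rewrite X; apply/r0/ZJ.
- by rewrite X => /r0/JE[s nCs]; apply: nZ.
rewrite -[l]rproj_surj; set b := repr l; have [s [a [nCs E]]] := frac b.
have [y sy] := unit_out nCs; have -> : b = j a * y by rewrite -E -mulrA sy mulr1.
have [Ta|/divT[i [g [t [Tt nCg Ea]]]]] := pselect (T a).
  by left; apply/r0; rewrite mulrC; apply: (JM); apply: ZJ; apply: TZ.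
have [z gz] := unit_out nCg; right.
exists i, (rproj J (j g * y)), (rproj J (j s * z)); split.
  by rewrite -rmorphM mulrACA [y * z]mulrC mulrACA gz sy mulr1 rmorph1.
rewrite X -rmorphM; apply/(rproj_eqI JI).
rewrite (_ : _ - _ = y * j t); first by apply: (JM); apply: ZJ; apply: TZ.
by rewrite Ea rmorphD rmorphM; ring.
Qed.
End LocalizedLength.

Lemma div_flip (F : fieldType) (x y : F) : x != 0 -> y != 0 -> y / x * (x / y) = 1.
Proof. by move=> x0 y0; rewrite mulrA divfK // divff. Qed.

Lemma div_chain (F : fieldType) (x y z : F) : y != 0 -> x / y * (y / z) = x / z.
Proof. by move=> y0; rewrite mulrA divfK. Qed.

Section Specialization.
Variables (K : fieldType) (P : ppoint K) (i0 : 'I_4).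
Local Notation S := {mpoly K[4]}.
Local Notation O := (stalk P).
Hypothesis Pi0 : ~ pt_ideal P 'X_i0.
Local Notation theta := (theta Pi0).
Implicit Types (f g : S) (I Z : set S).

Lemma ideal_homog_sum I f : is_ideal I -> (forall d, I (pihomog mdeg d f)) -> I f.
Proof.
move=> [I0 ID _] H; rewrite (pihomog_partitionE (leqnn (msize f))).
by elim/big_rec: _ => // d x _ Ix; apply: ID.
Qed.

Lemma theta_val u d f g : f \is d.-homog -> g \is d.-homog -> g != 0 ->
  u * theta g = theta f -> val u = tofrac f / tofrac g.
Proof.
move=> hf hg g0 /(congr1 val); rewrite rmorphM /= (val_theta _ hg) (val_theta _ hf).
have x0 := expf_neq0 d (pt_neq0 Pi0).
have y0 : tofrac g != 0 :> {fraction S} by rewrite tofrac_eq0.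
exact: div_cancel x0 y0.
Qed.

(** The point [Q] of the prime [C] of the local ring at [P]. *)
Variables (C : set O) (Q : ppoint K).
Hypothesis Cp : is_prime C.
Hypothesis QE : forall f, pt_ideal Q f <-> forall d, C (theta (pihomog mdeg d f)).

Let Qh d f : f \is d.-homog -> pt_ideal Q f <-> C (theta f).
Proof. exact: ppoint_homog. Qed.

Lemma specializes f : pt_ideal Q f -> pt_ideal P f.
Proof.
move=> /QE Qf; apply: ideal_homog_sum => [|d]; first by case: (pt_prime P).
apply: contrapT => /(theta_unit Pi0 (pihomogP _ _ _))[y fy].
exact: prime_unit Cp fy (Qf d).
Qed.

Lemma local_frac_sub u : local_frac P u -> local_frac Q u.
Proof.
move=> /asboolP[d [f [g [hf hg Pg E]]]]; apply/asboolP; exists d, f, g; split=> //.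
by move/specializes.
Qed.

(** The localisation map from [P] to the more general point [Q]. *)
Definition generize (u : O) : stalk Q := Sub (val u) (local_frac_sub (valP u)).

Lemma generize_is_zmod : zmod_morphism generize.
Proof. by move=> u v; apply: val_inj. Qed.
Lemma generize_is_monoid : monoid_morphism generize.
Proof. by split=> [|u v]; apply: val_inj. Qed.
HB.instance Definition _ := GRing.isZmodMorphism.Build _ _ generize generize_is_zmod.
HB.instance Definition _ := GRing.isMonoidMorphism.Build _ _ generize generize_is_monoid.

Lemma Q_X0 : ~ pt_ideal Q 'X_i0.
Proof. by move/specializes. Qed.

Lemma num_notin u d f g : ~ C u -> f \is d.-homog -> u * theta g = theta f ->
  (exists y, theta g * y = 1) -> ~ pt_ideal Q f.
Proof.
move=> nCu hf E [y gy] /(Qh hf); rewrite -E; have [_ _ CP] := Cp.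
by case/CP => //; apply: (prime_unit Cp gy).
Qed.

Lemma generize_unit u : ~ C u -> exists y, generize u * y = 1.
Proof.
move=> nCu; have [d [f [g [hf hg Pg E]]]] := germ_ex u.
have Qf := num_notin nCu hf (germ_theta Pi0 hf hg Pg E) (theta_unit Pi0 hg Pg).
exists (germ hg hf Qf); apply: val_inj; rewrite (rmorphM val) /= E.
exact: (div_flip (pt_neq0 Pg) (pt_neq0 Qf)).
Qed.

Lemma generize_frac b : exists s a, ~ C s /\ b * generize s = generize a.
Proof.
have [d [f [g [hf hg Qg E]]]] := germ_ex b.
exists (theta g), (theta f); split; first by move/(Qh hg).
apply: val_inj; rewrite (rmorphM val) /= E (val_theta _ hg) (val_theta _ hf).
exact: (div_chain _ _ (pt_neq0 Qg)).
Qed.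

Lemma generize_ideal Z a : is_ideal Z ->
  stalk_ideal Z (generize a) <-> exists2 s, ~ C s & stalk_ideal Z (s * a).
Proof.
move=> ZI; have [_ _ ZM] := ZI; split.
  move=> [d [f [g [Zf hf hg Qg E]]]]; exists (theta g); first by move/(Qh hg).
  suff -> : theta g * a = theta f by apply: stalk_ideal_theta hf Zf.
  apply: val_inj; rewrite (rmorphM val) /= -[val a]/(val (generize a)) E.
  rewrite (val_theta _ hg) (val_theta _ hf).
  by rewrite mulrC; exact: (div_chain _ _ (pt_neq0 Qg)).
move=> [s nCs /(stalk_idealP Pi0 _ ZI)[d [f [g [Zf hf hg Pg E]]]]].
have [d' [f' [g' [hf' hg' Pg' Es]]]] := germ_ex s.
have Es' := germ_theta Pi0 hf' hg' Pg' Es.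
have Qf' := num_notin nCs hf' Es' (theta_unit Pi0 hg' Pg').
have Qfg : ~ pt_ideal Q (f' * g) by apply: pt_mul => //; move/specializes.
exists (d' + d)%N, (g' * f), (f' * g); split=> //.
- exact: ZM.
- exact: dhomogM.
- exact: dhomogM.
apply: theta_val; [exact: dhomogM hg' hf | exact: dhomogM hf' hg | |].
  by apply: contra_notN Qfg => /eqP ->; case: (pt_prime Q) => -[].
by rewrite !rmorphM /= -Es' -E [RHS]mulrCA !mulrA [s * a]mulrC.
Qed.

(** Homogeneous primes between the ideal of the curve and [Q] agree with [Q],
    because an element of [Q] lies in the ideal of the curve after multiplication
    by a form that does not vanish at [P]. *)
Lemma generic_of_stalk I : homogeneous_ideal I -> C = @stalk_ideal _ I P ->
  generic_point Q I.
Proof.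
move=> Ih CE; have [II _] := Ih; split.
  by apply/(lies_on_stalk Cp QE Ih); rewrite CE.
move=> Q' Q'I sub; apply/seteqP; split=> // f /QE Qf.
have [Q'Ideal _ Q'P] := pt_prime Q'.
apply: ideal_homog_sum => // d; move: (Qf d).
set fd := pihomog mdeg d f; have hfd : fd \is d.-homog by exact: pihomogP.
rewrite CE => /(stalk_idealP Pi0 _ II)[e [h [g [Ih' hh hg Pg E]]]].
have E' : fd * g = h * 'X_i0 ^+ d.
  apply/eqP; rewrite -subr_eq0; apply/eqP; apply: (theta_inj (Pi0 := Pi0) (d := d + e)).
    apply: rpredB; first exact: dhomogM.
    by rewrite addnC; apply: dhomogM => //; apply: Xexp_homog.
  by rewrite rmorphB !rmorphM rmorphXn /= theta_X0 expr1n mulr1 E subrr.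
have : pt_ideal Q' (fd * g).
  by rewrite E' mulrC; have [_ _ M'] := Q'Ideal; apply: (M'); apply: Q'I.
by case/Q'P => // /sub/specializes.
Qed.

(** At the generic point of the curve [u] becomes a uniformiser, so the length is
    the exponent of [u] in the ideal of the multiplicity structure. *)
Lemma multiplicity_length I Z (T : set O) (u : O) k m : homogeneous_ideal I ->
  C = @stalk_ideal _ I P -> is_ideal Z ->
  (forall R, generic_point R I -> ring_length (local_ring Z R) m) ->
  (forall f : O, ~ T f -> exists i (g : O) t, [/\ T t, ~ C g & f = u ^+ i * g + t]) ->
  T `<=` @stalk_ideal _ Z P -> @stalk_ideal _ Z P (u ^+ k) ->
  (forall i s, (i < k)%N -> ~ C s -> ~ @stalk_ideal _ Z P (s * u ^+ i)) -> m = k.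
Proof.
move=> Ih CE ZI H divT TZ Zk nZ; have := H Q (generic_of_stalk Ih CE).
apply: (@localized_length _ _ generize C T (@stalk_ideal _ Z P) _ u k) => //.
- by apply: stalk_ideal_ideal Q_X0 _ ZI.
- exact: generize_unit.
- exact: generize_frac.
- by move=> a; apply: generize_ideal.
Qed.
End Specialization.

(** * The local equations of the configuration *)

Section Derivation.
Variables (K : fieldType) (N : nat) (q : 'I_N -> K).
Local Notation S := {mpoly K[N]}.

(** By the Leibniz rule the polynomials for which the formula holds form a
    subalgebra. *)
Lemma derivation_ext (D : S -> K) :
  (forall f g, D (f + g) = D f + D g) -> (forall c, D c%:MP = 0) ->
  (forall f g, D (f * g) = f.@[q] * D g + D f * g.@[q]) ->
  forall f, D f = \sum_i D 'X_i * (f^`M(i)).@[q].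
Proof.
move=> DD DC DM; pose E (f : S) := D f = \sum_i D 'X_i * (f^`M(i)).@[q].
have EC c : E c%:MP.
  by rewrite /E DC big1 // => i _; rewrite mderivC meval0 mulr0.
have EX i : E 'X_i.
  have UU : (U_(i) - U_(i))%MM = 0%MM :> 'X_{1..N} by apply/mnmP => j; rewrite mnmBE subnn mnm0E.
  rewrite /E (bigD1 i) //= mderivX mnm1E eqxx UU mpolyX0 scale1r meval1 mulr1.
  rewrite big1 ?addr0 // => j ji; rewrite mderivX mnm1E eq_sym (negPf ji) scale0r.
  by rewrite meval0 mulr0.
have EM f g : E f -> E g -> E (f * g).
  rewrite /E => Ef Eg; rewrite DM Ef Eg mulr_sumr mulr_suml -big_split /=.
  by apply: eq_bigr => i _; rewrite mderivM mevalD !mevalM; ring.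
move=> f; rewrite -/(E f) [f]mpolyE; elim/big_rec: _ => [|m g _ Eg].
  by rewrite -mpolyC0; apply: EC.
have : E (f@_m *: 'X_[m]).
  rewrite -mul_mpolyC; apply: (EM) => //; rewrite mpolyXE_id.
  elim/big_rec: _ => [|i h _]; first by rewrite -mpolyC1; apply: EC.
  apply: (EM); elim: (m i) => [|e IH]; first by rewrite expr0 -mpolyC1; apply: EC.
  by rewrite exprS; apply: (EM).
rewrite /E => Em; rewrite DD Em Eg -big_split /=; apply: eq_bigr => i _.
by rewrite mderivD mevalD mulrDr.
Qed.
End Derivation.

Lemma fpsM_U (K : fieldType) n (F G : fps K n) (j : 'I_n) :
  (F * G) U_(j)%MM = F 0%MM * G U_(j)%MM + F U_(j)%MM * G 0%MM.
Proof.
have H : ford 2 ((F - fps_const (F 0%MM)) * (G - fps_const (G 0%MM))).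
  by apply: (@fordM _ _ 1 1); apply: ford1_const.
have := H U_(j)%MM; rewrite mdeg1 => /(_ isT).
rewrite mulrBl !mulrBr [F * fps_const _]mulrC !fpsB !fps_constM fps_constE.
rewrite mnm1_eq0 !mulr0 subr0 => /eqP; rewrite subr_eq add0r => /eqP E.
by rewrite -[LHS](subrK (G 0%MM * F U_(j)%MM)) E; ring.
Qed.

(** The equations [a] of the surface and [a = u = 0] of the curve; the
    multiplicity structure is [a = u ^ m = 0]. *)
Record branch (K : fieldType) (O : comPzRingType) (tau : {rmorphism O -> fps K 3})
  (C Z T : set O) (m : nat) (a u : O) : Prop := Branch {
  surface_eqn : T = dvI tau a;
  curve_eqn : C = id2I tau a u;
  curve_gen : C = ideal_add T u;
  struct_gen : Z = ideal_add T (u ^+ m);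
  surface_in : T a;
  curve_in : C u;
  surface_nonunit : nonunits a;
  curve_nonunit : nonunits u;
  branch_indep : indep2 (tau a) (tau u);
  surface_fin : fin_over T;
  surface_is_ideal : is_ideal T
}.

Section Branch.
Variables (K : fieldType) (p : 'rV[K]_4) (hp : p != 0) (i0 : 'I_4).
Hypothesis pi0 : p 0 i0 != 0.
Local Notation S := {mpoly K[4]}.
Local Notation P := (cpoint hp).
Local Notation O := (stalk P).
Local Notation M := (@nonunits O).
Local Notation theta := (theta (cpoint_X0 pi0)).
Local Notation tau := (tau (hp := hp) i0).
Local Notation germs I := (@stalk_ideal K I P).
Implicit Types (f g : S) (C Z T : set S) (a u : O).

Lemma theta_value d f : f \is d.-homog -> M (theta f) <-> f.@[p 0] = 0.
Proof.
move=> hf; rewrite (tau_nonunit pi0) ford1E -(taylor0 p i0) -(tau_theta hp pi0 hf).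
rewrite fpsM0 -rmorphXn /= fps_constE eqxx mulr1.
split=> [->|/eqP]; first by rewrite mulr0.
by rewrite mulf_eq0 expf_eq0 (negPf pi0) andbF => /eqP.
Qed.

Lemma cpoint_theta f : pt_ideal P f <-> forall d, M (theta (pihomog mdeg d f)).
Proof. by split=> H d; have := H d; rewrite (theta_value (pihomogP _ _ _)). Qed.

Let tc := tau_coords hp pi0.
Let ti := @tau_inj K p hp i0 pi0.
Let d3 := @stalk_dim3 K p hp i0 pi0.

Lemma lies_on_germs T : homogeneous_ideal T -> lies_on P T <-> germs T `<=` M.
Proof. exact: (lies_on_stalk (M_prime tc) cpoint_theta). Qed.

Lemma surface_through C Z T h m : lies_on P C -> multiplicity_structure C Z m ->
  local_smooth_surface p h T -> contained_over h Z T ->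
  germs T `<=` germs Z /\ germs Z `<=` M.
Proof.
move=> PC [[Zh _] ZC _ _] [_ hp0 _ _] TZ; split; first exact: TZ.
by apply/lies_on_germs/ZC.
Qed.

(** The primes over the ideals of C and of Z agree, as these are read off from the
    homogeneous primes that contain them; this is how the condition on the
    supports is used. *)
Lemma branch_ex C Z T h m : smooth_curve C -> lies_on P C ->
  multiplicity_structure C Z m -> local_smooth_surface p h T -> contained_over h Z T ->
  exists a u, branch tau (germs C) (germs Z) (germs T) m a u.
Proof.
move=> [[Ch Csat] Creg] PC mult surf cont.
have [TZ ZM] := surface_through PC mult surf cont.
have [[Zh _] ZC ZCM Zlen] := mult; have [_ hp0 Th Treg] := surf.
have TM : germs T `<=` M by apply: subset_trans ZM.
have [CI TI ZI] : [/\ is_ideal (germs C), is_ideal (germs T) & is_ideal (germs Z)].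
  by split; apply: (stalk_ideal_ideal (cpoint_X0 (hp := hp) pi0)); [case: Ch|case: Th|case: Zh].
have Tr := Treg p hp hp0 ((lies_on_germs Th).2 TM).
have [a [Ta Ma ia TE]] := surface_ideal tc ti d3 TI TM Tr.
have fin := regular_fin tc TI TM Tr.
have CM : germs C `<=` M by apply/lies_on_germs.
have over q : is_prime q -> germs C `<=` q <-> germs Z `<=` q.
  move=> qp; have [Q QE] := prime_ppoint (cpoint_X0 (hp := hp) pi0) qp.
  by rewrite -(lies_on_stalk qp QE Zh) -(lies_on_stalk qp QE Ch) ZC.
have [u [[Cu Mu iau] [Cp nMC TC CE CE']]] :
    exists u, [/\ germs C u, M u & indep2 (tau a) (tau u)] /\
      [/\ is_prime (germs C), ~ M `<=` germs C, germs T `<=` germs C,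
          germs C = id2I tau a u & germs C = ideal_add (germs T) u].
  apply: (curve_ideal tc ti d3 TI fin Ta Ma ia CI CM (Creg p hp PC)) => q qp Cq.
  by apply: subset_trans TZ _; apply/(over q qp).
have ZsubC : germs Z `<=` germs C by apply/(over _ Cp).
have [k [ZE nZ]] := mult_ideal tc ti d3 TI fin Ma ia Cp nMC Mu iau CE CE' ZI TZ ZsubC
  (fun q qp Zq => (over q qp).2 Zq) (ZCM P ((ZC P).2 PC)).
have [Q QE] := prime_ppoint (cpoint_X0 (hp := hp) pi0) Cp.
have mk : m = k.
  apply: (multiplicity_length Cp QE Ch erefl _ Zlen _ TZ _ nZ); first by case: Zh.
    by move=> f; apply: (curve_div tc TI fin Mu CE').
  by rewrite ZE; apply: ideal_add_mem.
by exists a, u; split=> //; rewrite mk.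
Qed.

Lemma branch_pos C Z T m a u : germs Z `<=` M -> branch tau (germs C) (germs Z) (germs T) m a u -> (0 < m)%N.
Proof.
move=> ZM B; rewrite lt0n; apply/eqP => m0; apply: (M_not1 (O := O)); apply: ZM.
rewrite (struct_gen B) m0 expr0; apply: ideal_add_mem; exact: surface_is_ideal B.
Qed.

(** ** Tangency *)

Lemma taylor_deriv f j : (taylor p i0 f) U_(j)%MM = (f^`M(fintype.lift i0 j)).@[p 0].
Proof.
rewrite (derivation_ext (q := p 0) (D := fun f => taylor p i0 f U_(j)%MM)).
- rewrite (bigD1 (fintype.lift i0 j)) //= big1 ?addr0 => [|i ne].
    rewrite taylor_X /shift liftK /= rmorphD /= fps_ofC fpsD fps_constE mnm1_eq0 mulr0 add0r.
    by rewrite fps_mono eqxx mul1r.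
  rewrite taylor_X /shift; case: unliftP ne => [j'|] -> ne /=.
    rewrite rmorphD /= fps_ofC fpsD fps_constE mnm1_eq0 mulr0 add0r fps_mono eq_mnm1.
    rewrite (_ : (j' == j) = false) ?mul0r //; apply/negP => /eqP jj.
    by rewrite jj eqxx in ne.
  by rewrite addr0 fps_ofC fps_constE mnm1_eq0 mulr0 mul0r.
- by move=> g h; rewrite rmorphD.
- by move=> c; rewrite taylor_C fps_constE mnm1_eq0 mulr0.
- by move=> g h; rewrite rmorphM fpsM_U /= !taylor0.
Qed.

Lemma euler d f : f \is d.-homog -> \sum_i p 0 i * (f^`M(i)).@[p 0] = d%:R * f.@[p 0].
Proof.
move=> hf; pose D g := ((line_eval p g)^`()).[1].
have e1 g : (line_eval p g).[1] = g.@[p 0].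
  pose l : {rmorphism S -> K} := horner_eval 1 \o mmap (@polyC K) (fun i => p 0 i *: 'X).
  apply: (mmap_ext (c := idfun) (f := l)) => [c|i] /=; rewrite /horner_eval.
    by rewrite mmapC hornerC.
  by rewrite mmapX mmap1U hornerZ hornerX mulr1.
have DX i : D 'X_i = p 0 i.
  by rewrite /D /line_eval mmapX mmap1U derivZ derivX hornerZ hornerC mulr1.
transitivity (D f).
  rewrite (derivation_ext (q := p 0) (D := D)); first by apply: eq_bigr => i _; rewrite DX.
  - by move=> g h; rewrite /D /line_eval rmorphD derivD hornerD.
  - by move=> c; rewrite /D /line_eval mmapC derivC horner0.
  - by move=> g h; rewrite /D -!e1 /line_eval rmorphM derivM hornerD !hornerM addrC.
by rewrite /D (line_eval_homog _ hf) derivZ derivXn hornerZ hornerMn hornerXn expr1n mulrC.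
Qed.

(** The differential at [p] in the direction of [w], on power series: by Euler's
    relation [w] may be moved along [p] into the hyperplane of the affine chart. *)
Definition dir (w : 'rV[K]_4) (F : fps K 3) : K :=
  \sum_j (w 0 (fintype.lift i0 j) - w 0 i0 / p 0 i0 * p 0 (fintype.lift i0 j)) * F U_(j)%MM.

Lemma dir_taylor w d f : f \is d.-homog -> f.@[p 0] = 0 ->
  dir w (taylor p i0 f) = \sum_i w 0 i * (f^`M(i)).@[p 0].
Proof.
move=> hf f0; have := euler hf; rewrite f0 mulr0 => E.
pose c := w 0 i0 / p 0 i0; pose G i := (w 0 i - c * p 0 i) * (f^`M(i)).@[p 0].
have <- : \sum_i G i = \sum_i w 0 i * (f^`M(i)).@[p 0].
  transitivity (\sum_i w 0 i * (f^`M(i)).@[p 0] - c * \sum_i p 0 i * (f^`M(i)).@[p 0]).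
    by rewrite mulr_sumr -sumrB; apply: eq_bigr => i _; rewrite /G mulrBl mulrA.
  by rewrite E mulr0 subr0.
rewrite (bigD1 i0) //= {1}/G /c divfK // subrr mul0r add0r.
rewrite (reindex_omap (fintype.lift i0) (unlift i0)) /=.
  apply: eq_big => [j|j _]; first by rewrite liftK eq_sym neq_lift eqxx.
  by rewrite taylor_deriv.
by move=> i ne; case: unliftP ne => [j ->|->] //; rewrite eqxx.
Qed.

Lemma dirD w F G : dir w (F + G) = dir w F + dir w G.
Proof. by rewrite /dir -big_split; apply: eq_bigr => j _; rewrite fpsD mulrDr. Qed.

Lemma dirM w (F G : fps K 3) : F 0%MM = 0 -> dir w (F * G) = dir w F * G 0%MM.
Proof.
move=> F0; rewrite /dir mulr_suml; apply: eq_bigr => j _.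
by rewrite fpsM_U F0 mul0r add0r mulrA.
Qed.

Lemma dir_ford2 w F : ford 2 F -> dir w F = 0.
Proof. by move=> H; rewrite /dir big1 // => j _; rewrite H ?mulr0 // mdeg1. Qed.

Lemma dir_theta w d f : f \is d.-homog -> f.@[p 0] = 0 ->
  p 0 i0 ^+ d * dir w (tau (theta f)) = \sum_i w 0 i * (f^`M(i)).@[p 0].
Proof.
move=> hf f0; rewrite -(dir_taylor w hf f0) -(tau_theta hp pi0 hf) [X in _ = dir w X]mulrC dirM.
  by rewrite -rmorphXn /= fps_constE eqxx mulr1 mulrC.
by apply/ford1E/(tau_nonunit pi0)/(theta_value hf).
Qed.

(** A tangent direction of the curve that is not tangent to the second surface
    annihilates the linear parts of [a] and [u], but not that of [b]. *)
Lemma transverse C Z T m a u T' b : homogeneous_ideal C -> germs C `<=` M ->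
  homogeneous_ideal T' -> germs T' `<=` M -> germs T' = dvI tau b -> M b ->
  branch tau (germs C) (germs Z) (germs T) m a u -> ~ (tangent_space C p `<=` tangent_space T' p) ->
  indep3 (tau a) (tau u) (tau b).
Proof.
move=> [CI Ch] CM Th' TM' TE' Mb B /existsNP[w /not_implyP[Cw /existsNP[f /not_implyP[Tf Df]]]].
have [TI' Thh] := Th'.
pose D g := \sum_i w 0 i * (g^`M(i)).@[p 0].
have DD (g h : S) : D (g + h) = D g + D h.
  rewrite /D -big_split; apply: eq_bigr => i _.
  by rewrite mderivD mevalD mulrDr.
have [d Dd] : exists d, D (pihomog mdeg d f) <> 0.
  apply: contrapT => H; apply: Df; rewrite -/(D f).
  rewrite (pihomog_partitionE (leqnn (msize f))).
  elim/big_rec: _ => [|i g _ Dg].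
    by rewrite /D big1 // => i _; rewrite mderiv0 meval0 mulr0.
  by rewrite DD Dg addr0; apply: contrapT => Di; apply: (H); exists i.
have value0 (I : set S) e g : homogeneous_ideal I -> germs I `<=` M -> I g -> g \is e.-homog ->
    g.@[p 0] = 0.
  move=> [II _] IM Ig hg; apply/(theta_value hg)/IM.

  exact: (stalk_ideal_theta (cpoint_X0 (hp := hp) pi0) II hg Ig).
have hfd := pihomogP mdeg d f; have Tfd := Thh f d Tf.
have dir0 x : M x -> tau x 0%MM = 0 by move=> Mx; apply/ford1E/(tau_nonunit pi0).
have db : dir w (tau b) <> 0.
  move=> db; apply: Dd; rewrite /D -(dir_theta w hfd (value0 _ _ _ Th' TM' Tfd hfd)).
  have := stalk_ideal_theta (cpoint_X0 (hp := hp) pi0) TI' hfd Tfd.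
  rewrite TE' => -[g E]; have {}E : tau (theta (pihomog mdeg d f)) = tau b * g := E.
  by rewrite E dirM ?db ?mul0r ?mulr0 //; apply: dir0.
have dC x : germs C x -> dir w (tau x) = 0.
  move=> Cx; move: (Cx) => /(stalk_idealP (cpoint_X0 (hp := hp) pi0) _ CI)[e [g [h [Cg hg hh Ph E]]]].
  have := dir_theta w hg (value0 C e g (conj CI Ch) CM Cg hg); rewrite (Cw g Cg) -E.
  rewrite rmorphM /= dirM; last by apply/dir0/CM.
  move/eqP; rewrite !mulf_eq0 expf_eq0 (negPf pi0) andbF /= => /orP[/eqP //|/eqP h0].
  case: (Ph); apply/(cpoint_homog hp hh)/(theta_value hh)/(tau_nonunit pi0)/ford1E.
  exact: h0.
have TC : germs T `<=` germs C by rewrite (curve_gen B); apply: ideal_add_sub.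
move=> k l n H.
have n0 : n = 0.
  have := dir_ford2 w H; rewrite !dirD.
  have dk c x : M x -> dir w (fps_const c * tau x) = c * dir w (tau x).
    by move=> Mx; rewrite mulrC dirM ?dir0 // fps_constE eqxx mulr1 mulrC.
  rewrite !dk //; [|exact: curve_nonunit B|exact: surface_nonunit B].
  rewrite (dC u (curve_in B)) (dC a (TC a (surface_in B))) !mulr0 !add0r.
  by move/eqP; rewrite mulf_eq0 => /orP[/eqP|/eqP /db].
move: H; rewrite n0 rmorph0 mul0r addr0 => /(branch_indep B)[-> ->].
by split.
Qed.
End Branch.

(** * Two transverse branches *)

Section MonomialIdeals.
Variable K : fieldType.
Implicit Types (f g : fps K 3) (e m : 'X_{1..3}).
Local Notation x := (fps_var K (ord0 : 'I_3)).
Local Notation y := (fps_var K (inord 1 : 'I_3)).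
Local Notation z := (fps_var K (inord 2 : 'I_3)).

Lemma mnm3_le e m : (e <= m)%MM =
  [&& (e ord0 <= m ord0)%N, (e (inord 1) <= m (inord 1))%N & (e (inord 2) <= m (inord 2))%N].
Proof.
apply/mnm_lepP/and3P => [H|[h0 h1 h2]]; first by split; apply: H.
by apply: I3_case.
Qed.

Lemma fps_mono_dvdP e f : (exists g, f = (mono e) * g) <-> forall m, f m != 0 -> (e <= m)%MM.
Proof.
split=> [[g ->] m|H]; first by rewrite fps_monoM; case: ifP => // _; rewrite eqxx.
by apply: fps_mono_dvd => m; apply: contraNeq; apply: H.
Qed.

Definition fps_restr (Q : pred 'X_{1..3}) f : fps K 3 := fun m => if Q m then f m else 0.

Lemma fps_restrK Q f : fps_restr Q f + fps_restr (predC Q) f = f.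
Proof.
by apply: fps_eq => m; rewrite fpsD /fps_restr /=; case: (Q m); rewrite ?addr0 ?add0r.
Qed.

(** Membership in an ideal generated by three monomials is a condition on
    supports. *)
Lemma mono_span3 e1 e2 e3 f :
  (forall m, f m != 0 -> [|| (e1 <= m)%MM, (e2 <= m)%MM | (e3 <= m)%MM]) ->
  exists c1 c2 c3, f = (mono e1) * c1 + (mono e2) * c2 + (mono e3) * c3.
Proof.
move=> H; pose Q1 m := (e1 <= m)%MM; pose Q2 m := (e2 <= m)%MM.
have [|c1 E1] := (fps_mono_dvdP e1 (fps_restr Q1 f)).2.
  by move=> m; rewrite /fps_restr; case: ifP => //; rewrite eqxx.
have [|c2 E2] := (fps_mono_dvdP e2 (fps_restr Q2 (fps_restr (predC Q1) f))).2.
  by move=> m; rewrite /fps_restr; case: ifP => //; rewrite eqxx.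
have [|c3 E3] := (fps_mono_dvdP e3 (fps_restr (predC Q2) (fps_restr (predC Q1) f))).2.
  move=> m; rewrite /fps_restr /= /Q1 /Q2; case: ifP; last by rewrite eqxx.
  move=> n2; case: ifP; last by rewrite eqxx.
  by move=> n1 /H; rewrite (negPf n1) (negPf n2).
by exists c1, c2, c3; rewrite -E1 -E2 -E3 -addrA !fps_restrK.
Qed.

Lemma mono_var (i : 'I_3) : (mono U_(i)%MM) = fps_var K i.
Proof. by rewrite fps_varE. Qed.

Lemma mono_exp e k : (mono (e *+ k)%MM) = (mono e) ^+ k :> fps K 3.
Proof. by rewrite -mpolyXn rmorphXn. Qed.

Lemma ford1_span f : ford 1 f -> exists g0 g1 g2,
  f = x * g0 + y * g1 + z * g2.
Proof.
move=> f1; have [|g0 [g1 [g2 E]]] := @mono_span3 U_(ord0) U_(inord 1) U_(inord 2) f.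
  move=> m; rewrite !lep1mP; apply: contraR; rewrite !negb_or !negbK.
  move=> /and3P[/eqP m0 /eqP m1 /eqP m2]; apply/eqP/f1.
  by rewrite mdegE big_I3 m0 m1 m2.
by exists g0, g1, g2; rewrite {1}E !mono_var.
Qed.

(** For a monomial, membership in both ideals is a condition on the exponents, and
    [k <= l] leaves the three generators. *)
Lemma ideal2_inter k l f : (k <= l)%N ->
  ideal2 y (z ^+ k) f -> ideal2 x (z ^+ l) f ->
  exists c1 c2 c3, f = x * y * c1 + x * z ^+ k * c2 + z ^+ l * c3.
Proof.
move=> kl [g [h E]] [g' [h' E']].
have zE i : z ^+ i = mono (U_(inord 2) *+ i)%MM by rewrite mono_exp mono_var.
have [|c1 [c2 [c3 Ef]]] := @mono_span3 (U_(ord0) + U_(inord 1))%MM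
    (U_(ord0) + U_(inord 2) *+ k)%MM (U_(inord 2) *+ l)%MM f; last first.
  by exists c1, c2, c3; rewrite {1}Ef !fps_monoD !mono_exp !mono_var.
move=> m fm; rewrite !mnm3_le !mnmDE !mulmnE !mnm1E !jE /= !mul0n !mul1n !addn0 !add0n.
have H1 : (0 < m (inord 1))%N || (k <= m (inord 2))%N.
  move: fm; apply: contraR; rewrite negb_or -!leqNgt leqn0 => /andP[/eqP m1 mk].
  rewrite E [g * _]mulrC [h * _]mulrC fpsD zE fps_varE !fps_monoM lep1mP m1 eqxx add0r.
  by rewrite mnm3_le !mulmnE !mnm1E !jE /= mul1n (negPf mk) ?andbF.
have H2 : (0 < m ord0)%N || (l <= m (inord 2))%N.
  move: fm; apply: contraR; rewrite negb_or -!leqNgt leqn0 => /andP[/eqP m1 mk].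
  rewrite E' [g' * _]mulrC [h' * _]mulrC fpsD zE fps_varE !fps_monoM lep1mP m1 eqxx add0r.
  by rewrite mnm3_le !mulmnE !mnm1E !jE /= mul1n (negPf mk) ?andbF.
by move: H1 H2; lia.
Qed.
End MonomialIdeals.

Lemma mnm_subxx N (e : 'X_{1..N}) : (e - e)%MM = 0%MM.
Proof. by apply/mnmP => j; rewrite mnmBE subnn mnm0E. Qed.

Section Pair.
Variables (K : fieldType) (O : comPzRingType) (cst : K -> O).
Variable tau : {rmorphism O -> fps K 3}.
Hypothesis tauP : coords cst tau.
Local Notation M := (@nonunits O).
Variables (C1 Z1 T1 C2 Z2 T2 : set O) (m n : nat) (a u b v : O).
Hypotheses (B1 : branch tau C1 Z1 T1 m a u) (B2 : branch tau C2 Z2 T2 n b v).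
Hypotheses (ind1 : indep3 (tau a) (tau u) (tau b)) (ind2 : indep3 (tau b) (tau v) (tau a)).
Hypotheses (m0 : (0 < m)%N) (mn : (m <= n)%N).
Implicit Types (f t w z : O) (F G : fps K 3).

Let MP f : M f <-> ford 1 (tau f) := nonunits_ford tauP f.
Let Ma := surface_nonunit B1.
Let Mu := curve_nonunit B1.
Let Mb := surface_nonunit B2.
Let Mv := curve_nonunit B2.
Let I1 := surface_is_ideal B1.
Let I2 := surface_is_ideal B2.

(** By Krull's intersection theorem it is enough to see this in the completion,
    where [a], [u], [b] are coordinates. *)
Lemma max_gen w : M w -> exists t c d, T1 t /\ w = t + c * u + d * b.
Proof.
have [T0 TD TM] := I1; pose W : set O := [set w | exists t c d, T1 t /\ w = t + c * u + d * b].
have WI : is_ideal W.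
  split=> [|_ _ [t [c [d [Tt ->]]]] [t' [c' [d' [Tt' ->]]]]|r _ [t [c [d [Tt ->]]]]].
  - by exists 0, 0, 0; split=> //; ring.
  - by exists (t + t'), (c + c'), (d + d'); split; [exact: TD | ring].
  - by exists (r * t), (r * c), (r * d); split; [exact: TM | ring].
move=> Mw; rewrite -/(W w); apply: (krull tauP (surface_fin B1) WI).
  by move=> t Tt; exists t, 0, 0; split=> //; ring.
move=> k; have [kap [[kc kf ks] ka ku kb]] :=
  coords3 ((MP a).1 Ma) ((MP u).1 Mu) ((MP b).1 Mb) ind1.
have [|g0 [g1 [g2 E]]] := @ford1_span _ (kap (tau w)).
  by apply/kf/MP.
have [_ _ dens] := tauP.
have [h0 E0] := ks g0; have [h1 E1] := ks g1; have [h2 E2] := ks g2.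
have [c0 F0] := dens h0 k; have [c1 F1] := dens h1 k; have [c2 F2] := dens h2 k.
exists (c0 * a + c1 * u + c2 * b).
  by exists (c0 * a), c1, c2; split=> //; apply: (TM); apply: surface_in B1.
apply: fordBC; apply/kf; rewrite !rmorphB !rmorphD !rmorphM /= ka ku kb E -E0 -E1 -E2.
rewrite (_ : _ - _ = kap (tau c0 - h0) * fps_var K ord0 +
   kap (tau c1 - h1) * fps_var K (inord 1) + kap (tau c2 - h2) * fps_var K (inord 2)).
  by apply: fordD; [apply: fordD|]; apply: fordMr; apply/kf.
by rewrite !rmorphB; ring.
Qed.

(** Write [v = t + c u + d b] with [t] in the ideal of the first surface; then [c]
    is a unit, and [v - d b = t + c u] is a parameter on both curves. *)
Lemma common_param : exists z, [/\ M z, indep3 (tau b) (tau a) (tau z),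
  exists t c d, [/\ T1 t, c * d = 1 & z = t + c * u] & exists c, z = v + c * b].
Proof.
have [t [c [d [Tt E]]]] := max_gen Mv.
have [h Eh] : dv (tau a) (tau t) by move: Tt; rewrite (surface_eqn B1).
have a1 := (MP a).1 Ma; have u1 := (MP u).1 Mu; have b1 := (MP b).1 Mb.
have lin (F G : fps K 3) : ford 1 G -> ford 2 (F * G - fps_const (F 0%MM) * G).
  by move=> G1; rewrite -mulrBl; apply: (@fordM _ _ 1 1) => //; apply: ford1_const.
have nMc : ~ M c.
  move=> /MP/ford1E c0.
  have [|_ /eqP] := ind2 (k := tau d 0%MM) (l := - 1) (n := h 0%MM); last by rewrite oppr_eq0 oner_eq0.
  rewrite rmorphN rmorph1 mulN1r E !rmorphD !rmorphM /= Eh.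
  rewrite (_ : _ + _ = - ((tau d * tau b - fps_const (tau d 0%MM) * tau b) +
     (h * tau a - fps_const (h 0%MM) * tau a) +
     (tau c * tau u - fps_const (tau c 0%MM) * tau u))).
    by apply: fordN; apply: fordD; [apply: fordD|]; apply: lin.
  by rewrite c0 rmorph0; ring.
have [c' cc'] := not_M_unit nMc; exists (t + c * u); split.
- have [_ MD MM] := M_ideal tauP; apply: (MD); last by apply: (MM).
  by apply/MP; rewrite Eh; apply: fordMr.
- move=> k l r; rewrite rmorphD rmorphM /= Eh => H.
  have [|lr rc ->] := ind1 (k := l + r * h 0%MM) (l := r * tau c 0%MM) (n := k).
    rewrite -[X in ford 2 X](subrK (fps_const k * tau b + fps_const l * tau a +
       fps_const r * (tau a * h + tau c * tau u))).
    apply: fordD => //; rewrite rmorphD !rmorphM /=.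
    rewrite (_ : _ - _ = - (fps_const r * (h * tau a - fps_const (h 0%MM) * tau a) +
        fps_const r * (tau c * tau u - fps_const (tau c 0%MM) * tau u))); last by ring.
    by apply: fordN; apply: fordD; apply: fordMl; apply: lin.
  have r0 : r = 0.
    move/eqP: rc; rewrite mulf_eq0 => /orP[/eqP //|/eqP c0].
    by case: nMc; apply/MP/ford1E.
  by move: lr; rewrite r0 mul0r addr0.
- by exists t, c, c'.
by exists (- d); rewrite E; ring.
Qed.

Section CommonParameter.
Variables (z t c c' d : O).
Hypotheses (Mz : M z) (indz : indep3 (tau b) (tau a) (tau z)).
Hypotheses (Tt : T1 t) (cc' : c * c' = 1) (zE : z = t + c * u) (zE' : z = v + d * b).

Lemma z_in_C1 : C1 z.
Proof. by rewrite (curve_gen B1); exists t, c. Qed.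

Lemma z_in_C2 : C2 z.
Proof.
have [_ _ TM] := I2; rewrite (curve_gen B2); exists (d * b), 1; split.
  by apply: (TM); apply: surface_in B2.
by rewrite zE' mul1r addrC.
Qed.

Lemma ideal_add_exp (T : set O) x y i : is_ideal T -> T x -> exists s, T s /\
  (x + y) ^+ i = s + y ^+ i.
Proof.
move=> [T0 TD TM] Tx; elim: i => [|i [s [Ts E]]]; first by exists 0; rewrite !expr0 add0r.
exists (y * s + (x + y) ^+ i * x); split; first by apply: (TD); apply: (TM).
by rewrite exprS mulrDl {2}E exprS; ring.
Qed.

(** The function [z ^ n] vanishes on both structures because [m <= n]. *)
Lemma z_exp_in : Z1 (z ^+ n) /\ Z2 (z ^+ n).
Proof.
have [_ TD1 TM1] := I1; have [_ TD2 TM2] := I2.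
rewrite (struct_gen B1) (struct_gen B2); split.
  have [s [Ts E]] := ideal_add_exp (c * u) n I1 Tt.
  exists s, (c ^+ n * u ^+ (n - m)); split=> //.
  by rewrite zE E exprMn -mulrA -exprD subnK.
have [s [Ts E]] := ideal_add_exp v n I2 (TM2 d _ (surface_in B2)).
by exists s, 1; split=> //; rewrite zE' addrC E mul1r.
Qed.

Lemma ab_in : Z1 (a * b) /\ Z2 (a * b).
Proof.
have [_ _ TM1] := I1; have [_ _ TM2] := I2.
rewrite (struct_gen B1) (struct_gen B2); split; apply: ideal_add_sub.
  by rewrite mulrC; apply: (TM1); apply: surface_in B1.
by apply: (TM2); apply: surface_in B2.
Qed.

Variable kap : {rmorphism fps K 3 -> fps K 3}.
Hypotheses (kauto : fps_auto kap) (kb : kap (tau b) = fps_var K ord0).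
Hypotheses (ka : kap (tau a) = fps_var K (inord 1)) (kz : kap (tau z) = fps_var K (inord 2)).
Local Notation X := (fps_var K (ord0 : 'I_3)).
Local Notation Y := (fps_var K (inord 1 : 'I_3)).
Local Notation W := (fps_var K (inord 2 : 'I_3)).

Lemma T1_coord f : T1 f -> exists g, kap (tau f) = Y * g.
Proof. by rewrite (surface_eqn B1) => -[g ->]; exists (kap g); rewrite rmorphM ka. Qed.

Lemma T2_coord f : T2 f -> exists g, kap (tau f) = X * g.
Proof. by rewrite (surface_eqn B2) => -[g ->]; exists (kap g); rewrite rmorphM kb. Qed.

Lemma u_coord i : exists g h, kap (tau (u ^+ i)) = g * Y + h * W ^+ i.
Proof.
have -> : u = - (c' * t) + c' * z.
  by rewrite zE mulrDr addrA addNr add0r mulrA [c' * c]mulrC cc' mul1r.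
have [_ _ TM] := I1; have Tn : T1 (- (c' * t)) by apply: is_idealN => //; apply: TM.
have [s [Ts ->]] := ideal_add_exp (c' * z) i I1 Tn.
have [g Eg] := T1_coord Ts; exists g, (kap (tau (c' ^+ i))).
by rewrite exprMn !rmorphD !rmorphM /= Eg !rmorphXn /= kz mulrC.
Qed.

Lemma v_coord i : exists g h, kap (tau (v ^+ i)) = g * X + h * W ^+ i.
Proof.
have -> : v = - (d * b) + z by rewrite zE' addrC addrK.
have [_ _ TM] := I2; have Tn : T2 (- (d * b)).
  by apply: is_idealN => //; apply: (TM); apply: surface_in B2.
have [s [Ts ->]] := ideal_add_exp z i I2 Tn.
have [g Eg] := T2_coord Ts; exists g, 1.
by rewrite !rmorphD /= Eg !rmorphXn /= kz mulrC mul1r.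
Qed.

Lemma Z1_coord f : Z1 f -> ideal2 Y (W ^+ m) (kap (tau f)).
Proof.
rewrite (struct_gen B1) => -[s [e [Ts ->]]]; have [g Eg] := T1_coord Ts.
have [g' [h E]] := u_coord m; exists (g + kap (tau e) * g'), (kap (tau e) * h).
by rewrite !rmorphD !rmorphM /= Eg E; ring.
Qed.

Lemma Z2_coord f : Z2 f -> ideal2 X (W ^+ n) (kap (tau f)).
Proof.
rewrite (struct_gen B2) => -[s [e [Ts ->]]]; have [g Eg] := T2_coord Ts.
have [g' [h E]] := v_coord n; exists (g + kap (tau e) * g'), (kap (tau e) * h).
by rewrite !rmorphD !rmorphM /= Eg E; ring.
Qed.

Lemma C1_coord f : C1 f -> ideal2 Y W (kap (tau f)).
Proof.
rewrite (curve_gen B1) => -[s [e [Ts ->]]]; have [g Eg] := T1_coord Ts.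
have [g' [h E]] := u_coord 1; exists (g + kap (tau e) * g'), (kap (tau e) * h).
by move: E; rewrite !expr1 => E; rewrite !rmorphD !rmorphM /= Eg E; ring.
Qed.

Lemma C2_coord f : C2 f -> ideal2 X W (kap (tau f)).
Proof.
rewrite (curve_gen B2) => -[s [e [Ts ->]]]; have [g Eg] := T2_coord Ts.
have [g' [h E]] := v_coord 1; exists (g + kap (tau e) * g'), (kap (tau e) * h).
by move: E; rewrite !expr1 => E; rewrite !rmorphD !rmorphM /= Eg E; ring.
Qed.

Lemma a_in_C1 : C1 a.
Proof. by rewrite (curve_gen B1); apply: ideal_add_sub; apply: surface_in B1. Qed.

Lemma b_in_C2 : C2 b.
Proof. by rewrite (curve_gen B2); apply: ideal_add_sub; apply: surface_in B2. Qed.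

(** From [c1 x y + c2 x z^m + c3 z^n = - c3 (x y' - z^n)], where
    [y' = - (c1 y + c2 z^m) / c3]; the coefficients at [x y] and at [z^n] are
    the constant terms of [c1] and [c3]. *)
Lemma normal_form phi : Z1 phi -> Z2 phi ->
  kap (tau phi) (U_(ord0) + U_(inord 1))%MM != 0 ->
  kap (tau phi) (U_(inord 2) *+ n)%MM != 0 ->
  exists (rho : {rmorphism O -> fps K 3}) (e : fps K 3), [/\ coords cst rho,
    e \is a GRing.unit, rho phi = e * Ak_eqn K n, generates rho C1 Y W & generates rho C2 X W].
Proof.
move=> Zphi1 Zphi2 cxy czn.
have [c1 [c2 [c3 E]]] := ideal2_inter mn (Z1_coord Zphi1) (Z2_coord Zphi2).
have n0 : (0 < n)%N by apply: leq_trans mn.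
have Em : kap (tau phi) = (mono (U_(ord0) + U_(inord 1))%MM) * c1 +
    (mono (U_(ord0) + U_(inord 2) *+ m)%MM) * c2 + (mono (U_(inord 2) *+ n)%MM) * c3.
  by rewrite !fps_monoD !mono_exp !mono_var.
have c10 : c1 0%MM != 0.
  move: cxy; rewrite Em !fpsD !fps_monoM !mnm3_le !mnmDE !mulmnE !mnm1E !jE /=.
  have -> : (0 + 1 * m <= 0 + 0)%N = false by lia.
  have -> : (1 * n <= 0 + 0)%N = false by lia.
  by rewrite !addr0 mnm_subxx.
have c30 : c3 0%MM != 0.
  move: czn; rewrite Em !fpsD !fps_monoM !mnm3_le !mnmDE !mulmnE !mnm1E !jE /=.
  by rewrite leqnn !add0r mnm_subxx.
have [s c1s] : exists s, c1 * s = 1 by exists c1^-1; apply: divrr.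
have [r c3r] : exists r, c3 * r = 1 by exists c3^-1; apply: divrr.
have r0 : r 0%MM != 0.
  by move/(congr1 (@^~ 0%MM))/eqP: c3r; rewrite fpsM0 fps1 eqxx; apply: contraTneq => ->;
     rewrite mulr0 eq_sym oner_eq0.
pose Y' := - ((c1 * Y + c2 * W ^+ m) * r).
have Eu : kap (tau phi) = - c3 * (X * Y' - W ^+ n).
  transitivity (c3 * r * (X * (c1 * Y + c2 * W ^+ m)) + c3 * W ^+ n).
    by rewrite E c3r; ring.
  by rewrite /Y'; ring.
have WS : W ^+ m = W ^+ m.-1 * W by rewrite -exprSr prednK.
have YE : Y = - (c3 * s) * Y' - c2 * s * W ^+ m.-1 * W.
  transitivity (c3 * r * s * (c1 * Y + c2 * W ^+ m) - c2 * s * W ^+ m); last first.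
    by rewrite /Y' WS; ring.
  transitivity (c1 * s * Y); first by rewrite c1s mul1r.
  by rewrite c3r; ring.
have Y'1 : ford 1 Y'.
  apply: fordN; apply: fordMr; apply: fordD; apply: fordMl; first exact: ford_var.
  by rewrite WS; apply: fordMl; apply: ford_var.
have [|k [ka2 kX kY kW]] := coords3 (ford_var K ord0) Y'1 (ford_var K (inord 2)).
  move=> k l q H.
  have V i j : (fps_var K i) U_(j)%MM = (i == j)%:R :> K by rewrite fps_varE fps_mono eq_mnm1.
  have V0 i : (fps_var K i) 0%MM = 0 :> K by rewrite fps_varE fps_mono mnm1_eq0.
  have Wm0 : (W ^+ m) 0%MM = 0 by rewrite WS fpsM0 V0 mulr0.
  have Wm1 : (W ^+ m) U_(inord 1)%MM = 0 by rewrite WS fpsM_U V !jE mulr0 V0 mulr0 addr0.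
  have Y'U : Y' U_(inord 1)%MM = - (c1 0%MM * r 0%MM).
    rewrite /Y' fpsN fpsM_U !fpsD fpsM_U [(c2 * _) U_(_)%MM]fpsM_U !fpsM0 Wm1 Wm0 V V0 eqxx.
    by rewrite !mulr0 !addr0 mul0r add0r mulr1.
  have at_ j : k * (ord0 == j)%:R + l * Y' U_(j)%MM + q * (inord 2 == j)%:R = 0.
    by rewrite -!V -!fps_constM -!fpsD; apply: H; rewrite mdeg1.
  have l0 : l = 0.
    have := at_ (inord 1); rewrite !jE Y'U !mulr0 addr0 add0r => /eqP.
    by rewrite mulrN oppr_eq0 !mulf_eq0 (negPf c10) (negPf r0) !orbF => /eqP.
  split=> //; first by have := at_ ord0; rewrite l0 !jE mul0r mulr0 mulr1 !addr0.
  by have := at_ (inord 2); rewrite l0 !jE mul0r mulr0 mulr1 !add0r.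
pose rho : {rmorphism O -> fps K 3} := GRing.RMorphism.clone _ _ (k \o (kap \o tau)) _.
have rhoE f : rho f = k (kap (tau f)) by [].
have za : rho z = W by rewrite rhoE kz kW.
exists rho, (k (- c3)); split.
- exact: (coords_auto (coords_auto tauP kauto) ka2).
- by apply: rmorph_unit; rewrite fps_unitE fpsN oppr_eq0.
- by rewrite rhoE Eu rmorphM rmorphB rmorphM rmorphXn /= kX kY kW.
- split=> [f /C1_coord[g [h Ef]]|F [->|->]].
  + exists (k (- g * (c3 * s))), (k (h - g * (c2 * s * W ^+ m.-1))).
    transitivity (k ((- g * (c3 * s)) * Y' + (h - g * (c2 * s * W ^+ m.-1)) * W)).
      by rewrite rhoE Ef {1}YE; congr (k _); ring.
    by rewrite rmorphD !rmorphM /= kY kW.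
  + exists a, z, (k (- (c1 * r))), (k (- (c2 * r * W ^+ m.-1))).
    split; [exact: a_in_C1 | exact: z_in_C1 |].
    transitivity (k (- (c1 * r) * Y + - (c2 * r * W ^+ m.-1) * W)).
      by rewrite -[LHS]kY; congr (k _); rewrite /Y' WS; ring.
    by rewrite za rhoE ka rmorphD !rmorphM /= kW.
  exists z, z, 0, 1; split; [exact: z_in_C1 | exact: z_in_C1 |].
  by rewrite za mul0r add0r mul1r.
split=> [f /C2_coord[g [h Ef]]|F [->|->]].
- by exists (k g), (k h); rewrite rhoE Ef rmorphD !rmorphM /= kX kW.
- exists b, z, 1, 0; split; [exact: b_in_C2 | exact: z_in_C2 |].
  by rewrite rhoE kb kX mul1r mul0r addr0.
exists z, z, 0, 1; split; [exact: z_in_C2 | exact: z_in_C2 |].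
by rewrite za mul0r add0r mul1r.
Qed.

End CommonParameter.
End Pair.

(** * The general surface *)

Lemma form_functional (K : fieldType) d (l : {mpoly K[4]} -> K) :
  (forall f g, l (f + g) = l f + l g) -> (forall c f, l (c *: f) = c * l f) ->
  exists2 L : {mpoly K[#|{: 'X_{1..4 < d.+1}}|]}, L \is 1.-homog
    & forall F, F \is d.-homog -> L.@[@form_coeffs K d F] = l F.
Proof.
move=> lD lZ; have l0 : l 0 = 0 by rewrite -(scale0r 0) lZ mul0r.
exists (\sum_i l 'X_[enum_val i : 'X_{1..4 < d.+1}] *: 'X_i) => [|F hF].
  by apply: rpred_sum => i _; apply: rpredZ; rewrite dhomogX /= mdeg1.
have Fd : (msize F <= d.+1)%N.
  rewrite msizeE; apply/bigmax_leqP_seq => m mF _.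
  by rewrite ltnS; move/dhomogP: hF => /(_ m mF) ->.
rewrite {2}(mpolywE Fd) raddf_sum /=; symmetry.
transitivity (\sum_(m : 'X_{1..4 < d.+1}) F@_m * l 'X_[m]).
  by elim/big_rec2: _ => [|m x y _ <-]; rewrite ?lD ?lZ.
rewrite (reindex (@enum_val {: 'X_{1..4 < d.+1}} predT)) /=; last first.
  by apply: onW_bij; apply: enum_val_bij.
by apply: eq_bigr => i _; rewrite mevalZ mevalXU mulrC.
Qed.

(** Fractions [f1 / g1 = f2 / g2] representing the germ, with [f1] in [I] and [f2]
    in [J], give the form [f1 g2 = f2 g1] in both ideals; powers of [X_i0], whose
    dehomogenisation is [1], adjust the degree. *)
Lemma common_form (K : fieldType) (P : ppoint K) (i0 : 'I_4)
  (Pi0 : ~ pt_ideal P 'X_i0) (I J : set {mpoly K[4]}) (x : stalk P) :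
  is_ideal I -> is_ideal J -> stalk_ideal I x -> stalk_ideal J x ->
  exists d0, forall d, (d0 <= d)%N -> exists F y e,
    [/\ (I `&` J) F, F \is d.-homog, theta Pi0 F = x * y & y * e = 1].
Proof.
move=> II JI [d1 [f1 [g1 [If1 hf1 hg1 Pg1 E1]]]] [d2 [f2 [g2 [Jf2 hf2 hg2 Pg2 E2]]]].
have [_ _ IM] := II; have [_ _ JM] := JI.
have Ef : f1 * g2 = f2 * g1.
  apply: tofrac_inj; rewrite !rmorphM /=.
  by apply: (cross_mul (pt_neq0 Pg1) (pt_neq0 Pg2)); rewrite -E1 -E2.
exists (d1 + d2)%N => d dd; have [y1 gy1] := theta_unit Pi0 hg1 Pg1.
have [y2 gy2] := theta_unit Pi0 hg2 Pg2.
exists (f1 * g2 * 'X_i0 ^+ (d - (d1 + d2))), (theta Pi0 g1 * theta Pi0 g2), (y1 * y2); split.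
- by split; rewrite mulrC; [apply: (IM) | rewrite Ef; apply: (JM)]; rewrite mulrC; [apply: (IM)|apply: (JM)].
- rewrite -[X in X.-homog](subnKC dd); apply: dhomogM; last exact: Xexp_homog.
  exact: dhomogM.
- rewrite !rmorphM rmorphXn /= theta_X0 expr1n mulr1 mulrA.
  by rewrite (germ_theta Pi0 hf1 hg1 Pg1 E1).
by rewrite mulrACA gy1 gy2 mulr1.
Qed.

Section General.
Variables (K : fieldType) (p : 'rV[K]_4) (hp : p != 0) (i0 : 'I_4).
Hypothesis pi0 : p 0 i0 != 0.
Local Notation S := {mpoly K[4]}.
Local Notation P := (cpoint hp).
Local Notation O := (stalk P).
Local Notation M := (@nonunits O).
Local Notation Pi0 := (cpoint_X0 (hp := hp) pi0).
Local Notation theta := (theta Pi0).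
Local Notation tau := (tau (hp := hp) i0).
Local Notation germs I := (@stalk_ideal K I P).
Implicit Types (F f g : S).

Lemma principal_germs F d : F \is d.-homog ->
  forall x, germs (ideal_span [set F]) x <-> exists y, x = theta F * y.
Proof.
move=> hF x; have spI := is_ideal_span [set F]; split.
  move=> /(stalk_idealP Pi0 x spI)[e [f [g [/ideal_span1[q ->] hf hg Pg E]]]].
  have [y gy] := theta_unit Pi0 hg Pg; exists (theta q * y).
  by rewrite -[x]mulr1 -gy mulrA E rmorphM mulrA.
move=> [y ->]; rewrite mulrC; have [_ _ JM] := stalk_ideal_ideal Pi0 spI.
apply: (JM); apply: (stalk_ideal_theta Pi0 spI hF).
exact: sub_ideal_span.
Qed.

Definition opposite_class_surface n (C1 C2 : set S) F :=
  Ak_singularity F P n.-1 /\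
  exists phi : {additive class_group (complete_local_ring (ideal_span [set F]) P) -> Zmod n},
    [/\ bijective phi,
        exists2 c1, is_class_of (completed_ideal (F := F) C1) c1 & phi c1 = Zmod_proj n 1
      & exists2 c2, is_class_of (completed_ideal (F := F) C2) c2
          & phi c2 = Zmod_proj n (- 1)].

Lemma normal_form_classes n d (C1 C2 : set S) F (rho : {rmorphism O -> fps K 3}) (e : fps K 3) :
  (0 < n)%N -> F \is d.-homog -> coords (stalk_const P) rho -> e \is a GRing.unit ->
  rho (theta F) = e * Ak_eqn K n ->
  generates rho (germs C1) (fps_var K (inord 1)) (fps_var K (inord 2)) ->
  generates rho (germs C2) (fps_var K ord0) (fps_var K (inord 2)) ->
  opposite_class_surface n C1 C2 F.
Proof.
case: n => // k _ hF rc eu rF gen1 gen2; have IE := principal_germs hF; split.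
  exact: (completed_Ak rc eu rF IE).
exact: (completed_class rc eu rF IE gen1 gen2).
Qed.

Lemma theta_scale c f : theta (c *: f) = stalk_const P c * theta f.
Proof. by rewrite -mul_mpolyC rmorphM /=; congr (_ * _); rewrite /theta mmapC. Qed.

Variables (C1 C2 Z1 Z2 T1 T2 : set S) (m n : nat) (a u b v : O).
Hypotheses (B1 : branch tau (germs C1) (germs Z1) (germs T1) m a u).
Hypotheses (B2 : branch tau (germs C2) (germs Z2) (germs T2) n b v).
Hypotheses (ind1 : indep3 (tau a) (tau u) (tau b)) (ind2 : indep3 (tau b) (tau v) (tau a)).
Hypotheses (m0 : (0 < m)%N) (mn : (m <= n)%N) (ZI1 : is_ideal Z1) (ZI2 : is_ideal Z2).

(** The surface has the required form as soon as the coefficients at [x y] and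
    [z^n] of its local equation do not vanish; the germs [a b] and [z^n] show that
    these two linear conditions can be met in all large degrees. *)
Lemma general_opposite_classes : general_surface (Z1 `&` Z2) (opposite_class_surface n C1 C2).
Proof.
have tP := tau_coords hp pi0; have n0 : (0 < n)%N by apply: leq_trans mn.
have [z [Mz indz [t [c [c' [Tt cc' zE]]]] [d zE']]] := common_param tP B1 B2 ind1 ind2.
have [kap [kauto kb ka kz]] := coords3 ((tau_nonunit pi0 _).1 (surface_nonunit B2))
  ((tau_nonunit pi0 _).1 (surface_nonunit B1)) ((tau_nonunit pi0 _).1 Mz) indz.
have [kc _ _] := kauto.
pose e1 : 'X_{1..3} := (U_(ord0) + U_(inord 1))%MM.
pose e3 : 'X_{1..3} := (U_(inord 2) *+ n)%MM.
pose l e F : K := kap (tau (theta F)) e.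
have lD e f g : l e (f + g) = l e f + l e g by rewrite /l !rmorphD.
have lZ e k f : l e (k *: f) = k * l e f.
  by rewrite /l theta_scale !rmorphM /= tau_const kc fps_constM.
have [abZ1 abZ2] := ab_in B1 B2; have [znZ1 znZ2] := z_exp_in B1 B2 mn Tt zE zE'.
have [d1 form1] := common_form Pi0 ZI1 ZI2 abZ1 abZ2.
have [d2 form2] := common_form Pi0 ZI1 ZI2 znZ1 znZ2.
exists (maxn d1 d2) => D; rewrite geq_max => /andP[dD1 dD2].
have [L1 hL1 L1E] := form_functional D (lD e1) (lZ e1).
have [L3 hL3 L3E] := form_functional D (lD e3) (lZ e3).
exists 2%N, (L1 * L3); split; first exact: (dhomogM hL1 hL3).
  have [F1 [y1 [w1 [[F1Z1 F1Z2] hF1 E1 yw1]]]] := form1 D dD1.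
  have [F2 [y2 [w2 [[F2Z1 F2Z2] hF2 E2 yw2]]]] := form2 D dD2.
  have hF : F1 + F2 \is D.-homog by apply: rpredD.
  have unit0 (y w : O) : y * w = 1 -> kap (tau y) 0%MM != 0.
    move=> yw; have : kap (tau (y * w)) 0%MM = 1 by rewrite yw !rmorph1 fps1 eqxx.
    rewrite !rmorphM fpsM0 => /eqP; apply: contraTneq => ->.
    by rewrite mul0r eq_sym oner_eq0.
  have EF : kap (tau (theta (F1 + F2))) =
      (mono e1) * kap (tau y1) + (mono e3) * kap (tau y2).
    rewrite rmorphD /= E1 E2 !rmorphD !rmorphM !rmorphXn /= ka kb kz.
    by rewrite /e1 /e3 fps_monoD mono_exp !mono_var [X in X * _]mulrC.
  have l1 : l e1 (F1 + F2) != 0.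
    rewrite /l EF fpsD !fps_monoM lepm_refl mnm_subxx /e1 /e3 mnm3_le.
    rewrite !mnmDE !mulmnE !mnm1E !jE /= (_ : (1 * n <= 0 + 0)%N = false) ?addr0; last by lia.
    exact: unit0 yw1.
  have l3 : l e3 (F1 + F2) != 0.
    rewrite /l EF fpsD !fps_monoM lepm_refl mnm_subxx /e1 /e3 mnm3_le.
    rewrite !mnmDE !mulmnE !mnm1E !jE /= add0r.
    exact: unit0 yw2.
  have [_ ZD1 _] := ZI1; have [_ ZD2 _] := ZI2.
  exists (F1 + F2); split=> //.
  - by split; [apply: (ZD1) | apply: (ZD2)].
  - by apply: contraNneq l1 => ->; rewrite /l !rmorph0 fps0.
  - by rewrite mevalM L1E // L3E // mulf_neq0.
move=> F [[FZ1 FZ2] hF _]; rewrite mevalM L1E // L3E // mulf_eq0 negb_or => /andP[l1 l3].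
have th1 := stalk_ideal_theta Pi0 ZI1 hF FZ1; have th2 := stalk_ideal_theta Pi0 ZI2 hF FZ2.
have [rho [e [rc eu rF gen1 gen2]]] :=
  normal_form tP B1 B2 m0 mn Tt cc' zE zE' kauto kb ka kz th1 th2 l1 l3.
exact: normal_form_classes n0 hF rc eu rF gen1 gen2.
Qed.
End General.

Lemma general_surface_through_union (K : fieldType)
    (C1 C2 Z1 Z2 S1 S2 : set {mpoly K[4]}) (h1 h2 : {mpoly K[4]})
    (m n : nat) (p : 'rV[K]_4) (hp : p != 0) :
  smooth_curve C1 -> smooth_curve C2 ->
  lies_on (cpoint hp) C1 -> lies_on (cpoint hp) C2 ->
  multiplicity_structure C1 Z1 m -> multiplicity_structure C2 Z2 n ->
  (m <= n)%N ->
  local_smooth_surface p h1 S1 -> contained_over h1 Z1 S1 ->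
  local_smooth_surface p h2 S2 -> contained_over h2 Z2 S2 ->
  ~ (tangent_space C1 p `<=` tangent_space S2 p) ->
  ~ (tangent_space C2 p `<=` tangent_space S1 p) ->
  general_surface (Z1 `&` Z2) (opposite_class_surface hp n C1 C2).
Proof.
move=> sm1 sm2 pC1 pC2 mult1 mult2 mn surf1 cont1 surf2 cont2 tan1 tan2.
have [i0 pi0] : exists i0, p 0 i0 != 0 by apply/rV0Pn.
have [[Ch1 _] _] := sm1; have [[Ch2 _] _] := sm2.
have [a [u B1]] := branch_ex pi0 sm1 pC1 mult1 surf1 cont1.
have [b [v B2]] := branch_ex pi0 sm2 pC2 mult2 surf2 cont2.
have [TZ1 ZM1] := surface_through pi0 pC1 mult1 surf1 cont1.
have [TZ2 ZM2] := surface_through pi0 pC2 mult2 surf2 cont2.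
have TM1 := subset_trans TZ1 ZM1; have TM2 := subset_trans TZ2 ZM2.
have CM1 := (lies_on_germs hp pi0 Ch1).1 pC1; have CM2 := (lies_on_germs hp pi0 Ch2).1 pC2.
have [_ _ Th1 _] := surf1; have [_ _ Th2 _] := surf2.
have [[[ZI1 _] _] _ _ _] := mult1; have [[[ZI2 _] _] _ _ _] := mult2.
have ind1 := transverse pi0 Ch1 CM1 Th2 TM2 (surface_eqn B2) (surface_nonunit B2) B1 tan1.
have ind2 := transverse pi0 Ch2 CM2 Th1 TM1 (surface_eqn B1) (surface_nonunit B1) B2 tan2.
have mpos := branch_pos ZM1 B1.
exact: (general_opposite_classes pi0 B1 B2 ind1 ind2 mpos mn ZI1 ZI2).
Qed.

Theorem proposition3p4 (R : realType)
    (C1 C2 Z1 Z2 S1 S2 : set {mpoly R[i][4]}) (h1 h2 : {mpoly R[i][4]})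
    (m n : nat) (p : 'rV[R[i]]_4) (hp : p != 0) :
  smooth_curve C1 -> smooth_curve C2 ->
  lies_on (cpoint hp) C1 -> lies_on (cpoint hp) C2 ->
  multiplicity_structure C1 Z1 m -> multiplicity_structure C2 Z2 n ->
  (m <= n)%N ->
  local_smooth_surface p h1 S1 -> contained_over h1 Z1 S1 ->
  local_smooth_surface p h2 S2 -> contained_over h2 Z2 S2 ->
  ~ (tangent_space C1 p `<=` tangent_space S2 p) ->
  ~ (tangent_space C2 p `<=` tangent_space S1 p) ->
  general_surface (Z1 `&` Z2) (fun F =>
    Ak_singularity F (cpoint hp) n.-1 /\
    exists phi : {additive
        class_group (complete_local_ring (ideal_span [set F]) (cpoint hp))
          -> Zmod n},
      [/\ bijective phi,
          exists2 c1, is_class_of (completed_ideal (F := F) C1) c1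
            & phi c1 = Zmod_proj n 1
        & exists2 c2, is_class_of (completed_ideal (F := F) C2) c2
            & phi c2 = Zmod_proj n (- 1)]).
Proof. exact: general_surface_through_union. Qed.
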